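(* Let $M$ be a three-dimensional manifold and let $\mathcal{S}=(\Delta,\langle\cdot,\cdot\rangle)$ be an oriented sub-riemannian surface in $M$ whose distribution $\Delta$ is a (non-integrable) contact distribution. Let $B_2\to M$ be the reduced bundle of adapted coframes of $\mathcal{S}$, with structure group $$G_2=\left\{\begin{pmatrix}\cos\varphi&-\sin\varphi&0\\ \sin\varphi&\cos\varphi&0\\0&0&1\end{pmatrix} : \varphi\in\mathbb{R}\right\},$$ and let $\theta^1,\theta^2,\theta^3$ be the tautological $1$-forms on $B_2$. Then there are a $1$-form $\alpha$ on $B_2$, for which the matrix of $1$-forms below is a pseudoconnection form on $B_2$, and smooth functions $a_1,a_2$ on $B_2$ such that $$ \begin{pmatrix} d\theta^{1}\\ d\theta^{2}\\ d\theta^{3}\end{pmatrix} = \begin{pmatrix} 0 & \alpha & 0 \\ -\alpha & 0 & 0 \\ 0 & 0 & 0 \end{pmatrix} \wedge \begin{pmatrix} \theta^{1}\\ \theta^{2}\\ \theta^{3}\end{pmatrix} + \begin{pmatrix} a_1 & a_2 & 0 \\ a_2 & -a_1 & 0 \\ 0 & 0 & 1 \end{pmatrix} \begin{pmatrix} \theta^{2}\wedge\theta^{3}\\ \theta^{3}\wedge\theta^{1}\\ \theta^{1}\wedge\theta^{2}\end{pmatrix}, $$ and the function $\mathcal{M}=(a_1)^2+(a_2)^2$ is a differential invariant of $\mathcal{S}$.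
   Context: All objects are smooth. A $2$-dimensional distribution $\Delta$ on $M$ is a rank $2$ smooth subbundle of $TM$. A sub-riemannian surface $\mathcal{S}=(\Delta,\langle\cdot,\cdot\rangle)$ in $M$ is a non-holonomic $2$-dimensional distribution $\Delta$ (i.e. $[X_1,X_2](p)\notin\Delta_p$ at every $p$ for local vector fields $X_1,X_2$ spanning $\Delta$) with a smoothly varying scalar product on each $\Delta_p$; it is oriented if $\Delta$ is oriented. The non-integrable contact condition is that locally $\Delta=\ker\eta^3$ for a $1$-form $\eta^3$ with $d\eta^3\wedge\eta^3\neq 0$ everywhere. A coframe $\eta=(\eta^1,\eta^2,\eta^3)$ at $p\in M$ is adapted to $\mathcal{S}$ if: (1) $(\eta^1|_{\Delta_p},\eta^2|_{\Delta_p})$ is a positively oriented coframe of $\Delta_p$; (2) $\eta^3(W)=0$ for all $W\in\Delta_p$; (3) $\langle W,W\rangle=[\eta^1(W)]^2+[\eta^2(W)]^2$ for all $W\in\Delta_p$. Let $\pi:B_0\to M$ be the bundle of all adapted coframes; matrices $g$ in the group $$G_0=\left\{\begin{pmatrix}\cos\varphi_1&-\sin\varphi_1&\varphi_2\\ \sin\varphi_1&\cos\varphi_1&\varphi_3\\0&0&\varphi_4\end{pmatrix} : \varphi_4\neq 0\right\}$$ act on it on the right by $R_g\eta=g^{-1}\eta$ ($\eta$ viewed as a column). The tautological $1$-forms $\theta^i$ on $B_0$ are given by $\theta^i_\eta(X)=\eta^i(d\pi(X))$ for $X\in T_\eta B_0$; the tautological forms on a subbundle of $B_0$ are their restrictions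 (pullbacks). The function $T^3_{12}$ on $B_0$ is defined by $d\theta^3\wedge\theta^3=T^3_{12}\,\theta^1\wedge\theta^2\wedge\theta^3$, and $B_1=\{\eta\in B_0 : T^3_{12}(\eta)=1\}$, a principal subbundle with group the subgroup $G_1\subset G_0$ given by $\varphi_4=1$. On $B_1$ one has $d\theta^3=T^3_{23}\,\theta^2\wedge\theta^3+T^3_{31}\,\theta^3\wedge\theta^1+\theta^1\wedge\theta^2$, which defines the functions $T^3_{23},T^3_{31}$ on $B_1$. Then $B_2=\{\eta\in B_1 : T^3_{23}(\eta)=T^3_{31}(\eta)=0\}$, a principal subbundle with group $G_2$. A pseudoconnection form on $B_2$ is a $1$-form $\omega$ on $B_2$ with values in the Lie algebra $\mathfrak{g}_2$ of $G_2$ such that $\omega(\sigma(a))=a$ for every $a\in\mathfrak{g}_2$, where $\sigma(a)$ is the fundamental vertical vector field on $B_2$ generated by $a$ through the right action. The wedge product of a matrix of $1$-forms with a column of $1$-forms is the matrix product with multiplication of entries replaced by $\wedge$. That $\mathcal{M}$ is a differential invariant of $\mathcal{S}$ means: $\mathcal{M}$ is constant on the fibres of $B_2\to M$, hence defines a function $\mathcal{M}_{\mathcal{S}}$ on $M$ determined by $\mathcal{S}$; and if $f:M\to M'$ is a diffeomorphism carrying $\mathcal{S}$ to an oriented contact sub-riemannian surface $\mathcal{S}'$ in $M'$ (i.e. $df$ maps $\Delta$ onto $\Delta'$ preserving orientations and scalar products), then $\mathcal{M}_{\mathcal{S}'}\circ f=\mathcal{M}_{\mathcal{S}}$.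
   Formalization: The fundamental field σ(a) is taken with the opposite sign, as the velocity of R_{exp(ta)^{-1}}η = exp(ta)η, because with the usual sign the displayed equations and R_gη = g^{-1}η force ω(σ(a)) = -a. *)

(* Defs.v *)
From HB Require Import structures.
From mathcomp Require Import all_boot all_order all_algebra.
From mathcomp Require Import ring.
From mathcomp Require Import all_classical all_reals all_analysis.

Set Implicit Arguments.
Unset Strict Implicit.
Unset Printing Implicit Defensive.

Import Order.TTheory GRing.Theory Num.Theory numFieldNormedType.Exports.

Local Open Scope classical_set_scope.
Local Open Scope ring_scope.

Section SmoothEuclidean.
Variables (R : realType) (n : nat).

(* f is of class C^k on the open set V: all iterated directional derivatives
   of order at most k exist and are continuous on V. *)
Fixpoint Ck (k : nat) (V : set 'rV[R]_n) (f : 'rV[R]_n -> R) : Prop :=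
  (forall x, V x -> {for x, continuous f}) /\
  match k with
  | 0 => True
  | k'.+1 => forall v, (forall x, V x -> derivable f x v) /\ Ck k' V ('D_v f)
  end.

Definition smooth_on (V : set 'rV[R]_n) (f : 'rV[R]_n -> R) :=
  forall k, Ck k V f.

Lemma Ck_continuous k (V : set 'rV[R]_n) f :
  Ck k V f -> forall x, V x -> {for x, continuous f}.
Proof. by case: k => [|k] []. Qed.

Lemma CkW k (V : set 'rV[R]_n) f : Ck k.+1 V f -> Ck k V f.
Proof.
elim: k f => [|k IHk] f [fC fD]; first by split.
by split=> // v; have [fd /IHk] := fD v.
Qed.

Lemma eq_Ck k (V : set 'rV[R]_n) f g : open V ->
  (forall x, V x -> f x = g x) -> Ck k V f -> Ck k V g.
Proof.
move=> oV; elim: k f g => [|k IHk] f g fg [fC fD].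
all: have nfg x : V x -> \forall y \near x, f y = g y.
1,3: by move=> Vx; near=> y; apply: fg; near: y; apply: open_nbhs_nbhs.
all: have ngf x : V x -> \forall y \near x, g y = f y.
1,3: by move=> /nfg; apply: filterS.
all: split=> //.
1,2: move=> x Vx; suff : g @ x --> f x by rewrite (fg x Vx).
1,2: move=> A /(fC x Vx).
1,2: by apply: filterS2 (ngf x Vx) => y /= ->.
move=> v; have [fd /IHk fDk] := fD v; split.
  by move=> x Vx; apply: near_eq_derivable (nfg x Vx) (fd x Vx).
by apply: fDk => x Vx; exact: near_eq_derive (nfg x Vx).
Unshelve. all: by end_near. Qed.

Lemma Ck_cst k (V : set 'rV[R]_n) (c : R) : Ck k V (fun=> c).
Proof.
elim: k c => [|k IHk] c; split=> //; try by move=> x _; exact: cst_continuous.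
move=> v; split=> [x _|]; first exact: derivable_cst.
suff -> : 'D_v (fun=> c) = (fun=> 0) :> ('rV[R]_n -> R) by [].
by apply/funext => x; exact: derive_cst.
Qed.

Lemma CkD k (V : set 'rV[R]_n) f g : open V ->
  Ck k V f -> Ck k V g -> Ck k V (fun x => f x + g x).
Proof.
move=> oV; elim: k f g => [|k IHk] f g [fC fD] [gC gD]; split=> //.
1,2: by move=> x Vx; apply: continuousD; [exact: fC|exact: gC].
move=> v; have [fd fDk] := fD v; have [gd gDk] := gD v; split.
  by move=> x Vx; apply: derivableD; [exact: fd|exact: gd].
apply: eq_Ck (IHk _ _ fDk gDk) => // x Vx.
by rewrite [RHS](deriveD (fd x Vx) (gd x Vx)).
Qed.

Lemma CkM k (V : set 'rV[R]_n) f g : open V ->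
  Ck k V f -> Ck k V g -> Ck k V (fun x => f x * g x).
Proof.
move=> oV; elim: k f g => [|k IHk] f g fk gk; move: (fk) (gk);
  move=> [fC fD] [gC gD]; split=> //.
1,2: by move=> x Vx; apply: continuousM; [exact: fC|exact: gC].
move=> v; have [fd fDk] := fD v; have [gd gDk] := gD v; split.
  by move=> x Vx; apply: derivableM; [exact: fd|exact: gd].
have fgk := IHk _ _ (CkW fk) gDk; have gfk := IHk _ _ (CkW gk) fDk.
apply: eq_Ck (CkD oV fgk gfk) => // x Vx.
by rewrite [RHS](deriveM (fd x Vx) (gd x Vx)).
Qed.

Lemma Ck_coord k (V : set 'rV[R]_n) (i : 'I_n) : Ck k V (fun x => x ord0 i).
Proof.
case: k => [|k]; split=> //; try by move=> x _; exact: coord_continuous.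
move=> v.
have E (x : 'rV[R]_n) : (fun h : R => h^-1 *:
    (((fun y : 'rV[R]_n => y ord0 i) \o shift x) (h *: v) - x ord0 i : R))
  @ 0^' --> (v ord0 i : R).
  apply: cvg_near_cst; near=> h; rewrite /= !mxE addrK.
  by rewrite /GRing.scale /= mulKf//; near: h; exact: nbhs_dnbhs_neq.
split=> [x _|]; first by apply/cvg_ex; exists (v ord0 i); exact: E.
suff -> : 'D_v (fun x : 'rV[R]_n => x ord0 i) = fun=> v ord0 i.
  exact: Ck_cst.
by apply/funext => x; exact: cvg_lim (E x).
Unshelve. all: by end_near. Qed.

End SmoothEuclidean.

Lemma Ck_linear (R : realType) m n k (V : set 'rV[R]_n)
    (L : {linear 'rV[R]_m -> 'rV[R]_n}) f :
  continuous L -> Ck k V f -> Ck k (L @^-1` V) (f \o L).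
Proof.
move=> cL; elim: k f => [|k IHk] f [fC fD]; split=> //.
1,2: by move=> x Vx; apply: continuous_comp; [exact: cL|exact: fC].
move=> v; have [fd fDk] := fD (L v).
have E x : (fun h : R => h^-1 *: ((f \o L \o shift x) (h *: v) - (f \o L) x))
  = (fun h : R => h^-1 *: ((f \o shift (L x)) (h *: L v) - f (L x))).
  by apply/funext => h /=; rewrite linearP.
split=> [x Vx|]; first by rewrite /derivable E; exact: fd.
suff -> : 'D_v (f \o L) = 'D_(L v) f \o L by exact: IHk.
by apply/funext => x; rewrite /= /derive E.
Qed.


(* A set with its algebra of smooth real functions.  Manifolds, the
   bundles of coframes over them and their subbundles are all handled through
   this algebra: tangent vectors are derivations. *)
Record smoothSpace (R : realType) := SmoothSpace {
  carrier :> Type;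
  Cinf : set (carrier -> R);
  Cinf_cst : forall c, Cinf (fun=> c);
  CinfD : forall f g, Cinf f -> Cinf g -> Cinf (fun x => f x + g x);
  CinfM : forall f g, Cinf f -> Cinf g -> Cinf (fun x => f x * g x) }.

Arguments Cinf {R} _.

Record smoothMap (R : realType) (X Y : smoothSpace R) := SmoothMap {
  smooth_map :> X -> Y;
  smooth_mapP : forall f, Cinf Y f -> Cinf X (f \o smooth_map) }.

(* The smooth structure generated by a family G: locally, for the topology
   induced by G, a function is a smooth function of finitely many members
   of G. *)
Section Generated.
Variables (R : realType) (X : Type) (G : set (X -> R)).

Definition generated : set (X -> R) := [set f | forall p : X,
  exists (k : nat) (g : 'I_k -> X -> R) (F : 'rV[R]_k -> R) (e : R),
    [/\ forall i, G (g i), smooth_on setT F, 0 < e &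
      forall x, (forall i, `|g i x - g i p| < e) -> f x = F (\row_i g i x)]].

Lemma generated_incl : G `<=` generated.
Proof.
move=> g Gg p; exists 1%N, (fun=> g), (fun x => x ord0 ord0), 1.
by split=> // [k|x _]; [exact: Ck_coord | rewrite mxE].
Qed.

Lemma generated_cst c : generated (fun=> c).
Proof.
move=> p; exists 0%N, (fun=> fun=> 0), (fun=> c), 1.
by split=> // [[]//|k]; exact: Ck_cst.
Qed.

Let reindex m n (h : 'I_n -> 'I_m) (x : 'rV[R]_m) : 'rV[R]_n :=
  \row_i x ord0 (h i).

Lemma smooth_reindex m n (h : 'I_n -> 'I_m) (F : 'rV[R]_n -> R) :
  smooth_on setT F -> smooth_on setT (F \o reindex h).
Proof.
have lin : linear (reindex h) by move=> c x y; apply/rowP => i; rewrite !mxE.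
pose lL := GRing.isLinear.Build _ _ _ _ _ lin.
pose L : {linear 'rV[R]_m -> 'rV[R]_n} := HB.pack (reindex h) lL.
move=> sF k; apply: (@Ck_linear _ m n k setT L F _ (sF k)).
move=> x A /nbhs_ballP[e /= e0 eA]; apply/nbhs_ballP; exists e => //= y [_ xy].
by apply: eA; split=> // i j; rewrite !mxE; exact: xy.
Qed.

Lemma generated_op (op : R -> R -> R)
    (opS : forall n (F1 F2 : 'rV[R]_n -> R), smooth_on setT F1 ->
      smooth_on setT F2 -> smooth_on setT (fun x => op (F1 x) (F2 x))) f1 f2 :
  generated f1 -> generated f2 -> generated (fun x => op (f1 x) (f2 x)).
Proof.
move=> f1G f2G p; have [k1 [g1 [F1 [e1 [G1 S1 e1_gt0 E1]]]]] := f1G p.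
have [k2 [g2 [F2 [e2 [G2 S2 e2_gt0 E2]]]]] := f2G p.
pose g (i : 'I_(k1 + k2)) :=
  match fintype.split i with inl j => g1 j | inr j => g2 j end.
have gl j : g (lshift k2 j) = g1 j by rewrite /g (unsplitK (inl j)).
have gr j : g (rshift k1 j) = g2 j by rewrite /g (unsplitK (inr j)).
exists (k1 + k2)%N, g, (fun x => op ((F1 \o reindex (@lshift k1 k2)) x)
  ((F2 \o reindex (@rshift k1 k2)) x)), (Num.min e1 e2); split.
- by move=> i; rewrite /g; case: fintype.split.
- by apply: opS; exact: smooth_reindex.
- by rewrite lt_min e1_gt0.
move=> x xp; rewrite E1 ?E2.
- congr (op (F1 _) (F2 _)); apply/rowP => i; first by rewrite !mxE gl.
  by rewrite !mxE gr.
- by move=> i; have := xp (rshift k1 i); rewrite gr lt_min => /andP[].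
- by move=> i; have := xp (lshift k2 i); rewrite gl lt_min => /andP[].
Qed.

Lemma generatedD f g :
  generated f -> generated g -> generated (fun x => f x + g x).
Proof.
apply: generated_op => n F1 F2 S1 S2 k.
by apply: CkD => //; exact: openT.
Qed.

Lemma generatedM f g :
  generated f -> generated g -> generated (fun x => f x * g x).
Proof.
apply: generated_op => n F1 F2 S1 S2 k.
by apply: CkM => //; exact: openT.
Qed.

Definition generated_space : smoothSpace R :=
  SmoothSpace generated_cst generatedD generatedM.

End Generated.

(* A subset with the induced structure: its smooth functions are locally
   restrictions of ambient smooth functions. *)
Definition subspace_gen (R : realType) (X : smoothSpace R) (P : X -> Prop) :
  set ({x : X | P x} -> R) := [set g \o sval | g in Cinf X].

Arguments subspace_gen {R X} P _.

Definition subSpace (R : realType) (X : smoothSpace R) (P : X -> Prop) :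
  smoothSpace R := generated_space (subspace_gen P).

Arguments subSpace {R X} P.

Definition incl (R : realType) (X : smoothSpace R) (P : X -> Prop) :
  smoothMap (subSpace P) X.
Proof.
apply: (@SmoothMap _ (subSpace P) X sval) => f fX.
by apply: generated_incl; exists f.
Defined.

Record chart (R : realType) (T : topologicalType) (n : nat) := Chart {
  dom : set T;
  coord : T -> 'rV[R]_n;
  coord_inv : 'rV[R]_n -> T;
  dom_open : open dom;
  codom_open : open (coord @` dom);
  coordK : forall p, dom p -> coord_inv (coord p) = p;
  coord_cont : forall p, dom p -> {for p, continuous coord};
  coord_inv_cont : forall p, dom p -> {for coord p, continuous coord_inv} }.

(* Smoothness of a function or map does not depend on the atlas being maximal. *)
Record manifold (R : realType) (n : nat) := Manifold {
  mtop : topologicalType;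
  mtop_hausdorff : hausdorff_space mtop;
  mtop_countable : @second_countable mtop;
  atlas : set (chart R mtop n);
  atlas_cover : forall p : mtop, exists2 c, atlas c & dom c p;
  atlas_smooth : forall c c', atlas c -> atlas c' -> forall i : 'I_n,
    smooth_on (coord c @` (dom c `&` dom c'))
      (fun x => coord c' (coord_inv c x) ord0 i) }.

Section ManifoldFunctions.
Variables (R : realType) (n : nat) (M : manifold R n).

Definition mCinf : set (mtop M -> R) := [set f : mtop M -> R | forall c,
  @atlas R n M c -> smooth_on (coord c @` dom c) (f \o coord_inv c)].

Lemma mCinf_cst a : mCinf (fun=> a).
Proof. by move=> c _ k; exact: Ck_cst. Qed.

Lemma mCinfD f g : mCinf f -> mCinf g -> mCinf (fun x => f x + g x).
Proof.
by move=> fC gC c cA k; apply: CkD; [exact: codom_open | exact: fC | exact: gC].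
Qed.

Lemma mCinfM f g : mCinf f -> mCinf g -> mCinf (fun x => f x * g x).
Proof.
by move=> fC gC c cA k; apply: CkM; [exact: codom_open | exact: fC | exact: gC].
Qed.

Definition mspace : smoothSpace R := SmoothSpace mCinf_cst mCinfD mCinfM.

End ManifoldFunctions.

Coercion mspace : manifold >-> smoothSpace.

Section Tangent.
Variables (R : realType) (X : smoothSpace R).

(* Derivations of the smooth functions at p.  The value on a function which is
   not smooth is meaningless, and set to 0 so that two tangent vectors are equal
   as soon as they agree on smooth functions. *)
Definition derivation (p : X) (v : (X -> R) -> R) :=
  [/\ forall c f g, Cinf X f -> Cinf X g ->
        v (fun x => c * f x + g x) = c * v f + v g,
      forall f g, Cinf X f -> Cinf X g ->
        v (fun x => f x * g x) = f p * v g + g p * v f &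
      forall f, ~ Cinf X f -> v f = 0].

Definition is_tangent (p : X) : {pred (X -> R) -> R} :=
  fun v => `[< derivation p v >].

Lemma is_tangent_submod p : submod_closed (is_tangent p).
Proof.
split=> [|a u v /asboolP[uL uM u0] /asboolP[vL vM v0]]; apply/asboolP.
  by split=> [c f g _ _|f g _ _|//]; rewrite /= ?mulr0 ?addr0.
split=> [c f g fX gX|f g fX gX|f fX]; rewrite !fctE.
- by rewrite uL// vL// /GRing.scale /= !mulrDr addrACA !(mulrCA a c).
- by rewrite uM// vM// /GRing.scale /= !mulrDr addrACA !(mulrCA a).
- by rewrite u0// v0// scaler0 addr0.
Qed.

HB.instance Definition _ p :=
  GRing.isSubmodClosed.Build R ((X -> R) -> R) (is_tangent p)
    (is_tangent_submod p).

Record tangent (p : X) := Tangent {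
  tvec :> (X -> R) -> R;
  tvecP : tvec \in is_tangent p }.

HB.instance Definition _ p := [isSub for @tvec p].
HB.instance Definition _ p := [Choice of tangent p by <:].
HB.instance Definition _ p := [SubChoice_isSubLmodule of tangent p by <:].

End Tangent.

Arguments tangent {R} X p.

Section Fields.
Variables (R : realType) (X : smoothSpace R).

Lemma tangentP p (v : tangent X p) : derivation p v.
Proof. by apply/asboolP; exact: tvecP. Qed.

Lemma tangent_cst p (v : tangent X p) (c : R) : v (fun=> c) = 0.
Proof.
have [vL vM _] := tangentP v.
have v1 : v (fun=> 1) = 0.
  have := vM _ _ (Cinf_cst X 1) (Cinf_cst X 1).
  rewrite (_ : (fun=> 1 * 1) = fun=> 1 :> R); last by rewrite mulr1.
  by rewrite !mul1r => /eqP; rewrite -subr_eq subrr eq_sym => /eqP.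
have := vL c _ _ (Cinf_cst X 1) (Cinf_cst X 0).
rewrite (_ : (fun=> c * 1 + 0) = fun=> c :> R); last by rewrite mulr1 addr0.
move=> ->; rewrite v1 mulr0 add0r.
have := vL (-1) _ _ (Cinf_cst X 1) (Cinf_cst X 1).
by rewrite mulr1 addNr v1 mulr0 add0r.
Qed.

Record vfield := VField {
  vf :> forall p, tangent X p;
  vf_smooth : forall f, Cinf X f -> Cinf X (fun p => vf p f) }.

Section Bracket.
Variables V W : vfield.

Definition bracket_fun (p : X) (f : X -> R) : R :=
  V p (fun q => W q f) - W p (fun q => V q f).

Lemma bracket_tangent p : bracket_fun p \in is_tangent p.
Proof.
have [VL VM _] := tangentP (V p); have [WL WM _] := tangentP (W p).
have sV := @vf_smooth V; have sW := @vf_smooth W.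
apply/asboolP; split=> [c f g fX gX|f g fX gX|f fX]; rewrite /bracket_fun.
- rewrite (_ : (fun q => W q _) = fun q => c * W q f + W q g); last first.
    by apply/funext => q; have [-> //] := tangentP (W q).
  rewrite (_ : (fun q => V q _) = fun q => c * V q f + V q g); last first.
    by apply/funext => q; have [-> //] := tangentP (V q).
  rewrite VL ?WL; try by [exact: sV|exact: sW].
  by rewrite opprD addrACA mulrBr.
- rewrite (_ : (fun q => W q _) = fun q => f q * W q g + g q * W q f);
    last first.
    by apply/funext => q; have [_ -> //] := tangentP (W q).
  rewrite (_ : (fun q => V q _) = fun q => f q * V q g + g q * V q f);
    last first.
    by apply/funext => q; have [_ -> //] := tangentP (V q).
  have LD (u : tangent X p) h k : Cinf X h -> Cinf X k ->
      u (fun q => h q + k q) = u h + u k.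
    move=> hX kX; have [uL _ _] := tangentP u.
    have := uL 1 h k hX kX; rewrite mul1r => <-.
    by congr (u _); apply/funext => q; rewrite mul1r.
  have [sVf sVg sWf sWg] := And4 (sV _ fX) (sV _ gX) (sW _ fX) (sW _ gX).
  rewrite !LD; try exact: CinfM.
  rewrite !VM ?WM //; ring.
- rewrite (_ : (fun q => W q f) = fun=> 0); last first.
    by apply/funext => q; have [_ _ ->] := tangentP (W q).
  rewrite (_ : (fun q => V q f) = fun=> 0); last first.
    by apply/funext => q; have [_ _ ->] := tangentP (V q).
  by rewrite !tangent_cst subrr.
Qed.

Lemma bracket_smooth f : Cinf X f -> Cinf X (fun p => bracket_fun p f).
Proof.
move=> fX; have VWf := vf_smooth V (vf_smooth W fX).
have WVf := vf_smooth W (vf_smooth V fX).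
rewrite (_ : (fun p => _) = fun p => V p (fun q => W q f) +
  -1 * W p (fun q => V q f)); last by apply/funext => p; rewrite mulN1r.
by apply: CinfD => //; apply: CinfM => //; exact: Cinf_cst.
Qed.

Definition bracket : vfield :=
  @VField (fun p => Tangent (bracket_tangent p)) bracket_smooth.

End Bracket.

(* Fields of covectors, and 2-forms evaluated on vector fields. *)
Definition form1 := forall p, tangent X p -> R.
Definition form2 := vfield -> vfield -> X -> R.
Definition form3 := vfield -> vfield -> vfield -> X -> R.

(* Smooth functions on a manifold can be multiplied by bump functions, so global
   vector fields suffice to test the smoothness of a form, here and for the
   local conditions below. *)
Definition smooth_form (b : form1) :=
  (forall p, scalar (b p)) /\
  forall V : vfield, Cinf X (fun p => b p (V p)).

(* Normalization without factorials: (b /\ c)(V, W) = b(V) c(W) - b(W) c(V), and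
   correspondingly no factor 1/2 in the exterior derivative. *)
Definition wedge (b c : form1) : form2 := fun V W p =>
  b p (V p) * c p (W p) - b p (W p) * c p (V p).

Definition wedge21 (b : form2) (c : form1) : form3 := fun V W Z p =>
  b V W p * c p (Z p) + b W Z p * c p (V p) + b Z V p * c p (W p).

Definition dform (b : form1) : form2 := fun V W p =>
  V p (fun q => b q (W q)) - W p (fun q => b q (V q)) - b p (bracket V W p).

End Fields.

Section Differential.
Variables (R : realType) (X Y : smoothSpace R) (phi : smoothMap X Y).

Definition dmap_fun p (v : tangent X p) (f : Y -> R) : R :=
  if `[< Cinf Y f >] then v (f \o phi) else 0.

Lemma dmap_tangent p (v : tangent X p) : dmap_fun v \in is_tangent (phi p).
Proof.
have [vL vM _] := tangentP v.
apply/asboolP; split=> [c f g fY gY|f g fY gY|f fY]; rewrite /dmap_fun.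
- have hY : Cinf Y (fun x => c * f x + g x).
    by apply: CinfD => //; apply: CinfM => //; exact: Cinf_cst.
  by rewrite !asboolT// -vL//; exact: smooth_mapP.
- by rewrite !asboolT//; [rewrite -vM//; exact: smooth_mapP | exact: CinfM].
- by rewrite asboolF.
Qed.

Definition dmap p (v : tangent X p) : tangent Y (phi p) :=
  Tangent (dmap_tangent v).

Definition pullback (b : form1 Y) : form1 X := fun p v => b (phi p) (dmap v).

End Differential.

Section SubRiemannian.
Variables (R : realType) (M : manifold R 3).

Definition plane_basis (p : M) (D : set (tangent M p)) (v w : tangent M p) :=
  (forall a b : R, a *: v + b *: w = 0 -> a = 0 /\ b = 0) /\
  D = [set u | exists a b : R, u = a *: v + b *: w].

Record subRiemannianSurface := SubRiemannianSurface {
  plane : forall p : M, set (tangent M p);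
  metric : forall p : M, tangent M p -> tangent M p -> R;
  (* the positively oriented bases of the plane at p *)
  orient : forall p : M, set (tangent M p * tangent M p);
  plane_smooth : forall p : M, exists V W : vfield M,
    \forall q \near (p : mtop M), plane_basis (@plane q) (V q) (W q);
  nonholonomic : forall (p : M) (V W : vfield M),
    (\forall q \near (p : mtop M), plane_basis (@plane q) (V q) (W q)) ->
    ~ plane (bracket V W p);
  metric_sym : forall p (v w : tangent M p), plane v -> plane w ->
    metric v w = metric w v;
  metric_linear : forall p (a : R) (u v w : tangent M p),
    plane u -> plane v -> plane w ->
    metric (a *: u + v) w = a * metric u w + metric v w;
  metric_pos : forall p (v : tangent M p), plane v -> v != 0 -> 0 < metric v v;
  metric_smooth : forall V W : vfield M,
    (forall p, plane (V p)) -> (forall p, plane (W p)) ->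
    Cinf M (fun p => metric (V p) (W p));
  orient_smooth : forall p : M, exists V W : vfield M,
    \forall q \near (p : mtop M), plane_basis (@plane q) (V q) (W q) /\
      @orient q = [set vw | exists a b c d : R,
        [/\ 0 < a * d - b * c, vw.1 = a *: V q + b *: W q &
            vw.2 = c *: V q + d *: W q]] }.

Arguments plane : clear implicits.
Arguments orient : clear implicits.

Definition contact (S : subRiemannianSurface) := forall p : M,
  exists2 b : form1 M, smooth_form b & \forall q \near (p : mtop M),
    plane S q = [set v | b q v = 0] /\
    exists V W Z : vfield M, wedge21 (dform b) b V W Z q <> 0.

Definition i1 : 'I_3 := @Ordinal 3 0 isT.
Definition i2 : 'I_3 := @Ordinal 3 1 isT.
Definition i3 : 'I_3 := @Ordinal 3 2 isT.

Record coframe := Coframe {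
  base : M;
  covec : 'I_3 -> tangent M base -> R }.

Arguments covec : clear implicits.

Definition is_coframe (h : coframe) :=
  (forall i, scalar (covec h i)) /\
  forall l : tangent M (base h) -> R, scalar l ->
    exists! c : 'rV[R]_3, forall v, l v = \sum_i c ord0 i * covec h i v.

Variable S : subRiemannianSurface.

Definition adapted (h : coframe) :=
  [/\ is_coframe h,
      forall v w, orient S (base h) (v, w) ->
        0 < covec h i1 v * covec h i2 w - covec h i1 w * covec h i2 v,
      forall w, plane S (base h) w -> covec h i3 w = 0 &
      forall w, plane S (base h) w ->
        metric S w w = covec h i1 w ^+ 2 + covec h i2 w ^+ 2].

(* The smooth structure of the bundle of coframes: it is generated by the
   functions of the base point and the components of the coframe on the vector
   fields of M. *)
Definition B0_gen : set ({h : coframe | adapted h} -> R) :=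
  [set f \o base \o sval | f in Cinf M] `|`
  [set F | exists (i : 'I_3) (V : vfield M),
     F = fun h => covec (sval h) i (V (base (sval h)))].

Definition B0 : smoothSpace R := generated_space B0_gen.

Definition piB0 : smoothMap B0 M.
Proof.
apply: (@SmoothMap _ B0 M (base \o sval)) => f fM.
by apply: generated_incl; left; exists f.
Defined.

Definition theta0 (i : 'I_3) : form1 B0 :=
  fun h X => covec (sval h) i (dmap piB0 X).

(* The unique t with d theta^3 /\ theta^3 = t theta^1 /\ theta^2 /\ theta^3 at h;
   vector fields on B0 realize all tangent vectors at h. *)
Definition T312 (h : B0) : R := xget 0 [set t : R | forall V W Z : vfield B0,
  wedge21 (dform (theta0 i3)) (theta0 i3) V W Z h =
  t * wedge21 (wedge (theta0 i1) (theta0 i2)) (theta0 i3) V W Z h].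

Definition B1 : smoothSpace R := subSpace (fun h : B0 => T312 h = 1).

Definition theta1 (i : 'I_3) : form1 B1 :=
  pullback (incl (fun h : B0 => T312 h = 1)) (theta0 i).

(* The coefficients (T^3_23, T^3_31): the form theta^3 satisfies such an
   equation at each point of B1, with exactly one pair of coefficients. *)
Definition T3 (h : B1) : R * R :=
  xget (0, 0) [set t : R * R | forall V W : vfield B1,
    dform (theta1 i3) V W h =
    t.1 * wedge (theta1 i2) (theta1 i3) V W h +
    t.2 * wedge (theta1 i3) (theta1 i1) V W h +
    wedge (theta1 i1) (theta1 i2) V W h].

Definition T323 (h : B1) : R := (T3 h).1.
Definition T331 (h : B1) : R := (T3 h).2.

Definition B2 : smoothSpace R :=
  subSpace (fun h : B1 => T323 h = 0 /\ T331 h = 0).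

Definition incl21 : smoothMap B2 B1 := incl _.

Definition theta (i : 'I_3) : form1 B2 := pullback incl21 (theta1 i).

Definition coframe_of (h : B2) : coframe := sval (sval (sval h)).

Definition piB2 (h : B2) : M := base (coframe_of h).

Definition mx3 (s : seq (seq R)) : 'M[R]_3 :=
  \matrix_(i, j) nth 0 (nth [::] s i) j.

(* exp (lie_G2 s) = rot s *)
Definition rot (s : R) : 'M[R]_3 :=
  mx3 [:: [:: cos s; - sin s; 0]; [:: sin s; cos s; 0]; [:: 0; 0; 1]].

Definition lie_G2 (s : R) : 'M[R]_3 :=
  mx3 [:: [:: 0; - s; 0]; [:: s; 0; 0]; [:: 0; 0; 0]].

(* The right action R_g of the structure group on coframes *)
Definition act (g : 'M[R]_3) (h : coframe) : coframe :=
  Coframe (fun i v => \sum_j invmx g i j * covec h j v).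

(* v is the fundamental vector at h generated by the matrix lie_G2 a, that is,
   the velocity at t = 0 of R_{exp(t lie_G2 a)^-1} h = exp(t lie_G2 a) h.
   The sign matters: since the projection to M kills v, contracting the structure
   equations below with v gives L_v theta = conn(v) theta, while the flow of v
   acts on theta by exp(t lie_G2 a); so conn(v) = lie_G2 a holds for this v.
   For the velocity of R_{exp(t lie_G2 a)} h one would get conn(v) = - lie_G2 a. *)
Definition fundamental (a : R) (h : B2) (v : tangent B2 h) :=
  exists2 c : R -> B2,
    forall t, coframe_of (c t) = act (invmx (rot (t * a))) (coframe_of h) &
    forall f, Cinf B2 f -> is_derive (0 : R) 1 (f \o c) (v f).

Definition mx_form := forall h : B2, tangent B2 h -> 'M[R]_3.

Definition pseudoconnection (w : mx_form) :=
  [/\ forall i j, smooth_form (fun h v => w h v i j),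
      forall h v, exists a, w h v = lie_G2 a &
      forall (a : R) (h : B2), exists2 v : tangent B2 h,
        fundamental a v & w h v = lie_G2 a].

Definition mx_wedge (w : mx_form) (b : 'I_3 -> form1 B2) (i : 'I_3) : form2 B2 :=
  fun V W h => \sum_j wedge (fun q v => w q v i j) (b j) V W h.

Definition theta2 (i : 'I_3) : form2 B2 :=
  nth (fun _ _ _ => 0) [:: wedge (theta i2) (theta i3);
    wedge (theta i3) (theta i1); wedge (theta i1) (theta i2)] i.

Definition conn (alpha : form1 B2) : mx_form := fun h v =>
  mx3 [:: [:: 0; alpha h v; 0]; [:: - alpha h v; 0; 0]; [:: 0; 0; 0]].

Definition torsion (a1 a2 : B2 -> R) (h : B2) : 'M[R]_3 :=
  mx3 [:: [:: a1 h; a2 h; 0]; [:: a2 h; - a1 h; 0]; [:: 0; 0; 1]].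

Definition structure_equations (alpha : form1 B2) (a1 a2 : B2 -> R) :=
  [/\ smooth_form alpha, pseudoconnection (conn alpha), Cinf B2 a1, Cinf B2 a2 &
      forall (i : 'I_3) (V W : vfield B2) (h : B2),
        dform (theta i) V W h = mx_wedge (conn alpha) theta i V W h +
          \sum_j torsion a1 a2 h i j * theta2 j V W h].

End SubRiemannian.

Arguments plane {R M} S p _ : rename.
Arguments orient {R M} S p _ : rename.
Arguments covec {R M} h _ _ : rename.

Definition is_isomorphism (R : realType) (M M' : manifold R 3)
    (S : subRiemannianSurface M) (S' : subRiemannianSurface M')
    (f : smoothMap M M') :=
  [/\ exists2 g : smoothMap M' M, cancel f g & cancel g f,
      forall p, [set dmap f v | v in plane S p] = plane S' (f p),
      forall p v w, plane S p v -> plane S p w ->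
        metric S' (dmap f v) (dmap f w) = metric S v w &
      forall p v w, orient S p (v, w) ->
        orient S' (f p) (dmap f v, dmap f w)].

(* Main.v *)
(* Near every point of M there are an oriented orthonormal frame (E1, E2) of the
   plane field and a vector field E3 whose dual coframe eta satisfies
   d eta^3 = eta^1 /\ eta^2.  No description of the tangent spaces by partial
   derivatives is needed for this: the contact form makes them spanned by E1, E2
   and [E1, E2].  Over such a neighbourhood an adapted coframe is A eta with A in
   G_0, and d theta = dA /\ eta + A d eta gives T^3_12 = A_33 on B_0 and
   (T^3_23, T^3_31) = (A_13, A_23) on B_1, so that A is a rotation (c, s) on B_2.
   With d eta^1 = p1 eta^23 + p2 eta^31 + p3 eta^12 and
   d eta^2 = q1 eta^23 + q2 eta^31 + q3 eta^12, the identity d(d eta^3) = 0 reads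
   p2 = q1, and
     alpha = c ds - s dc + p3 eta^1 + q3 eta^2 - (p1 + q2) / 2 eta^3
   satisfies the structure equations, the traceless symmetric torsion being the
   conjugate by the rotation of the one with entries (p1 - q2) / 2 and p2.
   Lifting vector fields of M along curves in the bundles shows that alpha, a1 and
   a2 are unique; hence they do not depend on the frame, and the invariant is the
   function ((p1 - q2) / 2)^2 + p2^2 of the base point.  An isomorphism
   transports frames with all their structure functions. *)

From HB Require Import structures.
From mathcomp Require Import all_boot all_order all_algebra.
From mathcomp Require Import ring lra.
From mathcomp Require Import all_classical all_reals all_analysis.
Require Import Defs.

Set Implicit Arguments.
Unset Strict Implicit.
Unset Printing Implicit Defensive.

Import Order.TTheory GRing.Theory Num.Theory numFieldNormedType.Exports.

Local Open Scope classical_set_scope.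
Local Open Scope ring_scope.

(** * Calculus of C^k functions *)

(** The obstacle is that nothing is known about the bundles beyond their algebras of functions: [B1]
    and [B2] are subsets cut out by values of [xget], without charts or local triviality. A formula
    in a frame holds only over part of M, so differentiating it takes a cutoff function that makes
    derivations local. Moreover, a coefficient defined by [xget] can be computed only if there are
    enough vector fields to test its equation. Such fields are obtained as velocities at t = 0 of
    explicit curves, where only the velocity has to depend smoothly on the starting point. A smooth
    function on a bundle is locally F(g_1, ..., g_k) with generators g_i, so its derivative along a
    curve follows from those of the generators by the chain rule. Since [Ck] speaks of directional
    derivatives only, that rule, and already additivity in the direction, has to be derived from the
    mean value theorem. *)

Section LineDerivative.
Variable R : realType.

Lemma is_derive_line (V : normedModType R) (f : V -> R) x v (t l : R) :
  is_derive (t *: v + x) v f l ->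
  is_derive t (1 : R) (fun s : R => f (s *: v + x)) l.
Proof.
move=> [fd fl].
have E : (fun h : R => h^-1 *: (((fun s : R => f (s *: v + x)) \o shift t)
    (h *: (1 : R)) - f (t *: v + x)))
  = (fun h : R => h^-1 *: ((f \o shift (t *: v + x)) (h *: v) - f
      (t *: v + x))).
  by apply/funext => h /=; rewrite [h *: 1]mulr1 scalerDl addrA.
by split; rewrite /derivable /derive E.
Qed.

Lemma is_derive_line0 (V : normedModType R) (f : V -> R) x v (l : R) :
  is_derive (0 : R) (1 : R) (fun s : R => f (s *: v + x)) l ->
  is_derive x v f l.
Proof.
have E : (fun h : R => h^-1 *: (((fun s : R => f (s *: v + x)) \o shift 0)
    (h *: (1 : R)) - f (0 *: v + x)))
  = (fun h : R => h^-1 *: ((f \o shift x) (h *: v) - f x)).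
  by apply/funext => h /=; rewrite [h *: 1]mulr1 addr0 scale0r add0r.
by case; rewrite /derivable /derive E => ? ?; split.
Qed.

(** Chain rule for s -> s c on the line through x. Homogeneity in the direction comes from this
    alone; additivity needs [C1_derive_add]. *)
Lemma is_derive_scaledir (V : normedModType R) (f : V -> R) x v (l : R) :
  is_derive x v f l -> forall c : R, is_derive x (c *: v) f (c * l).
Proof.
move=> fl c; apply: is_derive_line0.
have -> : (fun s => f (s *: (c *: v) + x)) = (fun s => f (s *: v + x)) \o
    ( *%R^~ c).
  by apply/funext => s; rewrite /= scalerA.
have cd : is_derive (0 : R) (1 : R) ( *%R^~ c) c.
  by apply: is_derive_eq; rewrite scaler0 add0r [_ *: _]mulr1.
rewrite mulrC; apply: (@is_derive1_comp R _ ( *%R^~ c)).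
by apply: is_derive_line; rewrite mul0r scale0r add0r.
Qed.

Lemma is_derive_continuous (f : R -> R) (t l : R) :
  is_derive t (1 : R) f l -> {for t, continuous f}.
Proof.
by move=> fd; apply/differentiable_continuous/derivable1_diffP/ex_derive.
Qed.

Lemma mean_value_line (V : normedModType R) (f : V -> R) x v :
  (forall t : R, 0 <= t <= 1 -> derivable f (t *: v + x) v) ->
  exists2 t : R, 0 <= t <= 1 & f (v + x) - f x = 'D_v f (t *: v + x).
Proof.
move=> fd.
have D (t : R) : 0 <= t <= 1 ->
    is_derive t (1 : R) (fun s : R => f (s *: v + x)) ('D_v f (t *: v + x)).
  by move=> /fd /derivableP; exact: is_derive_line.
have [||t t01] := @MVT R (fun s : R => f (s *: v + x))
    (fun t => 'D_v f (t *: v + x)) 0 1 ltr01.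
- by move=> t /itvP t01; apply: D; rewrite !t01.
- apply: derivable_within_continuous => t /itvP t01.
  by apply/ex_derive/D; rewrite !t01.
rewrite scale1r scale0r add0r subr0 mulr1 => E; exists t => //.
by rewrite !ltW ?(itvP t01).
Qed.

End LineDerivative.

Section C1.
Variables (R : realType) (n : nat).
Implicit Types (V : set 'rV[R]_n) (f : 'rV[R]_n -> R).

Lemma rV_ball (x y : 'rV[R]_n) e :
  0 < e -> (forall i, `|x ord0 i - y ord0 i| < e) -> ball x e y.
Proof. by move=> e0 xy; split=> // i j; rewrite ord1; exact: xy. Qed.

(** The increment along h (u + v) splits into one along h u from x and one along h v from x + h u.
    By the mean value theorem the second is h times 'D_v f at a point tending to x, where 'D_v f is
    continuous. *)
Lemma C1_derive_add V f x u v : open V -> V x -> Ck 1 V f ->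
  'D_(u + v) f x = 'D_u f x + 'D_v f x.
Proof.
move=> oV Vx [_ fD].
have [fdu [cDu _]] := fD u; have [fdv [cDv _]] := fD v.
have [fduv _] := fD (u + v).
have [e /= e0 eV] : exists2 e : R, 0 < e & ball x e `<=` V.
  by apply/nbhs_ballP; exact: open_nbhs_nbhs.
have H : (fun h : R => h^-1 *: ((f \o shift x) (h *: (u + v)) - f x)) @ 0^' -->
   'D_u f x + 'D_v f x; last exact: cvg_lim H.
apply: (@cvg_trans _ ((fun h : R => h^-1 *: ((f \o shift x) (h *: u) - f x) +
  h^-1 *: (f (h *: v + (h *: u + x)) - f (h *: u + x))) @ 0^')).
  apply: near_eq_cvg; near=> h; rewrite -scalerDr /=; congr (_ *: _).
  by rewrite [LHS]addrC subrKA scalerDr (addrC (h *: u) (h *: v)) addrA.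
apply: cvgD; first exact: fdu.
have /cvgrPdist_lt cv := cDv x Vx.
apply/cvgrPdist_lt => d d0.
have /nbhs_ballP[r /= r0 rd] := cv _ d0.
pose m := Num.min e r.
have m0 : 0 < m by rewrite lt_min e0.
(* The points of the second leg lie within |h| K of x; the summand 1 keeps K positive. *)
pose K := `|u| + `|v| + 1.
have K0 : 0 < K by rewrite ltr_wpDl// addr_ge0.
near=> h.
have h0 : h != 0 by near: h; exact: nbhs_dnbhs_neq.
have hK (t : R) : 0 <= t <= 1 -> ball x m (t *: (h *: v) + (h *: u + x)).
  move=> /andP[t0 t1]; rewrite -ball_normE /=.
  rewrite addrA opprD addrCA subrr addr0 normrN.
  rewrite (le_lt_trans (ler_normD _ _))// !normrZ.
  have hlt : `|h| < m / K.
    near: h; apply: dnbhs0_lt; exact: divr_gt0.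
  apply: (@le_lt_trans _ _ (`|h| * K)); last by rewrite -ltr_pdivlMr.
  rewrite /K !mulrDr mulr1 addrC (ger0_norm t0).
  rewrite -!addrA lerD2l; rewrite ler_wpDr//.
  by rewrite ler_piMl// mulr_ge0.
have := @mean_value_line R _ f (h *: u + x) (h *: v).
case=> [t t01|t t01 ->].
  have /fdv : V (t *: (h *: v) + (h *: u + x)).
    by apply: eV; apply: le_ball (hK t t01); rewrite /m ge_min lexx.
  by move=> /derivableP /is_derive_scaledir/(_ h)/@ex_derive.
have fvt : derivable f (t *: (h *: v) + (h *: u + x)) v.
  by apply: fdv; apply: eV; apply: le_ball (hK t t01); rewrite /m ge_min lexx.
have -> : 'D_(h *: v) f (t *: (h *: v) + (h *: u + x)) = h * 'D_v f
    (t *: (h *: v) + (h *: u + x)).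
  by have /is_derive_scaledir/(_ h)[] := derivableP fvt.
rewrite [X in _ - X]mulKf//; apply: rd.
by apply: le_ball (hK t t01); rewrite /m ge_min lexx orbT.
Unshelve. all: by end_near. Qed.

Lemma C1_derive_coord V f x v : open V -> V x -> Ck 1 V f ->
  'D_v f x = \sum_i v ord0 i * 'D_(delta_mx ord0 i) f x.
Proof.
move=> oV Vx fC; rewrite {1}[v]row_sum_delta.
have [_ fD] := fC.
elim/big_rec2: _ => [|i y w _ <-]; first exact: derive0.
rewrite (C1_derive_add _ _ oV Vx fC); congr (_ + _).
have [/(_ x Vx)/derivableP fi _] := fD (delta_mx ord0 i).
by have [_ ->] := is_derive_scaledir fi (v ord0 i).
Qed.

(** The increment of f from g t to g (t + h) is the derivative of f in the direction of the chord,
    at some point y h of the chord. Expanded over the coordinates and divided by h, it converges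
    because y h tends to g t. *)
Lemma derive_along_curve V f (g : R -> 'rV[R]_n) (t : R) (dg : 'I_n -> R) :
  open V -> V (g t) -> Ck 1 V f ->
  (forall i, is_derive t (1 : R) (fun s => g s ord0 i) (dg i)) ->
  is_derive t (1 : R) (f \o g) (\sum_i dg i * 'D_(delta_mx ord0 i) f (g t)).
Proof.
move=> oV Vgt fC gd; have [_ fD] := fC.
have gC : {for t, continuous g}.
  apply/differentiable_continuous/derivable1_diffP/derivable_mxP => i j.
  by rewrite ord1; exact: ex_derive.
have [e /= e0 eV] : exists2 e : R, 0 < e & ball (g t) e `<=` V.
  by apply/nbhs_ballP; exact: open_nbhs_nbhs.
pose w (h : R) := g (h + t) - g t.
have wE (h : R) : w h + g t = g (h + t) by rewrite subrK.
have w0 : w @ 0^' --> (0 : 'rV[R]_n).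
  apply/cvgrPdist_lt => d d0; move/cvgrPdist_lt: gC => /(_ d d0).
  move=> /nbhs_ballP[r /= r0 rd]; near=> h.
  rewrite sub0r normrN distrC; apply: rd.
  rewrite -ball_normE /= opprD addrCA subrr addr0 normrN.
  by near: h; exact: dnbhs0_lt.
pose P (h : R) (y : 'rV[R]_n) := `|y - g t| <= `|w h| /\
  f (g (h + t)) - f (g t) = 'D_(w h) f y.
have wP : \forall h \near 0^', exists y, P h y.
  near=> h; have we : `|w h| < e.
    by near: h; move/cvgrPdist_lt: w0 => /(_ _ e0); apply: filterS => h;
        rewrite sub0r normrN.
  have yw (s : R) : 0 <= s <= 1 -> `|s *: w h + g t - g t| <= `|w h|.
    by move=> /andP[s0 s1]; rewrite addrK normrZ ger0_norm// ler_piMl.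
  have [s s01|s s01] := @mean_value_line R _ f (g t) (w h).
    have [+ _] := fD (w h); apply; apply: eV; rewrite -ball_normE /=.
    by rewrite distrC (le_lt_trans (yw s s01)).
  by rewrite wE => E; exists (s *: w h + g t); split=> //; exact: yw.
(* A function of h is needed to take the limit; the default g t is harmless, as [P h] is inhabited
   for small nonzero h. *)
pose y h := xget (g t) [set y | P h y].
have yP : \forall h \near 0^', P h (y h).
  by apply: filterS wP => h [z zP]; apply: (@xgetPex _ (g t) [set y | P h y]);
      exists z.
have yc : y @ 0^' --> g t.
  apply/cvgrPdist_lt => d d0; near=> h; rewrite distrC.
  have [yh _] : P h (y h) by near: h.
  rewrite (le_lt_trans yh)//; near: h.
  by move/cvgrPdist_lt: w0 => /(_ _ d0); apply: filterS => h; rewrite sub0r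
      normrN.
have H : (fun h : R => h^-1 *: (((f \o g) \o shift t) (h *: (1 : R)) - (f \o g)
    t)) @ 0^' -->
    \sum_i dg i * 'D_(delta_mx ord0 i) f (g t).
  apply: (@cvg_trans _ ((fun h : R => \sum_i
      (h^-1 *: (((fun s => g s ord0 i) \o shift t) (h *: (1 : R)) - g t ord0
      i)) *
     'D_(delta_mx ord0 i) f (y h)) @ 0^')).
    apply: near_eq_cvg; near=> h.
    have [yh] : P h (y h) by near: h.
    rewrite /= [h *: 1]mulr1 => ->.
    have Vy : V (y h).
      apply: eV; near: h; move/cvgrPdist_lt: yc => /(_ _ e0); apply: filterS =>
          h.
      by rewrite -ball_normE.
    rewrite (C1_derive_coord _ oV Vy fC) scaler_sumr; apply: eq_bigr => i _.
    by rewrite !mxE scalerAl.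
  apply: cvg_big => [|i _]; first exact: add_continuous.
  apply: cvgM.
    have [gid <-] := gd i; exact: gid.
  apply: (@cvg_comp _ _ _ y ('D_(delta_mx ord0 i) f) _ _ _ yc).
  have [_ [+ _]] := fD (delta_mx ord0 i); exact.
by split; [apply/cvg_ex; exists
    (\sum_i dg i * 'D_(delta_mx ord0 i) f (g t))|exact: cvg_lim H].
Unshelve. all: by end_near. Qed.

End C1.

Section CkTheory.
Variable R : realType.

Lemma Ck_le n k l (V : set 'rV[R]_n) f : (k <= l)%N -> Ck l V f -> Ck k V f.
Proof.
move=> /subnKC <-; elim: (l - k)%N => [|j IHj]; first by rewrite addn0.
by rewrite addnS => /CkW.
Qed.

(** Every clause of [Ck] is a condition at single points of the set, about functions on the whole
    space; hence W may be any set. *)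
Lemma Ck_local n k (V : set 'rV[R]_n) f :
  (forall x, V x -> exists2 W : set 'rV[R]_n, W x & Ck k W f) -> Ck k V f.
Proof.
elim: k f => [|k IHk] f fV; split=> //.
1,2: by move=> x /fV[W Wx /Ck_continuous]; exact.
move=> v; split=> [x /fV[W Wx [_ /(_ v)[+ _]]]|]; first exact.
by apply: IHk => x /fV[W Wx [_ /(_ v)[_ fW]]]; exists W.
Qed.

Lemma Ck_subset n k (V W : set 'rV[R]_n) f : V `<=` W -> Ck k W f -> Ck k V f.
Proof. by move=> VW fW; apply: Ck_local => x /VW Wx; exists W. Qed.

Lemma Ck_sum n k (V : set 'rV[R]_n) (I : Type) (r : seq I)
    (f : I -> 'rV[R]_n -> R) : open V -> (forall i, Ck k V (f i)) ->
  Ck k V (fun x => \sum_(i <- r) f i x).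
Proof.
move=> oV fV; elim: r => [|i r IHr].
  by apply: eq_Ck (Ck_cst k V 0) => // x _; rewrite big_nil.
apply: eq_Ck (CkD oV (fV i) IHr) => // x _; by rewrite big_cons.
Qed.

Lemma rV_continuous (T : topologicalType) n (g : T -> 'rV[R]_n) (x : T) :
  (forall i, {for x, continuous (fun y => g y ord0 i)}) ->
  {for x, continuous g}.
Proof.
move=> gi; apply/cvg_ballP => e e0; near=> y.
apply: rV_ball => //; near: y.
by apply: filter_forall => i; have /cvgrPdist_lt/(_ _ e0) := gi i.
Unshelve. all: by end_near. Qed.

(** Induction on k: by the chain rule a derivative of the composite is a sum of products of
    derivatives of the coordinates of T with partial derivatives of f composed with T. *)
Lemma Ck_comp m n k (V : set 'rV[R]_m) (W : set 'rV[R]_n)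
    (T : 'rV[R]_m -> 'rV[R]_n) f : open V -> open W ->
  (forall x, V x -> W (T x)) -> (forall i, Ck k V (fun x => T x ord0 i)) ->
  Ck k W f -> Ck k V (f \o T).
Proof.
move=> oV oW VW; elim: k f => [|k IHk] f TV fW.
all: have fC x : V x -> {for x, continuous (f \o T)}.
1,3: move=> Vx; apply: continuous_comp; last exact: Ck_continuous fW _
    (VW _ Vx).
1,2: by apply: rV_continuous => i; exact: Ck_continuous (TV i) _ Vx.
by split.
split=> // v.
have D x : V x -> is_derive x v (f \o T)
   (\sum_i 'D_v (fun x => T x ord0 i) x * 'D_(delta_mx ord0 i) f (T x)).
  move=> Vx; apply: is_derive_line0.
  have E : T (0 *: v + x) = T x by rewrite scale0r add0r.
  have := @derive_along_curve _ _ W f (fun s : R => T (s *: v + x)) 0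
    (fun i => 'D_v (fun x => T x ord0 i) x) oW.
  rewrite E => /(_ (VW _ Vx) (Ck_le _ fW)) H; apply: H => //.
  move=> i; apply: (@is_derive_line _ _ (fun x => T x ord0 i)); rewrite scale0r
      add0r.
  by apply: derivableP; have [_ /(_ v)[+ _]] := TV i; exact.
split=> [x /D[]//|].
apply: (@eq_Ck _ _ _ _ (fun x => \sum_i 'D_v (fun x => T x ord0 i) x *
    'D_(delta_mx ord0 i) f (T x))) => //.
  by move=> x /D[_ ->].
apply: (@Ck_sum _ _ _ _ _ (fun i x => 'D_v (fun x => T x ord0 i) x *
    'D_(delta_mx ord0 i) f (T x))) => // i.
apply: CkM => //.
  by have [_ /(_ v)[]] := TV i.
apply: (IHk ('D_(delta_mx ord0 i) f)) => [j|]; first exact: CkW.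
by have [_ /(_ (delta_mx ord0 i))[]] := fW.
Qed.

(** The derivative is existentially quantified, so that an induction on k may exhibit it inside a
    family closed under differentiation. *)
Fixpoint Ck1 (k : nat) (I : set R) (phi : R -> R) : Prop :=
  (forall t, I t -> {for t, continuous phi}) /\
  match k with
  | 0 => True
  | k'.+1 => exists2 dphi, (forall t, I t -> is_derive t (1 : R) phi (dphi t)) &
      Ck1 k' I dphi
  end.

Lemma Ck1_lin k I a b phi psi : Ck1 k I phi -> Ck1 k I psi ->
  Ck1 k I (fun t => a * phi t + b * psi t).
Proof.
elim: k phi psi => [|k IHk] phi psi [cphi dphi] [cpsi dpsi].
  split=> // t It; apply: continuousD; apply: continuousM; try exact:
      cst_continuous.
    exact: cphi.
  exact: cpsi.
have D : exists2 d, (forall t, I t -> is_derive t (1 : R)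
    (fun t => a * phi t + b * psi t) (d t)) & Ck1 k I d.
  have [dp Dp Cp] := dphi; have [dq Dq Cq] := dpsi.
  exists (fun t => a * dp t + b * dq t); last exact: IHk.
  move=> t It; have ? := Dp t It; have ? := Dq t It.
  by apply: (@is_deriveD _ _ _ (a \*: phi) (b \*: psi)).
split=> // t It; have [d /(_ t It) + _] := D; exact: is_derive_continuous.
Qed.

Lemma Ck_comp1 n k (V : set 'rV[R]_n) (I : set R) phi f : open V ->
  Ck1 k I phi -> (forall x, V x -> I (f x)) -> Ck k V f -> Ck k V (phi \o f).
Proof.
move=> oV + VI; elim: k phi => [|k IHk] phi phiI fV.
all: have C x : V x -> {for x, continuous (phi \o f)}.
1,3: move=> Vx; apply: continuous_comp; first exact: Ck_continuous fV _ Vx.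
1,2: case: phiI => + _; apply; exact: VI.
by split.
split=> // v; have [_ [dphi dphiI /IHk dphiC]] := phiI.
have D x : V x -> is_derive x v (phi \o f) (dphi (f x) * 'D_v f x).
  move=> Vx; apply: is_derive_line0.
  apply: (@is_derive1_comp R phi (fun s : R => f (s *: v + x))).
    by rewrite scale0r add0r; exact/dphiI/VI.
  apply: is_derive_line; rewrite scale0r add0r.
  by apply: derivableP; have [_ /(_ v)[+ _]] := fV; exact.
split=> [x /D[]//|].
apply: (@eq_Ck _ _ _ _ (fun x => dphi (f x) * 'D_v f x)) => //.
  by move=> x /D[_ ->].
apply: CkM => //; first exact: dphiC (CkW fV).
by have [_ /(_ v)[]] := fV.
Qed.

(** The factor c makes the family stable under differentiation. *)
Lemma Ck1_powR k c a : Ck1 k [set t | 0 < t] (fun t => c * t `^ a).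
Proof.
have D b d (t : R) : 0 < t -> is_derive t (1 : R) (fun t => b * t `^ d)
    (b * (d * t `^ (d - 1))).
  by move=> t0; have H := is_derive1_powR d t0; have := @is_deriveZ _ _ _
      (fun x : R => x `^ d) b t 1 _ H.
elim: k c a => [|k IHk] c a; split=> //; try by move=> t /(D c a) ?; exact:
    is_derive_continuous.
exists (fun t => (c * a) * t `^ (a - 1)); last exact: IHk.
by move=> t /(D c a); rewrite mulrA.
Qed.

End CkTheory.

(** * Flat functions, smooth steps and bumps *)

Section Bump.
Variable R : realType.

(* The powers of 1 / t make this family stable under differentiation. *)
Definition flat (n : nat) (t : R) : R :=
  if 0 < t then t^-1 ^+ n * expR (- t^-1) else 0.

Lemma flat_ge0 n t : 0 <= flat n t.
Proof.
rewrite /flat; case: ifP => // t0.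
by rewrite mulr_ge0 ?expR_ge0 ?exprn_ge0 ?invr_ge0 ?ltW.
Qed.

(** Apply exp x >= x^(n+1) / (n+1)! at x = 1/t. A linear bound is enough for the derivative at 0,
    because the difference quotient of [flat n] on the positive side is [flat n.+1]. *)
Lemma flat_le n t : 0 < t -> flat n t <= n.+1`!%:R * t.
Proof.
move=> t0; rewrite /flat t0.
have x0 : 0 <= t^-1 by rewrite invr_ge0 ltW.
have f0 : 0 < n.+1`!%:R :> R by rewrite ltr0n fact_gt0.
have H : t^-1 ^+ n.+1 <= n.+1`!%:R * expR t^-1.
  rewrite mulrC -ler_pdivrMr// (le_trans _ (expR_ge1Dxn n x0))//.
  by rewrite lerDr.
rewrite expRN ler_pdivrMr ?expR_gt0// mulrAC -ler_pdivrMr//.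
by rewrite -exprSr.
Qed.

(** The coefficients are spelled out so that the derivative is an instance of [Ck1_lin]. *)
Lemma flat_derive n t :
  is_derive t (1 : R) (flat n) (1 * flat n.+2 t + - n%:R * flat n.+1 t).
Proof.
have [t0|t0|->] := ltgtP t 0.
- have -> : 1 * flat n.+2 t + - n%:R * flat n.+1 t = 0.
    by rewrite /flat !ltNge (ltW t0) /= !mulr0 addr0.
  apply: (@near_eq_is_derive _ _ _ (cst 0)).
    by near=> s; rewrite /flat ltNge ltW//; near: s; exact: lt_nbhsl.
- pose g (s : R) : R := s^-1 ^+ n * expR (- s^-1).
  have E : \forall s \near t, g s = flat n s.
    by near=> s; rewrite /flat ifT//; near: s; exact: lt_nbhsr.
  apply: near_eq_is_derive E _.
  have tn0 : t != 0 by rewrite gt_eqF.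
  have D1 : is_derive t (1 : R) (fun t : R => t^-1) (- t^-1 ^+ 2).
    split; first exact: (@derivableV _ _ id).
    by rewrite (@deriveV _ _ id)// derive_id [_ *: _]mulr1 exprVn.
  have D2 : is_derive t (1 : R) (fun t : R => expR (- t^-1))
      (expR (- t^-1) * t^-1 ^+ 2).
    apply: (@is_derive1_comp R expR (fun t : R => - t^-1)) => //.
    by apply: is_derive_eq; rewrite opprK.
  have D3 : is_derive t (1 : R) (fun t : R => t^-1 ^+ n)
      (- n%:R * t^-1 ^+ n.+1).
    have E : is_derive t^-1 (1 : R) (fun x : R => x ^+ n) (n%:R * t^-1 ^+ n.-1).
      by split; [exact: exprn_derivable|rewrite -derive1E exp_derive1].
    apply: (is_derive_eq (is_derive1_comp E D1)).
    by case: (n) => [|m]; rewrite ?mul0r ?oppr0 ?mul0r//= !exprS; ring.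
  apply: (is_derive_eq (is_deriveM D3 D2)).
  by rewrite /flat t0 /GRing.scale /= !exprS; ring.
have -> : 1 * flat n.+2 0 + - n%:R * flat n.+1 0 = 0 :> R.
  by rewrite /flat ltxx !mulr0 addr0.
have H : (fun h : R => h^-1 *: ((flat n \o shift 0) (h *: (1 : R)) - flat n 0))
    @ 0^' --> (0 : R).
  apply/cvgrPdist_lt => e e0; near=> h.
  rewrite sub0r normrN /= [h *: 1]mulr1 addr0 /flat ltxx subr0.
  have [h0|h0] := ltP 0 h; last by rewrite scaler0 normr0.
  have -> : h^-1 *: (h^-1 ^+ n * expR (- h^-1)) = flat n.+1 h.
    by rewrite /flat h0 exprS -mulrA.
  rewrite ger0_norm ?flat_ge0// (le_lt_trans (flat_le _ h0))//.
  have f0 : 0 < n.+2`!%:R :> R by rewrite ltr0n fact_gt0.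
  rewrite mulrC -ltr_pdivlMr// -(ger0_norm (ltW h0)).
  near: h; apply: dnbhs0_lt; exact: divr_gt0.
by split; [apply/cvg_ex; exists 0|exact: cvg_lim H].
Unshelve. all: by end_near. Qed.

Lemma Ck1_flat k n : Ck1 k setT (flat n).
Proof.
elim: k n => [|k IHk] n; split=> //; try by move=> t _; apply:
    is_derive_continuous (flat_derive n t).
by exists (fun t => 1 * flat n.+2 t + - n%:R * flat n.+1 t);
    [move=> t _; exact: flat_derive|exact: Ck1_lin].
Qed.

(** The quotient is written with a real power, whose smoothness is [Ck1_powR]; t and 1 - t are never
    both nonpositive, so the denominator is positive. *)
Definition step (t : R) : R :=
  flat 0 t * (flat 0 t + flat 0 (1 - t)) `^ (- 1).

Lemma flat0_gt0 t : 0 < t -> 0 < flat 0 t.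
Proof. by move=> t0; rewrite /flat t0 expr0 mul1r expR_gt0. Qed.

Lemma flat0_le0 t : t <= 0 -> flat 0 t = 0.
Proof. by rewrite /flat ltNge => ->. Qed.

Lemma step_den_gt0 t : 0 < flat 0 t + flat 0 (1 - t).
Proof.
have [t0|t0] := ltP 0 t; first by rewrite ltr_pwDl ?flat0_gt0 ?flat_ge0.
by rewrite ltr_wpDl ?flat_ge0// flat0_gt0//; lra.
Qed.

Lemma step0 t : t <= 0 -> step t = 0.
Proof. by move=> /flat0_le0; rewrite /step => ->; rewrite mul0r. Qed.

Lemma step1 t : 1 <= t -> step t = 1.
Proof.
move=> t1; rewrite /step (@flat0_le0 (1 - t)) ?subr_le0// addr0.
by rewrite powR_inv1 ?flat_ge0// mulfV// gt_eqF// flat0_gt0//; lra.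
Qed.

Lemma step_ge0 t : 0 <= step t.
Proof. by rewrite mulr_ge0 ?flat_ge0 ?powR_ge0. Qed.

Lemma step_le1 t : step t <= 1.
Proof.
have D := step_den_gt0 t.
by rewrite /step powR_inv1 ?(ltW D)// ler_pdivrMr// mul1r lerDl flat_ge0.
Qed.

Lemma Ck_step n k (V : set 'rV[R]_n) f : open V ->
  Ck k V f -> Ck k V (step \o f).
Proof.
move=> oV fV.
have F0 g : Ck k V g -> Ck k V (flat 0 \o g).
  by move=> gV; apply: (Ck_comp1 oV (Ck1_flat k 0)).
have gV : Ck k V (fun x => 1 - f x).
  apply: (eq_Ck oV _ (CkD oV (Ck_cst k V 1) (CkM oV (Ck_cst k V (-1)) fV))).
  by move=> x _; rewrite mulN1r.
have dV := CkD oV (F0 _ fV) (F0 _ gV).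
have := Ck_comp1 oV (Ck1_powR k 1 (-1)) (fun x _ => step_den_gt0 (f x)) dV.
move=> /(CkM oV (F0 _ fV)); apply: eq_Ck => // x _.
by rewrite /= mul1r.
Qed.

(** Squares keep the argument of [step] smooth. For e > 0 the factor of index i is 1 when |x_i -
    p_i| <= e and vanishes from sqrt 2 e on. *)
Definition bump n (p : 'rV[R]_n) (e : R) (x : 'rV[R]_n) : R :=
  \prod_i step (2 - (x ord0 i - p ord0 i) ^+ 2 / e ^+ 2).

Lemma Ck_prod n k (V : set 'rV[R]_n) (I : Type) (r : seq I)
    (f : I -> 'rV[R]_n -> R) : open V -> (forall i, Ck k V (f i)) ->
  Ck k V (fun x => \prod_(i <- r) f i x).
Proof.
move=> oV fV; elim: r => [|i r IHr].
  by apply: eq_Ck (Ck_cst k V 1) => // x _; rewrite big_nil.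
apply: eq_Ck (CkM oV (fV i) IHr) => // x _; by rewrite big_cons.
Qed.

Lemma bump_smooth n (p : 'rV[R]_n) e : smooth_on setT (bump p e).
Proof.
move=> k; apply: (@Ck_prod _ _ _ _ _
    (fun i x => step (2 - (x ord0 i - p ord0 i) ^+ 2 / e ^+ 2))) => [|i].
  exact: openT.
apply: (@Ck_step _ _ _ (fun x => 2 - (x ord0 i - p ord0 i) ^+ 2 / e ^+ 2));
    first exact: openT.
have oT := @openT 'rV[R]_n.
have sub : Ck k setT (fun x : 'rV[R]_n => x ord0 i - p ord0 i).
  exact: CkD oT (Ck_coord k setT i) (Ck_cst k setT (- p ord0 i)).
have := CkD oT (Ck_cst k setT 2)
    (CkM oT (CkM oT sub sub) (Ck_cst k setT (- (e ^+ 2)^-1))).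
by apply: eq_Ck => // x _; rewrite mulrN expr2.
Qed.

Lemma bump_eq1 n (p x : 'rV[R]_n) e : 0 < e ->
  (forall i, `|x ord0 i - p ord0 i| <= e) -> bump p e x = 1.
Proof.
move=> e0 xp; rewrite /bump big1// => i _; apply: step1.
suff : (x ord0 i - p ord0 i) ^+ 2 / e ^+ 2 <= 1 by lra.
rewrite ler_pdivrMr ?exprn_gt0// mul1r -real_normK ?num_real//.
by rewrite lerXn2r ?nnegrE ?normr_ge0 ?(ltW e0).
Qed.

Lemma bump_neq0 n (p x : 'rV[R]_n) e : 0 < e -> bump p e x != 0 ->
  forall i, `|x ord0 i - p ord0 i| <= 2 * e.
Proof.
move=> e0 bx i; rewrite leNgt; apply: contraNN bx => H.
rewrite /bump (bigD1 i)//= step0 ?mul0r//.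
suff : 2 <= (x ord0 i - p ord0 i) ^+ 2 / e ^+ 2 by lra.
rewrite ler_pdivlMr ?exprn_gt0// -[leRHS]real_normK ?num_real//.
have : (2 * e) ^+ 2 <= `|x ord0 i - p ord0 i| ^+ 2.
  by rewrite lerXn2r ?nnegrE ?normr_ge0 ?mulr_ge0 ?(ltW e0) ?(ltW H).
by move=> H2; apply: le_trans H2; rewrite exprMn; have := exprn_gt0 2 e0; lra.
Qed.

(** For t0 > 0, a smooth positive function of t, equal to t0 below t0 / 4 and to t above t0 / 2. It
    turns a function positive near a point into one positive everywhere, to which real powers
    apply. *)
Definition clamp (t0 t : R) : R :=
  (1 - step (4 * t / t0 - 1)) * t0 + step (4 * t / t0 - 1) * t.

Lemma clamp_gt0 t0 t : 0 < t0 -> 0 < clamp t0 t.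
Proof.
move=> t0_gt0; rewrite /clamp; set s := step _.
have [/step0 s0|t1] := leP (4 * t / t0 - 1) 0.
  by rewrite /s s0; lra.
have t_gt0 : 0 < t.
  have : 1 < 4 * t / t0 by lra.
  by rewrite ltr_pdivlMr//; lra.
have s0 : 0 <= s := step_ge0 _; have s1 : s <= 1 := step_le1 _.
nra.
Qed.

Lemma clamp_id t0 t : 0 < t0 -> t0 / 2 <= t -> clamp t0 t = t.
Proof.
move=> t0_gt0 tt; rewrite /clamp step1; first by ring.
by rewrite lerBrDr ler_pdivlMr//; lra.
Qed.

Lemma Ck_clamp n k (V : set 'rV[R]_n) f t0 : open V ->
  Ck k V f -> Ck k V (clamp t0 \o f).
Proof.
move=> oV fV.
have gV : Ck k V (fun x => 4 * f x / t0 - 1).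
  by apply: CkD (Ck_cst k V (-1)) => //; apply: CkM (Ck_cst k V _) => //;
      apply: CkM (Ck_cst k V _) _.
have sV := Ck_step oV gV.
apply: CkD => //; apply: CkM => //; last exact: Ck_cst.
apply: (eq_Ck oV _ (CkD oV (Ck_cst k V 1) (CkM oV (Ck_cst k V (-1)) sV))).
by move=> x _; rewrite mulN1r.
Qed.

End Bump.

(** * Tangent vectors and vector fields *)

Section CinfTheory.
Variables (R : realType) (X : smoothSpace R).

Lemma CinfZ (c : R) f : Cinf X f -> Cinf X (fun x => c * f x).
Proof. by move=> fX; apply: CinfM => //; exact: Cinf_cst. Qed.

Lemma CinfN f : Cinf X f -> Cinf X (fun x => - f x).
Proof.
move=> /(CinfZ (-1)); rewrite (_ : (fun x => -1 * f x) = (fun x => - f x))//.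
by apply/funext => x; rewrite mulN1r.
Qed.

Lemma CinfB f g : Cinf X f -> Cinf X g -> Cinf X (fun x => f x - g x).
Proof. by move=> fX gX; apply: CinfD => //; exact: CinfN. Qed.

Lemma Cinf_sum (I : Type) (r : seq I) (f : I -> X -> R) :
  (forall i, Cinf X (f i)) -> Cinf X (fun x => \sum_(i <- r) f i x).
Proof.
move=> fX; elim: r => [|i r IHr].
  rewrite (_ : (fun x => _) = fun=> 0); first exact: Cinf_cst.
  by apply/funext => x; rewrite big_nil.
rewrite (_ : (fun x => _) = fun x => f i x + \sum_(i <- r) f i x).
  exact: CinfD.
by apply/funext => x; rewrite big_cons.
Qed.

Section AtPoint.
Variables (p : X) (v : tangent X p).

Lemma tangentD f g : Cinf X f -> Cinf X g ->
  v (fun x => f x + g x) = v f + v g.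
Proof.
move=> fX gX; have [vL _ _] := tangentP v.
rewrite -(mul1r (v f)) -vL//; congr (v _); apply/funext => x; by rewrite mul1r.
Qed.

Lemma tangentM f g : Cinf X f -> Cinf X g ->
  v (fun x => f x * g x) = f p * v g + g p * v f.
Proof. by have [_ + _] := tangentP v; exact. Qed.

Lemma tangentZ (c : R) f : Cinf X f -> v (fun x => c * f x) = c * v f.
Proof.
move=> fX; rewrite (tangentM (Cinf_cst X c) fX) tangent_cst mulr0 addr0 //.
Qed.

Lemma tangentN f : Cinf X f -> v (fun x => - f x) = - v f.
Proof.
move=> fX; rewrite -[RHS]mulN1r -tangentZ//.
by congr (v _); apply/funext => x; rewrite mulN1r.
Qed.

Lemma tangentB f g : Cinf X f -> Cinf X g ->
  v (fun x => f x - g x) = v f - v g.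
Proof. by move=> fX gX; rewrite (tangentD fX (CinfN gX)) tangentN. Qed.

Lemma tangent_sum (I : Type) (r : seq I) (f : I -> X -> R) :
  (forall i, Cinf X (f i)) ->
  v (fun x => \sum_(i <- r) f i x) = \sum_(i <- r) v (f i).
Proof.
move=> fX; elim: r => [|i r IHr].
  rewrite big_nil -[RHS](tangent_cst v 0); congr (v _).
  by apply/funext => x; rewrite big_nil.
rewrite big_cons -IHr -(tangentD (fX i) (Cinf_sum r fX)).
by congr (v _); apply/funext => x; rewrite big_cons.
Qed.

(** The products chi f and chi g agree everywhere. In the Leibniz rule at p the terms with v chi are
    equal, since f p = g p, and chi p can be cancelled. *)
Lemma tangent_local (chi f g : X -> R) :
  Cinf X chi -> Cinf X f -> Cinf X g -> chi p != 0 ->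
  (forall q, chi q != 0 -> f q = g q) -> v f = v g.
Proof.
move=> chiX fX gX chip fg.
have : v (fun x => chi x * f x) = v (fun x => chi x * g x).
  congr (v _); apply/funext => x.
  by have [->|/fg ->//] := eqVneq (chi x) 0; rewrite !mul0r.
by rewrite !tangentM// (fg _ chip) => /addIr/(mulfI chip).
Qed.

End AtPoint.

Lemma tangent_ext p (v w : tangent X p) :
  (forall f, Cinf X f -> v f = w f) -> v = w.
Proof.
move=> vw; apply: val_inj; apply/funext => f /=.
have [fX|nfX] := pselect (Cinf X f); first exact: vw.
by have [_ _ ->//] := tangentP v; have [_ _ ->//] := tangentP w.
Qed.

Lemma tvecD p (v w : tangent X p) f : (v + w : tangent X p) f = v f + w f.
Proof. by []. Qed.

Lemma tvecZ p (c : R) (v : tangent X p) f : (c *: v : tangent X p) f = c * v f.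
Proof. by []. Qed.

Lemma tvec0 p f : (0 : tangent X p) f = 0.
Proof. by []. Qed.

Lemma tvec_sum p (I : Type) (r : seq I) (v : I -> tangent X p) f :
  (\sum_(i <- r) v i) f = \sum_(i <- r) v i f.
Proof.
by elim: r => [|i r IHr]; rewrite ?big_nil ?big_cons// tvecD IHr.
Qed.

Lemma vfD_smooth (V W : vfield X) f :
  Cinf X f -> Cinf X (fun p => (V p + W p : tangent X p) f).
Proof. by move=> fX; apply: CinfD; exact: vf_smooth. Qed.
Definition vfD V W : vfield X := VField (vfD_smooth V W).

Lemma vfZ_smooth (c : {c : X -> R | Cinf X c}) (V : vfield X) f :
  Cinf X f -> Cinf X (fun p => (sval c p *: V p : tangent X p) f).
Proof. by move=> fX; apply: CinfM; [exact: (svalP c)|exact: vf_smooth]. Qed.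
Definition vfZ (c : X -> R) (cX : Cinf X c) V : vfield X :=
  VField (vfZ_smooth (exist _ c cX) V).

Lemma vf0_smooth (f : X -> R) : Cinf X f -> Cinf X
    (fun p => (0 : tangent X p) f).
Proof. by move=> _; exact: Cinf_cst. Qed.
Definition vf0 : vfield X := VField vf0_smooth.

Lemma bracketE (V W : vfield X) p f :
  bracket V W p f = V p (fun q => W q f) - W p (fun q => V q f).
Proof. by []. Qed.

Lemma bracket_antisym (V W : vfield X) p : bracket W V p = - bracket V W p.
Proof.
apply: tangent_ext => f fX; rewrite -[- _]scaleN1r tvecZ !bracketE; ring.
Qed.

Lemma bracket_self (V : vfield X) p : bracket V V p = 0.
Proof. by apply: tangent_ext => f fX; rewrite bracketE subrr. Qed.

Lemma bracketDr (V W Z : vfield X) p :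
  bracket V (vfD W Z) p = bracket V W p + bracket V Z p.
Proof.
apply: tangent_ext => f fX; rewrite tvecD !bracketE.
change (V p (fun q => W q f + Z q f) -
    (W p (fun q => V q f) + Z p (fun q => V q f)) =
  V p (fun q => W q f) - W p (fun q => V q f) +
      (V p (fun q => Z q f) - Z p (fun q => V q f))).
rewrite (tangentD _ (vf_smooth W fX) (vf_smooth Z fX)); ring.
Qed.

Lemma bracketZr (V W : vfield X) c (cX : Cinf X c) p :
  bracket V (vfZ cX W) p = c p *: bracket V W p + V p c *: W p.
Proof.
apply: tangent_ext => f fX; rewrite tvecD !tvecZ !bracketE.
change (V p (fun q => c q * W q f) - c p * W p (fun q => V q f) =
  c p * (V p (fun q => W q f) - W p (fun q => V q f)) + V p c * W p f).
rewrite (tangentM _ cX (vf_smooth W fX)); ring.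
Qed.

Lemma jacobi (V W Z : vfield X) p :
  bracket V (bracket W Z) p + bracket W (bracket Z V) p +
  bracket Z (bracket V W) p = 0.
Proof.
apply: tangent_ext => f fX; rewrite !tvecD tvec0 !bracketE.
have E (A B C : vfield X) : A p (fun q => bracket B C q f) =
    A p (fun q => B q (fun q => C q f)) - A p (fun q => C q (fun q => B q f)).
  by rewrite -tangentB//; do !apply: vf_smooth.
rewrite (E V W Z) (E W Z V) (E Z V W); ring.
Qed.

(* d(db) = 0, in Cartan's form. *)
Lemma dform_closed (b : form1 X) (V W Z : vfield X) p : smooth_form b ->
  V p (fun q => dform b W Z q) + W p (fun q => dform b Z V q) +
  Z p (fun q => dform b V W q) =
  dform b (bracket V W) Z p + dform b (bracket W Z) V p +
  dform b (bracket Z V) W p.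
Proof.
move=> [bL bC].
have E (A B C : vfield X) : A p (fun q => dform b B C q) =
    A p (fun q => B q (fun q => b q (C q))) - A p
        (fun q => C q (fun q => b q (B q)))
    - A p (fun q => b q (bracket B C q)).
  rewrite /dform !tangentB//; try exact: bC; try (apply: vf_smooth; exact: bC).
  by apply: CinfB; apply: vf_smooth; exact: bC.
pose bl := HB.pack_for {scalar tangent X p} (b p)
    (GRing.isLinear.Build _ _ _ _ _ (bL p)).
have bD u w : b p (u + w) = b p u + b p w by exact: (linearD bl).
have bN u : b p (- u) = - b p u by exact: (linearN bl).
(* The iterated brackets vanish by the Jacobi identity; all other terms cancel formally. *)
have bJ : b p (bracket V (bracket W Z) p) + b p (bracket W (bracket Z V) p) +
    b p (bracket Z (bracket V W) p) = 0.
  by rewrite -!bD jacobi; exact: (linear0 bl).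
rewrite !E /dform !bracketE.
rewrite (bracket_antisym Z (bracket V W)) (bracket_antisym V (bracket W Z))
    (bracket_antisym W (bracket Z V)) !bN.
move: bJ; set a1 := b p (bracket V _ _); set a2 := b p (bracket W _ _); set a3
    := b p (bracket Z _ _).
move=> bJ; have -> : a1 = - a2 - a3 by lra.
ring.
Qed.

End CinfTheory.

Section Maps.
Variable R : realType.

Lemma dmapE (X Y : smoothSpace R) (phi : smoothMap X Y) p (v : tangent X p) f :
  Cinf Y f -> dmap phi v f = v (f \o phi).
Proof. by move=> fY; rewrite /= /dmap_fun asboolT. Qed.

Lemma dmap_linear (X Y : smoothSpace R) (phi : smoothMap X Y) p :
  linear (@dmap R X Y phi p).
Proof.
move=> a u v; apply: tangent_ext => f fY.
by rewrite tvecD tvecZ !dmapE// tvecD tvecZ.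
Qed.

Definition smap_comp (X Y Z : smoothSpace R) (psi : smoothMap Y Z)
    (phi : smoothMap X Y) : smoothMap X Z :=
  @SmoothMap R X Z (psi \o phi) (fun f fZ => smooth_mapP phi
      (smooth_mapP psi fZ)).

Lemma dmap_comp (X Y Z : smoothSpace R) (psi : smoothMap Y Z)
    (phi : smoothMap X Y) p (v : tangent X p) :
  dmap (smap_comp psi phi) v = dmap psi (dmap phi v).
Proof.
by apply: tangent_ext => f fZ; rewrite !dmapE//; exact: smooth_mapP.
Qed.

Definition smap_id (X : smoothSpace R) : smoothMap X X :=
  @SmoothMap R X X id (fun f fX => fX).

Lemma dmap_id (X : smoothSpace R) p (v : tangent X p) : dmap (smap_id X) v = v.
Proof. by apply: tangent_ext => f fX; rewrite dmapE. Qed.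

End Maps.

(** * Vector fields as velocities of curves *)

Section Curves.
Variables (R : realType) (X : smoothSpace R).

Definition velocity_fun (c : R -> X) (f : X -> R) : R :=
  if `[< Cinf X f >] then 'D_1 (f \o c) 0 else 0.

Lemma velocity_tangent p (c : R -> X) : c 0 = p ->
  (forall f, Cinf X f -> derivable (f \o c) 0 (1 : R)) ->
  velocity_fun c \in is_tangent p.
Proof.
move=> c0 cd; apply/asboolP; split=> [a f g fX gX|f g fX gX|f fX]; rewrite
    /velocity_fun.
- have fgX : Cinf X (fun x => a * f x + g x) by apply: CinfD => //; exact:
    CinfZ.
  rewrite !asboolT//.
  have Df := derivableP (cd f fX); have Dg := derivableP (cd g gX).
  suff [_ <-] : is_derive (0 : R) (1 : R) (fun t => a * f (c t) + g (c t))
      (a * 'D_1 (f \o c) 0 + 'D_1 (g \o c) 0) by [].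
  exact: (@is_deriveD _ _ _ (a \*: (f \o c)) (g \o c)).
- have fgX : Cinf X (fun x => f x * g x) by exact: CinfM.
  rewrite !asboolT//.
  by have := deriveM (cd f fX) (cd g gX); rewrite /= c0.
- by rewrite asboolF.
Qed.

(** One curve through each point, of which only the velocity at 0 matters; no flow property is asked
    for. *)
Definition curve_field (c : X -> R -> X) :=
  (forall p, c p 0 = p) /\ forall f, Cinf X f ->
    (forall p, derivable (f \o c p) 0 (1 : R)) /\
    Cinf X (fun p => 'D_1 (f \o c p) 0).

Section FieldOfCurves.
Variable (c : X -> R -> X).
Hypothesis cF : curve_field c.

Definition curve_velocity p : tangent X p :=
  Tangent (velocity_tangent (cF.1 p) (fun f fX => (cF.2 f fX).1 p)).

Lemma curve_velocity_smooth f :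
  Cinf X f -> Cinf X (fun p => curve_velocity p f).
Proof.
move=> fX; rewrite (_ : (fun p => _) = fun p => 'D_1 (f \o c p) 0).
  by have [] := cF.2 f fX.
by apply/funext => p; rewrite /= /velocity_fun asboolT.
Qed.

Definition curve_vfield : vfield X := VField curve_velocity_smooth.

Lemma curve_vfieldE p f : Cinf X f -> curve_vfield p f = 'D_1 (f \o c p) 0.
Proof. by move=> fX; rewrite /= /velocity_fun asboolT. Qed.

End FieldOfCurves.

End Curves.

Section GeneratedCurves.
Variables (R : realType) (X : Type) (G : set (X -> R)).
Let XG := generated_space G.

(** Boxes of finitely many generators are the basic neighbourhoods; the generators of the box and
    those expressing f0 are joined into one list. *)
Lemma generated_local_box (f : X -> R) :
  (forall p : X, exists k (g : 'I_k -> X -> R) (e : R) (f0 : X -> R),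
    [/\ forall i, G (g i), generated G f0, 0 < e &
    forall x, (forall i, `|g i x - g i p| < e) -> f x = f0 x]) -> generated G f.
Proof.
move=> fL p; have [k2 [g2 [e2 [f0 [g2G f0G e2_gt0 f0E]]]]] := fL p.
have [k1 [g1 [F [e1 [g1G FS e1_gt0 FE]]]]] := f0G p.
pose g (i : 'I_(k1 + k2)) :=
  match fintype.split i with inl j => g1 j | inr j => g2 j end.
have gl j : g (lshift k2 j) = g1 j by rewrite /g (unsplitK (inl j)).
have gr j : g (rshift k1 j) = g2 j by rewrite /g (unsplitK (inr j)).
exists (k1 + k2)%N, g, (F \o (fun x : 'rV[R]_(k1 + k2) => \row_i x ord0
    (lshift k2 i))), (Num.min e1 e2); split.
- by move=> i; rewrite /g; case: fintype.split.
- exact: (@smooth_reindex R _ _ (fun i => lshift k2 i) F FS).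
- by rewrite lt_min e1_gt0.
- move=> x xp; rewrite f0E.
    rewrite FE; first by congr (F _); apply/rowP => i; rewrite !mxE gl.
    by move=> i; have := xp (lshift k2 i); rewrite gl lt_min => /andP[].
  by move=> i; have := xp (rshift k1 i); rewrite gr lt_min => /andP[].
Qed.

(** The generator g acts as a cutoff: it has no zero in the box of radius |g p| around p. *)
Lemma generated_local (f : X -> R) :
  (forall p : X, exists (g f0 : X -> R), [/\ G g, generated G f0, g p != 0 &
    forall x, g x != 0 -> f x = f0 x]) -> generated G f.
Proof.
move=> fL; apply: generated_local_box => p.
have [g [f0 [Gg f0G gp f0E]]] := fL p.
exists 1%N, (fun=> g), `|g p|, f0; split=> // [|x /(_ ord0) xp].
  by rewrite normr_gt0.
by apply: f0E; apply: contraTneq xp => ->; rewrite sub0r normrN ltxx.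
Qed.

Lemma generated_derive (c : R -> X) (p : X) : c 0 = p ->
  (forall g, G g -> derivable (g \o c) 0 (1 : R)) ->
  forall k (g : 'I_k -> X -> R) (F : 'rV[R]_k -> R) (f : X -> R) (e : R),
  (forall i, G (g i)) -> smooth_on setT F -> 0 < e ->
  (forall x, (forall i, `|g i x - g i p| < e) -> f x = F (\row_i g i x)) ->
  is_derive (0 : R) (1 : R) (f \o c)
    (\sum_i 'D_1 (g i \o c) 0 * 'D_(delta_mx ord0 i) F (\row_i g i p)).
Proof.
move=> c0 cd k g F f e gG FS e0 fE.
have gd i : is_derive (0 : R) (1 : R) (g i \o c) ('D_1 (g i \o c) 0).
  by apply: derivableP; exact: cd.
apply: (@near_eq_is_derive _ _ _ (F \o (fun t => \row_i g i (c t)))).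
  near=> t; apply/esym; apply: fE.
  near: t; apply: filter_forall => /= i; move: (is_derive_continuous (gd i)).
  move=> /cvgrPdist_lt/(_ e e0); apply: filterS => t.
  by rewrite /= c0 distrC.
have := @derive_along_curve R k setT F (fun t => \row_i g i (c t)) 0
    (fun i => 'D_1 (g i \o c) 0).
rewrite c0; apply; [exact: openT|by []|exact: FS|].
move=> i; rewrite (_ : (fun s => _) = g i \o c)//.
by apply/funext => s; rewrite mxE.
Unshelve. all: by end_near. Qed.

(** By [generated_derive], the derivative of F(g_1, ..., g_k) is a sum of products of derivatives of
    generators with partial derivatives of F, and both are smooth. *)
Lemma generated_curve_field (c : X -> R -> X) :
  (forall p, c p 0 = p) ->
  (forall g, G g -> (forall p, derivable (g \o c p) 0 (1 : R)) /\
    generated G (fun p => 'D_1 (g \o c p) 0)) ->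
  @curve_field R XG c.
Proof.
move=> c0 cG; split=> // f fG; split=> [p|].
  have [k [g [F [e [gG FS e0 fE]]]]] := fG p.
  by have [] := generated_derive (c0 p) (fun g Gg => (cG g Gg).1 p) gG FS e0 fE.
apply: generated_local_box => p.
have [k [g [F [e [gG FS e0 fE]]]]] := fG p.
(* For x in the box of radius e / 2 around p, the box of radius e / 2 around x lies in the one of
   radius e around p, so the same F and g compute the derivative at x. *)
exists k, g, (e / 2), (fun x => \sum_i 'D_1 (g i \o c x) 0 *
    'D_(delta_mx ord0 i) F (\row_i g i x)).
split=> //; last 2 first.
- exact: divr_gt0.
- move=> x xp; have xe : 0 < e / 2 by exact: divr_gt0.
  have [|_ <-//] := generated_derive (c0 x) (fun g Gg => (cG g Gg).1 x) gG FS
      xe (f := f).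
  move=> y yx; apply: fE => i; rewrite (splitr e) -(subrKA (g i x)).
  by rewrite (le_lt_trans (ler_normD _ _))// ltrD.
apply: (@Cinf_sum R XG) => i; apply: (@CinfM R XG); first by have [] := cG _
    (gG i).
move=> q; exists k, g, ('D_(delta_mx ord0 i) F), 1; split=> // j.
by have [_ /(_ (delta_mx ord0 i))[]] := FS j.+1.
Qed.

End GeneratedCurves.

(** * Cutoff functions and straight curves in charts *)

Section ManifoldFunctionsTheory.
Variables (R : realType) (n : nat) (M : manifold R n).

Lemma mCinf_continuous f (p : mtop M) : Cinf M f -> {for p, continuous f}.
Proof.
move=> fM; have [c cA cp] := atlas_cover p.
have fC := Ck_continuous (fM c cA 0%N)
    (ex_intro2 _ _ p cp erefl : (coord c @` dom c) (coord c p)).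
have gC : {for p, continuous ((f \o coord_inv c) \o coord c)}.
  by apply: continuous_comp => //; exact: coord_cont.
have E : \forall q \near p, ((f \o coord_inv c) \o coord c) q = f q.
  near=> q; rewrite /= coordK//; near: q; apply: open_nbhs_nbhs.
  by split=> //; exact: dom_open.
rewrite /prop_for /continuous_at.
have -> : f p = ((f \o coord_inv c) \o coord c) p by rewrite /= coordK.
apply: (cvg_trans _ gC); apply: near_eq_cvg; exact: E.
Unshelve. all: by end_near. Qed.

Lemma open_coord_image (c : chart R (mtop M) n) (O : set (mtop M)) :
  open O -> O `<=` dom c -> open (coord c @` O).
Proof.
move=> oO Oc; rewrite openE => x [p Op <-].
have cp := Oc _ Op.
have H1 : \forall y \near coord c p, (coord c @` dom c) y.
  by apply: open_nbhs_nbhs; split; [exact: codom_open|exists p].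
have H2 : \forall y \near coord c p, O (coord_inv c y).
  by apply: (coord_inv_cont cp); rewrite coordK//; exact: open_nbhs_nbhs.
apply: filterS2 H1 H2 => y [q cq <-]; by rewrite coordK// => Oq; exists q.
Qed.

Definition box (x0 : 'rV[R]_n) (r : R) : set 'rV[R]_n :=
  [set x | forall i, `|x ord0 i - x0 ord0 i| <= r].

Lemma compact_box x0 r : compact (box x0 r).
Proof.
have -> : box x0 r = [set x : 'rV[R]_n | forall i,
    `[x0 ord0 i - r, x0 ord0 i + r]%classic (x ord0 i)].
  by apply/seteqP; split=> x xb i; have := xb i; rewrite /= in_itv /= ler_distl.
by apply: (@rV_compact _ _ (fun i => `[x0 ord0 i - r, x0 ord0 i + r]%classic))
    => i; exact: segment_compact.
Qed.

Definition chart_fun (c : chart R (mtop M) n) (h : 'rV[R]_n -> R) : M -> R :=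
  fun q => if `[< dom c q >] then h (coord c q) else 0.

(** The image of K in M is compact, hence closed because M is Hausdorff. A point outside the chart
    thus has a neighbourhood where the function is 0; at a point inside, the transition map
    applies. *)
Lemma chart_fun_Cinf c h (K : set 'rV[R]_n) : @atlas R n M c -> compact K ->
  K `<=` coord c @` dom c -> smooth_on (coord c @` dom c) h ->
  (forall x, ~ K x -> h x = 0) -> Cinf M (chart_fun c h).
Proof.
move=> cA cK Kc hS hK c' c'A k.
have clK : closed (coord_inv c @` K).
  apply: compact_closed; first exact: mtop_hausdorff.
  apply: continuous_compact => //.
  apply/continuous_in_subspaceT => x; rewrite inE => /Kc[p cp <-].
  exact: coord_inv_cont.
have oI : open (dom c' `&` dom c) by apply: openI; exact: dom_open.
have oJ : open (dom c' `\` (coord_inv c @` K)).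
  by rewrite setDE; apply: openI; [exact: dom_open|exact: closed_openC].
apply: Ck_local => x [p c'p <-{x}].
have [cp|ncp] := pselect (dom c p).
  exists (coord c' @` (dom c' `&` dom c)); first by exists p.
  have oW : open (coord c' @` (dom c' `&` dom c)).
    by apply: open_coord_image => //; exact: subIsetl.
  have sub : coord c' @` (dom c' `&` dom c) `<=` coord c' @` dom c'.
    by move=> _ [q [c'q _] <-]; exists q.
  have H : Ck k (coord c' @` (dom c' `&` dom c))
      (h \o (fun x => coord c (coord_inv c' x))).
    apply: Ck_comp (hS k) => //; first exact: codom_open.
      by move=> _ [q [c'q cq] <-]; rewrite coordK//; exists q.
    by move=> i; exact: atlas_smooth.
  apply: eq_Ck H => //.
  by move=> _ [q [c'q cq] <-]; rewrite /chart_fun /= coordK// asboolT.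
exists (coord c' @` (dom c' `\` (coord_inv c @` K))).
  exists p => //; split=> // -[x Kx xp]; apply: ncp.
  by rewrite -xp; have [q cq <-] := Kc _ Kx; rewrite coordK.
apply: eq_Ck (Ck_cst k _ 0).
  by apply: open_coord_image => // q [].
move=> _ [q [c'q qK] <-]; rewrite /chart_fun /= coordK//.
case: asboolP => // cq; rewrite hK// => Kq; apply: qK.
by exists (coord c q) => //; rewrite coordK.
Qed.

(** The bump is kept in the coordinates of one chart, because it cuts off functions and also slows
    down straight lines of that chart. *)
Record cutoff (p : mtop M) (U : set (mtop M)) := Cutoff {
  cut_chart : chart R (mtop M) n;
  cut_bump : 'rV[R]_n -> R;
  cut_supp : set 'rV[R]_n;
  cut_atlas : @atlas R n M cut_chart;
  cut_dom : dom cut_chart p;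
  cut_compact : compact cut_supp;
  cut_sub : cut_supp `<=` coord cut_chart @` (dom cut_chart `&` U);
  cut_smooth : smooth_on setT cut_bump;
  cut_out : forall x, ~ cut_supp x -> cut_bump x = 0;
  cut_near : \forall x \near coord cut_chart p, cut_bump x = 1 }.

Lemma cutoff_exists (p : mtop M) (U : set (mtop M)) : nbhs p U ->
  exists _ : cutoff p U, True.
Proof.
move=> pU; have [c cA cp] := atlas_cover p.
have oO : open (dom c `&` U^°).
  by apply: openI; [exact: dom_open|exact: open_interior].
have oI : open (coord c @` (dom c `&` U^°)).
  by apply: open_coord_image => // q [].
have [r /= r0 rI] : exists2 r : R, 0 < r & ball (coord c p) r `<=` coord c @`
    (dom c `&` U^°).
  apply/nbhs_ballP; apply: open_nbhs_nbhs; split=> //; exists p => //.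
(* The bump of parameter r / 4 vanishes outside the box of radius r / 2, which lies in the ball of
   radius r. *)
have e0 : 0 < r / 4 by exact: divr_gt0.
unshelve eexists; last by [].
apply: (@Cutoff p U c (bump (coord c p) (r / 4))
    (box (coord c p) (2 * (r / 4)))) => //.
- exact: compact_box.
- move=> x xb; have [|q [cq Uq] <-] := rI x.
    by apply: rV_ball => // i; rewrite distrC (le_lt_trans (xb i))//; lra.
  by exists q => //; split=> //; exact: interior_subset.
- exact: bump_smooth.
- move=> x xb; apply/eqP; apply: contra_notT xb => /(bump_neq0 e0); exact.
- near=> x; apply: bump_eq1 => // i; rewrite distrC.
  have : ball (coord c p) (r / 4) x by near: x; exact: nbhsx_ballx.
  by case=> _ /(_ ord0 i)/ltW.
Unshelve. all: by end_near. Qed.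

Section Cut.
Variables (p : mtop M) (U : set (mtop M)) (C : cutoff p U).
Let c := cut_chart C.
Let b := cut_bump C.

Lemma cut_mul_Cinf h : smooth_on (coord c @` dom c) h ->
  Cinf M (chart_fun c (fun x => b x * h x)).
Proof.
move=> hS; apply: (chart_fun_Cinf (K := cut_supp C)).
- exact: cut_atlas.
- exact: cut_compact.
- by move=> x /cut_sub[q [cq _] <-]; exists q.
- move=> k; apply: CkM; [exact: codom_open| |exact: hS].
  by apply: Ck_subset (cut_smooth C k).
- by move=> x /cut_out bx; rewrite /b bx mul0r.
Qed.

Definition cut_fun : M -> R := chart_fun c (fun x => b x * 1).

Lemma cut_fun_Cinf : Cinf M cut_fun.
Proof. by apply: cut_mul_Cinf => k; exact: Ck_cst. Qed.

Lemma near_cut (P : set 'rV[R]_n) : (\forall x \near coord c p, P x) ->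
  \forall q \near p, dom c q /\ P (coord c q).
Proof.
move=> pP; apply: filterS2 (open_nbhs_nbhs (conj (dom_open c) (cut_dom C)))
    (coord_cont (cut_dom C) pP).
by move=> q.
Qed.

Lemma cut_fun_near : \forall q \near p, cut_fun q = 1.
Proof.
apply: filterS (near_cut (cut_near C)) => q [cq bq].
by rewrite /cut_fun /chart_fun asboolT// /b bq mulr1.
Qed.

Lemma cut_fun1 : cut_fun p = 1.
Proof. exact: nbhs_singleton cut_fun_near. Qed.

Lemma cut_bump_supp q : dom c q -> b (coord c q) != 0 -> U q.
Proof.
move=> cq; apply: contraNP => Uq; apply/eqP; apply: cut_out =>
    /cut_sub[q' [cq' Uq'] E].
by apply: Uq; rewrite -(coordK cq) -E coordK.
Qed.

Lemma cut_fun_supp q : cut_fun q != 0 -> U q.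
Proof.
rewrite /cut_fun /chart_fun; case: asboolP => [cq|_]; last by rewrite eqxx.
rewrite mulr1; exact: cut_bump_supp.
Qed.

Definition cut_coord (l : 'I_n) : M -> R :=
  chart_fun c (fun x => b x * (x ord0 l - coord c p ord0 l)).

Lemma cut_coord_Cinf l : Cinf M (cut_coord l).
Proof.
apply: cut_mul_Cinf => k.
by apply: CkD (Ck_cst k _ _) => //; [exact: codom_open|exact: Ck_coord].
Qed.

(** The speed is damped by the bump, so points outside U do not move and the velocity extends
    smoothly by 0. The inner test guards against leaving the chart, which does not happen for t near
    0. *)
Definition cut_curve (u : 'rV[R]_n) (q : M) (t : R) : M :=
  if `[< dom c q >] then
    let y := t *: (b (coord c q) *: u) + coord c q in
    if `[< (coord c @` dom c) y >] then coord_inv c y else q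
  else q.

Lemma cut_curve0 u q : cut_curve u q 0 = q.
Proof.
rewrite /cut_curve; case: asboolP => // cq; rewrite /= scale0r add0r.
by rewrite asboolT ?coordK//; exists q.
Qed.

Lemma cut_curve_out u q t : ~ U q -> cut_curve u q t = q.
Proof.
move=> Uq; rewrite /cut_curve; case: asboolP => // cq.
have -> : b (coord c q) = 0 by apply/eqP; apply: contra_notT Uq; exact:
    cut_bump_supp.
by rewrite /= scale0r scaler0 add0r asboolT ?coordK//; exists q.
Qed.

Lemma cut_curve_derive u f q : Cinf M f ->
  is_derive (0 : R) (1 : R) (f \o cut_curve u q)
    (chart_fun c (fun x => b x * 'D_u (f \o coord_inv c) x) q).
Proof.
move=> fM; rewrite /chart_fun; have [cq|ncq] := pselect (dom c q); last first.
  rewrite asboolF// (_ : f \o _ = cst (f q)); first exact: is_derive_cst.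
  by apply/funext => t; rewrite /= /cut_curve asboolF.
rewrite asboolT//.
have qI : (coord c @` dom c) (coord c q) by exists q.
pose g t := (f \o coord_inv c) (t *: (b (coord c q) *: u) + coord c q).
have E : \forall t \near (0 : R), g t = (f \o cut_curve u q) t.
  have cont : {for (0 : R), continuous
      (fun t : R => t *: (b (coord c q) *: u) + coord c q)}.
    by move=> ?; apply: cvgD; [apply: cvgZr_tmp; exact: cvg_id|exact: cvg_cst].
  have H : \forall y \near (0 : R) *: (b (coord c q) *: u) + coord c q,
      (coord c @` dom c) y.
    by rewrite scale0r add0r; apply: open_nbhs_nbhs; split;
        [exact: codom_open|].
  have K : \forall t \near (0 : R), (coord c @` dom c)
      (t *: (b (coord c q) *: u) + coord c q).
    exact: cont _ H.
  near=> t; have tI : (coord c @` dom c)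
      (t *: (b (coord c q) *: u) + coord c q) by near: t.
  by rewrite /g /= /cut_curve asboolT//= asboolT.
apply: near_eq_is_derive E _; apply: is_derive_line; rewrite scale0r add0r.
apply: is_derive_scaledir; apply: derivableP.
by have [_ /(_ u)[+ _]] := fM c (cut_atlas C) 1%N; exact.
Unshelve. all: by end_near. Qed.

Lemma cut_curve_field u : @curve_field R M (cut_curve u).
Proof.
split=> [q|f fM]; first exact: cut_curve0.
split=> [q|]; first by have [] := cut_curve_derive u q fM.
rewrite (_ : (fun q => _) = chart_fun c
    (fun x => b x * 'D_u (f \o coord_inv c) x)).
  apply: cut_mul_Cinf => k; have [_ /(_ u)[]//] := fM c (cut_atlas C) k.+1.
by apply/funext => q; have [_ ->] := cut_curve_derive u q fM.
Qed.

Definition cut_vfield u : vfield M := curve_vfield (cut_curve_field u).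

Lemma cut_vfieldE u f : Cinf M f ->
  cut_vfield u p f = 'D_u (f \o coord_inv c) (coord c p).
Proof.
move=> fM; rewrite curve_vfieldE//; have [_ ->] := cut_curve_derive u p fM.
rewrite /chart_fun asboolT ?mulr1; last exact: cut_dom.
by rewrite /b (nbhs_singleton (cut_near C)) mul1r.
Qed.

Lemma cut_vfield_coord u l : cut_vfield u p (cut_coord l) = u ord0 l.
Proof.
rewrite (cut_vfieldE _ (cut_coord_Cinf l)).
have E : \forall x \near coord c p, ((x : 'rV[R]_n) ord0 l - coord c p ord0 l)
    = (cut_coord l \o coord_inv c) x.
  have H1 : \forall x \near coord c p, (coord c @` dom c) x.
    by apply: open_nbhs_nbhs; split;
        [exact: codom_open|exists p => //; exact: cut_dom].
  apply: filterS2 H1 (cut_near C) => _ [q cq <-] bq.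
  by rewrite /cut_coord /chart_fun /= coordK// asboolT// /b bq mul1r.
suff [_ <-] : is_derive (coord c p) u (cut_coord l \o coord_inv c) (u ord0 l)
    by [].
apply: near_eq_is_derive E _; apply: is_derive_line0.
rewrite (_ : (fun s => _) = (fun s : R => s * u ord0 l)).
  by apply: is_derive_eq; rewrite scaler0 add0r [_ *: _]mulr1.
by apply/funext => s; rewrite !mxE addrK.
Qed.

Lemma cut_vfield_sum u f : Cinf M f ->
  cut_vfield u p f = \sum_j u ord0 j * cut_vfield (delta_mx ord0 j) p f.
Proof.
move=> fM; rewrite cut_vfieldE// (@C1_derive_coord _ _ (coord c @` dom c)).
- by apply: eq_bigr => j _; rewrite cut_vfieldE.
- exact: codom_open.
- by exists p => //; exact: cut_dom.
- exact: (fM c (cut_atlas C)).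
Qed.

(** A derivation might a priori see more than the coordinates. But each coordinate field is a
    combination of the E_k, and evaluation on the coordinates shows that the matrix m of these
    combinations satisfies m B = 1. Both matrices are square, so the coordinate fields span as
    well. *)
Lemma cut_coord_basis (E : 'I_n -> tangent M p) :
  (forall v, exists a : 'I_n -> R, v = \sum_k a k *: E k) ->
  (\matrix_(k, l) E k (cut_coord l)) \in unitmx /\
  forall v : tangent M p, v = cut_vfield (\row_l v (cut_coord l)) p.
Proof.
move=> span; set B := \matrix_(_, _) _.
have /choice[m mE] : forall j, exists a : 'I_n -> R, cut_vfield
    (delta_mx ord0 j) p = \sum_k a k *: E k.
  by move=> j; exact: span.
have mB : (\matrix_(j, k) m j k) *m B = 1%:M.
  apply/matrixP => j l; rewrite !mxE.
  have := cut_vfield_coord (delta_mx ord0 j) l; rewrite mE tvec_sum mxE eqxx /=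
      eq_sym => <-.
  by apply: eq_bigr => k _; rewrite !mxE.
have [_ Bu] := mulmx1_unit mB; split=> // v.
have Bm : B *m (\matrix_(j, k) m j k) = 1%:M by exact: mulmx1C.
apply: tangent_ext => f fM; rewrite cut_vfield_sum//.
have [a vE] := span v.
have -> : v f = \sum_k a k * E k f by rewrite vE tvec_sum.
have EE k : E k f = \sum_j B k j * cut_vfield (delta_mx ord0 j) p f.
  have dE : \col_j cut_vfield (delta_mx ord0 j) p f = (\matrix_(j, k) m j k) *m
      \col_i E i f.
    apply/matrixP => j i; rewrite !mxE mE tvec_sum.
    by apply: eq_bigr => l _; rewrite !mxE.
  have /matrixP/(_ k ord0) : \col_i E i f = B *m \col_j cut_vfield
      (delta_mx ord0 j) p f.
    by rewrite dE mulmxA Bm mul1mx.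
  rewrite !mxE => ->; apply: eq_bigr => j _. by congr (_ * _); rewrite mxE.
under eq_bigr do rewrite EE mulr_sumr.
rewrite exchange_big; apply: eq_bigr => j _; rewrite mxE.
have -> : v (cut_coord j) = \sum_k a k * E k (cut_coord j) by rewrite vE
    tvec_sum.
rewrite mulr_suml; apply: eq_bigr => k _; by rewrite mulrA mxE.
Qed.

End Cut.

End ManifoldFunctionsTheory.

(** * Local frames *)

Section SmoothOperations.
Variables (R : realType) (M : manifold R 3).

Lemma mCinf_lt_near (f : M -> R) (p : mtop M) (a : R) :
  Cinf M f -> a < f p -> \forall q \near p, a < f q.
Proof.
move=> fM afp; have := mCinf_continuous (p := p) fM => /cvgr_gt; exact.
Qed.

(** [clamp] makes the power smooth on all of M; near p, where f > f p / 2, it is the identity. *)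
Lemma inv_sqrt_near (f : M -> R) (p : mtop M) : Cinf M f -> 0 < f p ->
  exists2 s : M -> R, Cinf M s &
    \forall q \near p, 0 < f q /\ 0 < s q /\ s q ^+ 2 * f q = 1.
Proof.
move=> fM fp; exists (fun q => 1 * (clamp (f p) (f q)) `^ (- 2^-1)).
  move=> c cA k.
  apply: (@Ck_comp1 _ _ _ _ _ (fun t => 1 * t `^ (- 2^-1))
      (fun x => clamp (f p) (f (coord_inv c x))) _ (Ck1_powR k 1 (- 2^-1))).
  - exact: codom_open.
  - by move=> x _; exact: clamp_gt0.
  - by apply: (@Ck_clamp _ _ _ _ (f \o coord_inv c));
      [exact: codom_open|exact: fM].
have f2 : f p / 2 < f p by lra.
apply: filterS (mCinf_lt_near fM f2) => q fq.
have fq0 : 0 < f q by lra.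
rewrite clamp_id ?(ltW fq)// mul1r; split=> //; split; first exact: powR_gt0.
have -> : (f q `^ (- 2^-1)) ^+ 2 = (f q)^-1.
  rewrite -powR_mulrn ?powR_ge0// -powRrM (_ : - 2^-1 * 2%:R = -1); last by
      field.
  by rewrite powR_inv1// ltW.
by rewrite mulVf// gt_eqF.
Qed.

(** The reciprocal is s^2 f with s = (f^2)^(-1/2) near p, which allows either sign of f. *)
Lemma inv_near (f : M -> R) (p : mtop M) : Cinf M f -> f p != 0 ->
  exists2 r : M -> R, Cinf M r & \forall q \near p, r q * f q = 1.
Proof.
move=> fM fp; have [|s sM sE] := @inv_sqrt_near (fun q => f q * f q) p
    (CinfM fM fM).
  by rewrite -expr2 exprn_even_gt0.
exists (fun q => s q * s q * f q); first by do !apply: CinfM.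
by apply: filterS sE => q [_ [_ <-]]; ring.
Qed.

End SmoothOperations.

Lemma Cinf_prod (R : realType) (X : smoothSpace R) (I : Type) (r : seq I)
    (f : I -> X -> R) :
  (forall i, Cinf X (f i)) -> Cinf X (fun x => \prod_(i <- r) f i x).
Proof.
move=> fX; elim: r => [|i r IHr].
  rewrite (_ : (fun x => _) = fun=> 1); first exact: Cinf_cst.
  by apply/funext => x; rewrite big_nil.
rewrite (_ : (fun x => _) = fun x => f i x * \prod_(i <- r) f i x).
  exact: CinfM.
by apply/funext => x; rewrite big_cons.
Qed.

Lemma Cinf_det (R : realType) (X : smoothSpace R) m (A : X -> 'M[R]_m) :
  (forall i j, Cinf X (fun x => A x i j)) -> Cinf X (fun x => \det (A x)).
Proof.
move=> AX; rewrite /determinant; apply: Cinf_sum => s.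
by apply: CinfM; [exact: Cinf_cst|exact: Cinf_prod].
Qed.

Section Coframings.
Variables (R : realType) (M : manifold R 3).

(** The covectors are sums of [fcoef] d [fpot]: in this shape exterior derivatives and pullbacks to
    the bundles reduce to derivatives of functions. Duality is a separate condition because it holds
    only locally. *)
Record coframing := Coframing {
  fvec : 'I_3 -> vfield M;
  fpot : 'I_3 -> M -> R;
  fcoef : 'I_3 -> 'I_3 -> M -> R;
  fpot_Cinf : forall l, Cinf M (fpot l);
  fcoef_Cinf : forall k l, Cinf M (fcoef k l) }.

Definition eta (F : coframing) (k : 'I_3) : form1 M :=
  fun q v => \sum_l fcoef F k l q * v (fpot F l).

Arguments eta : clear implicits.

Definition dual (F : coframing) (q : M) :=
  (forall k l, eta F k q (fvec F l q) = (k == l)%:R) /\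
  (forall v : tangent M q, v = \sum_k eta F k q v *: fvec F k q).

Lemma eta_scalar F k q : scalar (eta F k q).
Proof.
move=> a u v; rewrite /eta mulr_sumr -big_split; apply: eq_bigr => l _.
change (fcoef F k l q * (a * u (fpot F l) + v (fpot F l)) =
  a * (fcoef F k l q * u (fpot F l)) + fcoef F k l q * v (fpot F l)); ring.
Qed.

Lemma eta_smooth F k : smooth_form (eta F k).
Proof.
split=> [q|V]; first exact: eta_scalar.
apply: Cinf_sum => l; apply: CinfM; first exact: fcoef_Cinf.
by apply: vf_smooth; exact: fpot_Cinf.
Qed.

Lemma etaD F k q u v : eta F k q (u + v) = eta F k q u + eta F k q v.
Proof. by have := eta_scalar F k (q := q) 1 u v; rewrite scale1r mul1r. Qed.

Lemma eta0 F k q : eta F k q 0 = 0.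
Proof. by rewrite /eta big1// => l _; rewrite tvec0 mulr0. Qed.

Lemma etaZ F k q a v : eta F k q (a *: v) = a * eta F k q v.
Proof. by have := eta_scalar F k (q := q) a v 0; rewrite addr0 eta0 addr0. Qed.

Lemma etaN F k q v : eta F k q (- v) = - eta F k q v.
Proof. by rewrite -scaleN1r etaZ mulN1r. Qed.

Lemma eta_sum F k q (I : Type) (r : seq I) (v : I -> tangent M q) :
  eta F k q (\sum_(i <- r) v i) = \sum_(i <- r) eta F k q (v i).
Proof.
by elim: r => [|i r IHr]; rewrite ?big_nil ?eta0// !big_cons etaD IHr.
Qed.

Lemma dual_span F q :
  (forall k l, eta F k q (fvec F l q) = (k == l)%:R) ->
  (forall v : tangent M q, exists a : 'I_3 -> R, v = \sum_k a k *: fvec F k q)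
      ->
  dual F q.
Proof.
move=> FE span; split=> // v; have [a vE] := span v.
have aE k : eta F k q v = a k.
  rewrite vE eta_sum (bigD1 k)//= big1 => [|l lk].
    by rewrite etaZ FE eqxx mulr1 addr0.
  by rewrite etaZ FE eq_sym (negPf lk) mulr0.
by rewrite [LHS]vE; apply: eq_bigr => k _; rewrite aE.
Qed.

Lemma coframing_exists (E : 'I_3 -> vfield M) (p : mtop M) :
  (forall v : tangent M p, exists a : 'I_3 -> R, v = \sum_k a k *: E k p) ->
  exists2 F : coframing, fvec F = E &
    \forall q \near p, forall k l, eta F k q (E l q) = (k == l)%:R.
Proof.
move=> span; have [C _] := @cutoff_exists R 3 M p setT filterT.
have [Bu _] := cut_coord_basis C (E := fun k => E k p) span.
pose B (q : M) : 'M[R]_3 := \matrix_(k, l) E k q (cut_coord C l).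
have BC k l : Cinf M (fun q => B q k l).
  rewrite (_ : (fun q => _) = fun q => E k q (cut_coord C l)).
    by apply: vf_smooth; exact: cut_coord_Cinf.
  by apply/funext => q; rewrite mxE.
have dC : Cinf M (fun q => \det (B q)) by exact: Cinf_det.
have [|r rC rE] := @inv_near R M _ p dC.
  by move: Bu; rewrite unitmxE unitfE.
(* The inverse of B by Cramer's formula, with r a global smooth function equal to 1 / det B near
   p. *)
pose phi k l q := r q * (\adj (B q)) l k.
have phiC k l : Cinf M (phi k l).
  apply: CinfM => //; rewrite (_ : (fun q => _) = fun q => cofactor (B q) k l).
    apply: CinfM; first exact: Cinf_cst.
    apply: Cinf_det => i j; rewrite
        (_ : (fun q => _) = fun q => B q (lift k i) (lift l j)).
      exact: BC.
    by apply/funext => q; rewrite !mxE.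
  by apply/funext => q; rewrite mxE.
exists (Coframing E (cut_coord_Cinf C) phiC) => //.
apply: filterS rE => q rq k l; rewrite /eta /=.
have /matrixP/(_ l k) := mul_mx_adj (B q); rewrite !mxE => H.
transitivity (r q * \sum_j B q l j * \adj (B q) j k).
  rewrite mulr_sumr; apply: eq_bigr => j _; rewrite /phi [B q l j]mxE; ring.
by rewrite H eq_sym; case: (k == l); rewrite ?mulr1n ?mulr0n ?mulr0 ?rq.
Qed.

End Coframings.

Arguments eta {R M} F k p _ : rename.

Lemma sum_I3 (V : nmodType) (F : 'I_3 -> V) :
  \sum_i F i = F i1 + F i2 + F i3.
Proof.
rewrite !big_ord_recl big_ord0 addr0 addrA; do 2?congr (_ + _);
  by congr F; apply: val_inj.
Qed.

Lemma ind_I3 (P : 'I_3 -> Prop) : P i1 -> P i2 -> P i3 -> forall i, P i.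
Proof.
move=> P1 P2 P3 [[|[|[|//]]] i3].
- by rewrite (_ : Ordinal i3 = i1)//; exact: val_inj.
- by rewrite (_ : Ordinal i3 = i2)//; exact: val_inj.
- by rewrite (_ : Ordinal i3 = Defs.i3)//; exact: val_inj.
Qed.

Section Planes.
Variables (R : realType) (M : manifold R 3) (S : subRiemannianSurface M).
Implicit Types p : M.

Lemma plane_comb p a b v w : plane S p v -> plane S p w ->
  plane S p (a *: v + b *: w).
Proof.
have [V [W /nbhs_singleton [_ ->]]] := plane_smooth S p.
move=> [a1 [b1 ->]] [a2 [b2 ->]].
exists (a * a1 + b * a2), (a * b1 + b * b2).
by rewrite !scalerDr !scalerA !scalerDl addrACA.
Qed.

Lemma plane0 p : plane S p 0.
Proof.
have [V [W /nbhs_singleton [_ ->]]] := plane_smooth S p.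
by exists 0, 0; rewrite !scale0r addr0.
Qed.

Lemma planeZ p a v : plane S p v -> plane S p (a *: v).
Proof. by move=> pv; have := plane_comb a 0 pv pv; rewrite scale0r addr0. Qed.

Lemma metric_comb p a b v w x : plane S p v -> plane S p w -> plane S p x ->
  metric S (a *: v + b *: w) x = a * metric S v x + b * metric S w x.
Proof.
move=> pv pw px; rewrite metric_linear//; last exact: planeZ.
have p0 := plane0 p.
have m0 : metric S (0 : tangent M p) x = 0.
  by have := metric_linear 1 p0 p0 px; rewrite scale1r addr0 mul1r; lra.
by have := metric_linear b pw p0 px; rewrite !addr0 => ->; rewrite m0 addr0.
Qed.

Lemma metric_sqr p a b v w : plane S p v -> plane S p w ->
  metric S (a *: v + b *: w) (a *: v + b *: w) =
  a ^+ 2 * metric S v v + 2 * a * b * metric S v w + b ^+ 2 * metric S w w.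
Proof.
move=> pv pw; have pvw := plane_comb a b pv pw.
rewrite metric_comb// [metric S v _]metric_sym//
    [metric S w (_ + _)]metric_sym//.
rewrite !metric_comb// [metric S w v]metric_sym//; ring.
Qed.

(** Cramer's rule re-expresses the pairs in terms of (v, w); the new determinant is a quotient of
    two positive ones. *)
Lemma orient_positive p v w : orient S p (v, w) ->
  orient S p = [set vw | exists a b c d : R,
    [/\ 0 < a * d - b * c, vw.1 = a *: v + b *: w & vw.2 = c *: v + d *: w]].
Proof.
have [V [W /nbhs_singleton [[li _] ->]]] := orient_smooth S p.
move=> [a [b [c [d [D /= -> ->]]]]].
apply/seteqP; split=> -[v' w'] [a' [b' [c' [d' [D' /= -> ->]]]]].
  exists ((a' * d - b' * c) / (a * d - b * c)),
      ((a * b' - b * a') / (a * d - b * c)),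
    ((c' * d - d' * c) / (a * d - b * c)),
        ((a * d' - b * c') / (a * d - b * c)).
  have D0 : a * d - b * c != 0 by rewrite gt_eqF.
  have E1 x y : (x * d - y * c) / (a * d - b * c) * a + (a * y - b * x) /
      (a * d - b * c) * c = x.
    by field.
  have E2 x y : (x * d - y * c) / (a * d - b * c) * b + (a * y - b * x) /
      (a * d - b * c) * d = y.
    by field.
  split.
  - rewrite [X in 0 < X](_ : _ = (a' * d' - b' * c') / (a * d - b * c)); last
      by field.
    exact: divr_gt0.
  - by rewrite /= !scalerDr !scalerA addrACA -!scalerDl E1 E2.
  - by rewrite /= !scalerDr !scalerA addrACA -!scalerDl E1 E2.
exists (a' * a + b' * c), (a' * b + b' * d), (c' * a + d' * c),
    (c' * b + d' * d).
split.
- rewrite [X in 0 < X](_ : _ = (a' * d' - b' * c') * (a * d - b * c)); last by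
    ring.
  exact: mulr_gt0.
- by rewrite /= !scalerDr !scalerA addrACA -!scalerDl.
- by rewrite /= !scalerDr !scalerA addrACA -!scalerDl.
Qed.

(** Where the frame is dual on a neighbourhood, d eta^3(E_i, E_j) = - eta^3([E_i, E_j]); the last
    clause then makes E_3 the Reeb field of eta^3. *)
Definition reeb_frame (F : coframing M) (q : M) := [/\ dual F q,
  orient S q (fvec F i1 q, fvec F i2 q),
  plane S q = [set v | eta F i3 q v = 0],
  forall w, plane S q w ->
    metric S w w = eta F i1 q w ^+ 2 + eta F i2 q w ^+ 2 &
  [/\ eta F i3 q (bracket (fvec F i1) (fvec F i2) q) = -1,
      eta F i3 q (bracket (fvec F i3) (fvec F i1) q) = 0 &
      eta F i3 q (bracket (fvec F i2) (fvec F i3) q) = 0]].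

Definition orthonormal_pair (E1 E2 : vfield M) (q : M) :=
  [/\ plane_basis (plane S q) (E1 q) (E2 q), orient S q (E1 q, E2 q) &
      forall a b : R, metric S (a *: E1 q + b *: E2 q) (a *: E1 q + b *: E2 q)
          = a ^+ 2 + b ^+ 2].

Lemma orthonormal_pair_exists (p : mtop M) :
  exists E1 E2 : vfield M, \forall q \near p, orthonormal_pair E1 E2 q.
Proof.
have [V0 [W0 VW0]] := orient_smooth S p.
have [C _] := cutoff_exists VW0.
(* Cut off, the fields lie in the plane at every point, as [metric_smooth] requires. *)
pose V := vfZ (cut_fun_Cinf C) V0; pose W := vfZ (cut_fun_Cinf C) W0.
have inplane (q : M) : plane S q (V q) /\ plane S q (W q).
  have [c0|/cut_fun_supp[[_ pq] _]] := eqVneq (cut_fun C q) 0.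
    have VE : V q = 0 by rewrite /V /= c0 scale0r.
    have WE : W q = 0 by rewrite /W /= c0 scale0r.
    by rewrite VE WE; split; exact: plane0.
  split; apply: planeZ; rewrite pq; first by exists 1, 0; rewrite scale1r
      scale0r addr0.
  by exists 0, 1; rewrite scale1r scale0r add0r.
have pV q := (inplane q).1; have pW q := (inplane q).2.
pose g11 q := metric S (V q) (V q).
pose g12 q := metric S (V q) (W q).
pose g22 q := metric S (W q) (W q).
have g11C : Cinf M g11 by exact: metric_smooth.
have g12C : Cinf M g12 by exact: metric_smooth.
have g22C : Cinf M g22 by exact: metric_smooth.
have VWnear : \forall q \near p, V q = V0 q /\ W q = W0 q.
  by apply: filterS (cut_fun_near C) => q cq; rewrite /V /W /= cq !scale1r.
clearbody V W.
have [[li _] _] := nbhs_singleton VW0; have [Vp Wp] := nbhs_singleton VWnear.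
(* Gram-Schmidt without division: D is the squared length of g11 W - g12 V, which is orthogonal to
   V. *)
pose D q := g11 q * (g11 q * g22 q - g12 q * g12 q).
have DC : Cinf M D by apply: CinfM => //; apply: CinfB; apply: CinfM.
have g11p : 0 < g11 p.
  apply: metric_pos => //; apply/eqP => V0'; move: V0'; rewrite Vp => V0'.
  have := li 1 0; rewrite V0' scaler0 scale0r addr0 => /(_ erefl)[/eqP].
  by rewrite oner_eq0.
have Dp : 0 < D p.
  have -> : D p = metric S (- g12 p *: V p + g11 p *: W p)
      (- g12 p *: V p + g11 p *: W p).
    by rewrite metric_sqr// /D -/(g11 p) -/(g12 p) -/(g22 p); ring.
  apply: metric_pos; first exact: plane_comb.
  apply/eqP; rewrite Vp Wp => /li[_ /eqP]; by rewrite gt_eqF.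
have [s1 s1C s1E] := inv_sqrt_near g11C g11p.
have [s2 s2C s2E] := inv_sqrt_near DC Dp.
pose E1 := vfZ s1C V.
have g12NC := CinfN g12C.
pose E2 := vfZ s2C (vfD (vfZ g12NC V) (vfZ g11C W)).
have E1E q : E1 q = s1 q *: V q by [].
have E2E q : E2 q = s2 q *: (- g12 q *: V q + g11 q *: W q) by [].
clearbody E1 E2; exists E1, E2; near=> q.
have [g11q [s1q s1g]] : 0 < g11 q /\ 0 < s1 q /\ s1 q ^+ 2 * g11 q = 1 by near:
    q.
have [Dq [s2q s2g]] : 0 < D q /\ 0 < s2 q /\ s2 q ^+ 2 * D q = 1 by near: q.
have [Vq Wq] : V q = V0 q /\ W q = W0 q by near: q.
have [[liq pq] oq] : plane_basis (plane S q) (V0 q) (W0 q) /\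
   orient S q = [set vw | exists a b c d : R,
        [/\ 0 < a * d - b * c, vw.1 = a *: V0 q + b *: W0 q &
            vw.2 = c *: V0 q + d *: W0 q]] by near: q.
have E1q : E1 q = s1 q *: V0 q by rewrite E1E Vq.
have E2q : E2 q = (- s2 q * g12 q) *: V0 q + (s2 q * g11 q) *: W0 q.
  by rewrite E2E Vq Wq scalerDr !scalerA mulrN mulNr.
split.
- split=> [a b|].
    rewrite E1q E2q scalerDr !scalerA addrA -scalerDl => /liq[].
    move=> H1 H2; have b0 : b = 0.
      apply/eqP; move/eqP: H2; rewrite mulf_eq0 (gt_eqF (mulr_gt0 s2q g11q))
          orbF.
      by [].
    split=> //; move: H1; rewrite b0 mul0r addr0 => /eqP.
    by rewrite mulf_eq0 (gt_eqF s1q) orbF => /eqP.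
  rewrite pq; apply/seteqP; split=> _ [a [b ->]].
    exists ((a + b * g12 q / g11 q) / s1 q), (b / (s2 q * g11 q)).
    have g0 : g11 q != 0 by rewrite gt_eqF.
    have s10 : s1 q != 0 by rewrite gt_eqF.
    have s20 : s2 q != 0 by rewrite gt_eqF.
    have Ha : (a + b * g12 q / g11 q) / s1 q * s1 q + b / (s2 q * g11 q) *
        (- s2 q * g12 q) = a.
      by field; rewrite g0 s10 s20.
    have Hb : b / (s2 q * g11 q) * (s2 q * g11 q) = b by field; rewrite g0 s20.
    by rewrite E1q E2q scalerDr !scalerA addrA -scalerDl Ha Hb.
  exists (a * s1 q - b * (s2 q * g12 q)), (b * (s2 q * g11 q)).
  by rewrite E1q E2q scalerDr !scalerA addrA -scalerDl mulNr mulrN.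
- rewrite oq /=; exists (s1 q), 0, (- s2 q * g12 q), (s2 q * g11 q).
  by split=> //=; [rewrite mul0r subr0; do !apply: mulr_gt0|rewrite scale0r
      addr0].
- move=> a b.
  have -> : a *: E1 q + b *: E2 q =
      (a * s1 q + b * (- s2 q * g12 q)) *: V q + (b * (s2 q * g11 q)) *: W q.
    by rewrite E1q E2q Vq Wq scalerDr !scalerA addrA -scalerDl.
  rewrite (metric_sqr _ _ (pV q) (pW q)) -/(g11 q) -/(g12 q) -/(g22 q).
  transitivity (a ^+ 2 * (s1 q ^+ 2 * g11 q) + b ^+ 2 * (s2 q ^+ 2 * D q)).
    by rewrite /D; ring.
  by rewrite s1g s2g !mulr1.
Unshelve. all: by end_near. Qed.

End Planes.

Section ReebFrames.
Variables (R : realType) (M : manifold R 3) (S : subRiemannianSurface M).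
Hypothesis hS : contact S.

(** The plane is the kernel of a single functional, so subtracting a multiple of N brings any vector
    into it. In this way the contact form bounds the dimension of the space of derivations. *)
Lemma transversal_span (q : M) (b : tangent M q -> R) (E1 E2 N : tangent M q) :
  scalar b -> plane S q = [set v | b v = 0] -> plane_basis (plane S q) E1 E2 ->
  ~ plane S q N ->
  forall v, exists a1 a2 a3 : R, v = a1 *: E1 + a2 *: E2 + a3 *: N.
Proof.
move=> bL pb [_ pE] Nq v.
have bN : b N != 0 by apply/eqP => bN0; apply: Nq; rewrite pb.
have : plane S q ((- (b v / b N)) *: N + v).
  by rewrite pb /= bL mulNr divfK// addNr.
rewrite pE => -[a1 [a2 E]]; exists a1, a2, (b v / b N).
by rewrite -E scaleNr addrC addNKr.
Qed.

Lemma reeb_frame_exists (p : mtop M) :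
  exists F : coframing M, \forall q \near p, reeb_frame S F q.
Proof.
have [E1 [E2 E12]] := orthonormal_pair_exists S p.
(* This order of the bracket gives eta^3([E1, E2]) = -1 as soon as eta^3(N) = 1. *)
pose N : vfield M := bracket E2 E1.
have NE q : N q = - bracket E1 E2 q by exact: bracket_antisym.
have [b bS bp] := hS p.
have Ntrans : \forall q \near p, ~ plane S q (N q).
  (* [nonholonomic] at q asks the fields to span the plane on a neighbourhood of q. *)
  have : \forall q \near p, \forall r \near q, orthonormal_pair S E1 E2 r.
    exact: nbhs_interior.
  apply: filterS => q Eq; rewrite NE => Nq.
  apply: (@nonholonomic _ _ S q E1 E2); first by apply: filterS Eq => r [].
  by have := planeZ (-1) Nq; rewrite scaleN1r opprK.
have span : \forall q \near p, forall v : tangent M q,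
    exists a1 a2 a3 : R, v = a1 *: E1 q + a2 *: E2 q + a3 *: N q.
  near=> q.
  have [pq _] : plane S q = [set v | b q v = 0] /\
    exists V W Z : vfield M, wedge21 (dform b) b V W Z q <> 0 by near: q.
  have [Eq _ _] : orthonormal_pair S E1 E2 q by near: q.
  apply: transversal_span pq Eq _; first exact: bS.1.
  by near: q.
pose E (k : 'I_3) : vfield M := nth (@vf0 R M) [:: E1; E2; N] k.
have [F FE Fd] : exists2 F : coframing M, fvec F = E &
    \forall q \near p, forall k l, eta F k q (E l q) = (k == l)%:R.
  apply: coframing_exists => v.
  have [a1 [a2 [a3 ->]]] := nbhs_singleton span v.
  by exists (fun k => nth 0 [:: a1; a2; a3] k); rewrite sum_I3.
(* Adding x E1 + y E2 to N changes eta^3([E2, N]) by x and eta^3([E1, N]) by - y, since eta^3 kills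
   the terms with derivatives of x and y. These values make both vanish for E3. *)
pose x q := - eta F i3 q (bracket E2 N q).
pose y q := eta F i3 q (bracket E1 N q).
have xC : Cinf M x.
  by apply: CinfN; have [_] := eta_smooth F i3; exact.
have yC : Cinf M y by have [_] := eta_smooth F i3; exact.
pose E3 := vfD N (vfD (vfZ xC E1) (vfZ yC E2)).
have E3E q : E3 q = N q + (x q *: E1 q + y q *: E2 q) by [].
(* The coframe dual to (E1, E2, E3) is eta^1 - x eta^3, eta^2 - y eta^3, eta^3. *)
pose phi (k l : 'I_3) : M -> R := nth (fcoef F k l)
  [:: (fun q => fcoef F i1 l q - x q * fcoef F i3 l q);
      (fun q => fcoef F i2 l q - y q * fcoef F i3 l q)] k.
have phiC k l : Cinf M (phi k l).
  have fC := fcoef_Cinf F.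
  move: k; apply: (@ind_I3 (fun k => Cinf M (phi k l))).
  - exact: CinfB (fC i1 l) (CinfM xC (fC i3 l)).
  - exact: CinfB (fC i2 l) (CinfM yC (fC i3 l)).
  - exact: fC.
pose F' := Coframing (fun k => nth (@vf0 R M) [:: E1; E2; E3] k)
    (@fpot_Cinf _ _ F) phiC.
have eta'1 q v : eta F' i1 q v = eta F i1 q v - x q * eta F i3 q v.
  by rewrite /eta !sum_I3 /= /phi /=; ring.
have eta'2 q v : eta F' i2 q v = eta F i2 q v - y q * eta F i3 q v.
  by rewrite /eta !sum_I3 /= /phi /=; ring.
have eta'3 q v : eta F' i3 q v = eta F i3 q v by rewrite /eta !sum_I3.
have fv1 : fvec F' i1 = E1 by [].
have fv2 : fvec F' i2 = E2 by [].
have fv3 : fvec F' i3 = E3 by [].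
exists F'; near=> q.
have [[li pq] oq mq] : orthonormal_pair S E1 E2 q by near: q.
have spanq : forall v : tangent M q,
    exists a1 a2 a3 : R, v = a1 *: E1 q + a2 *: E2 q + a3 *: N q by near: q.
have Fq : forall k l, eta F k q (E l q) = (k == l)%:R by near: q.
have e3E1 : eta F i3 q (E1 q) = 0 by have := Fq i3 i1.
have e3E2 : eta F i3 q (E2 q) = 0 by have := Fq i3 i2.
have e3N : eta F i3 q (N q) = 1 by have := Fq i3 i3.
have e1E1 : eta F i1 q (E1 q) = 1 by have := Fq i1 i1.
have e1E2 : eta F i1 q (E2 q) = 0 by have := Fq i1 i2.
have e1N : eta F i1 q (N q) = 0 by have := Fq i1 i3.
have e2E1 : eta F i2 q (E1 q) = 0 by have := Fq i2 i1.
have e2E2 : eta F i2 q (E2 q) = 1 by have := Fq i2 i2.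
have e2N : eta F i2 q (N q) = 0 by have := Fq i2 i3.
have e3E12 : eta F i3 q (bracket E1 E2 q) = -1.
  by move: e3N; rewrite NE etaN => H; rewrite -H opprK.
have planeE v : plane S q v -> v = eta F i1 q v *: E1 q + eta F i2 q v *: E2 q.
  by rewrite pq => -[a1 [a2 ->]]; rewrite !etaD !etaZ e1E1 e1E2 e2E1 e2E2
      !mulr0 !mulr1 addr0 add0r.
have pqE : plane S q = [set v | eta F i3 q v = 0].
  apply/seteqP; split=> v.
    by rewrite pq => -[a1 [a2 ->]] /=; rewrite etaD !etaZ e3E1 e3E2 !mulr0
        addr0.
  have [a1 [a2 [a3 ->]]] := spanq v.
  rewrite /= !etaD !etaZ e3E1 e3E2 e3N !mulr0 mulr1 !add0r => ->.
  by rewrite scale0r addr0 pq; exists a1, a2.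
split.
- apply: dual_span.
    have simp := (e1E1, e1E2, e1N, e2E1, e2E2, e2N, e3E1, e3E2, e3N).
    apply: ind_I3; apply: ind_I3; rewrite ?(fv1, fv2, fv3, eta'1, eta'2, eta'3);
      rewrite ?E3E ?etaD ?etaZ !simp ?(mulr0, mulr1, subr0, addr0, add0r,
          oppr0) ?subrr //.
  move=> v; have [a1 [a2 [a3 ->]]] := spanq v.
  exists (fun k => nth 0 [:: a1 - a3 * x q; a2 - a3 * y q; a3] k).
  rewrite sum_I3 fv1 fv2 fv3 E3E /= !scalerDr !scalerA !scalerBl.
  by rewrite [X in _ = _ + X]addrC addrA (addrACA (_ - _)) !subrK.
- exact: oq.
- by rewrite pqE; apply/seteqP; split=> v /=; rewrite eta'3.
- move=> w wq; rewrite {1 2}(planeE w wq) mq eta'1 eta'2.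
  by move: wq; rewrite pqE /= => ->; rewrite !mulr0 !subr0.
- rewrite !eta'3 fv1 fv2 fv3.
  have B (V W : vfield M) : eta F i3 q (bracket V W q) = - eta F i3 q
      (bracket W V q).
    by rewrite bracket_antisym etaN.
  split=> //.
    rewrite B /E3 !bracketDr !bracketZr !etaD !etaZ bracket_self eta0 e3E1 e3E2
        e3E12.
    by rewrite -/(y q) !mulr0 !add0r addr0 mulrN1 subrr oppr0.
  rewrite /E3 !bracketDr !bracketZr !etaD !etaZ bracket_self eta0 e3E1 e3E2
      (B E2 E1) e3E12.
  by rewrite !mulr0 !addr0 opprK mulr1 /x subrr.
Unshelve. all: by end_near. Qed.

End ReebFrames.

(** * Adapted coframes in a local frame *)

Section AdaptedCoframes.
Variables (R : realType) (M : manifold R 3) (S : subRiemannianSurface M).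
Variables (F : coframing M).

Definition coef (h : coframe M) (i j : 'I_3) : R :=
  covec h i (fvec F j (base h)).

(** Membership in G_0 with the angle eliminated. *)
Definition in_G0 (A : 'I_3 -> 'I_3 -> R) := [/\ A i3 i1 = 0, A i3 i2 = 0,
  A i2 i2 = A i1 i1, A i2 i1 = - A i1 i2 &
  A i1 i1 ^+ 2 + A i1 i2 ^+ 2 = 1 /\ A i3 i3 != 0].

Lemma scalar_sum (V : lmodType R) (l : V -> R) (v : 'I_3 -> V) (a : 'I_3 -> R) :
  scalar l -> l (\sum_k a k *: v k) = \sum_k a k * l (v k).
Proof.
move=> lL; have l0 : l 0 = 0.
  by have := lL 1 0 0; rewrite scale1r addr0 mul1r; lra.
rewrite !sum_I3 -addrA lL lL.
by rewrite -[a i3 *: _]addr0 lL l0 addr0 addrA.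
Qed.

Lemma covec_dual (h : coframe M) : dual F (base h) -> is_coframe h ->
  forall i v, covec h i v = \sum_j coef h i j * eta F j (base h) v.
Proof.
move=> [_ dF] [hL _] i v; rewrite {1}(dF v) scalar_sum//.
by apply: eq_bigr => j _; rewrite mulrC.
Qed.

Lemma frame_plane q : reeb_frame S F q ->
  plane S q (fvec F i1 q) /\ plane S q (fvec F i2 q).
Proof. by move=> [[dE _] _ -> _ _]; split=> /=; rewrite dE. Qed.

(** The upper left block preserves the norm, so it is orthogonal; the orientation makes its
    determinant positive, so it is a rotation. *)
Lemma coef_in_G0 (h : coframe M) : reeb_frame S F (base h) -> adapted S h ->
  in_G0 (coef h).
Proof.
move=> Fh [hc ho hp hm]; have [[dE dF] oE pE mE _] := Fh.
have [p1 p2] := frame_plane Fh.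
have a31 : coef h i3 i1 = 0 by exact: hp.
have a32 : coef h i3 i2 = 0 by exact: hp.
have det := ho _ _ oE.
have [hL hU] := hc.
have norm (a b : R) : (a * coef h i1 i1 + b * coef h i1 i2) ^+ 2 +
    (a * coef h i2 i1 + b * coef h i2 i2) ^+ 2 = a ^+ 2 + b ^+ 2.
  have pw := plane_comb a b p1 p2.
  have comb i : covec h i (a *: fvec F i1 (base h) + b *: fvec F i2 (base h)) =
     a * coef h i i1 + b * coef h i i2.
    rewrite (hL i) -[b *: _]addr0 (hL i).
    have -> : covec h i 0 = 0 by have := hL i 1 0 0; rewrite scale1r addr0
        mul1r; lra.
    by rewrite addr0.
  rewrite -!comb -hm// mE// !etaD !etaZ !dE /=; ring.
have n1 := norm 1 0; have n2 := norm 0 1; have n3 := norm 1 1.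
move: det n1 n2 n3; rewrite -!/(coef h _ _).
set a := coef h i1 i1; set b := coef h i1 i2; set c := coef h i2 i1; set d :=
    coef h i2 i2.
move=> det n1 n2 n3.
have e1 : a ^+ 2 + c ^+ 2 = 1 by lra.
have e2 : b ^+ 2 + d ^+ 2 = 1 by lra.
have e3 : a * b + c * d = 0 by lra.
have e4 : a * d - b * c = 1.
  have : (a * d - b * c) ^+ 2 = 1.
    transitivity ((a ^+ 2 + c ^+ 2) * (b ^+ 2 + d ^+ 2) - (a * b + c * d) ^+
        2); first by ring.
    by rewrite e1 e2 e3; ring.
  by move: det; set x := a * d - b * c => x0 /eqP; rewrite sqrf_eq1 =>
      /orP[/eqP//|/eqP]; lra.
have e5 : d = a.
  transitivity ((a ^+ 2 + c ^+ 2) * d); first by rewrite e1 mul1r.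
  transitivity (a * (a * d - b * c) + c * (a * b + c * d)); first by ring.
  by rewrite e3 e4; ring.
have e6 : c = - b.
  transitivity (c * (b ^+ 2 + d ^+ 2)); first by rewrite e2 mulr1.
  transitivity (d * (a * b + c * d) - b * (a * d - b * c)); first by ring.
  by rewrite e3 e4; ring.
split=> //; split; first by rewrite -/a -/b -e5 addrC.
(* If A_33 were 0, the third covector would vanish, and the zero functional would have two
   coordinate rows: 0 and the third unit row. *)
apply/eqP => a33.
have z3 v : covec h i3 v = 0.
  by rewrite (covec_dual (conj dE dF) hc) sum_I3 a31 a32 a33 !mul0r !addr0.
have [|c0 [_ cU]] := hU (fun=> 0); first by move=> k u v; rewrite mulr0 addr0.
have E0 : c0 = 0 by apply: cU => v; rewrite big1// => i _; rewrite mxE mul0r.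
have /rowP/(_ i3) : c0 = delta_mx ord0 i3.
  apply: cU => v; rewrite sum_I3 z3 mulr0 !mxE /= !mul0r !addr0 //.
by rewrite E0 !mxE /= => /eqP; rewrite eq_sym oner_eq0.
Qed.

Definition coframe_at (A : 'I_3 -> 'I_3 -> R) (q : M) : coframe M :=
  @Coframe R M q (fun i v => \sum_j A i j * eta F j q v).

Lemma adapted_coframe_at A q : reeb_frame S F q -> in_G0 A ->
  adapted S (coframe_at A q).
Proof.
move=> [[dE dF] oE pE mE _] [a31 a32 a22 a21 [nA a33]].
have covL i : scalar (covec (coframe_at A q) i).
  by move=> k u v; rewrite /= !sum_I3 !etaD !etaZ; ring.
have cov1 v : covec (coframe_at A q) i1 v = A i1 i1 * eta F i1 q v + A i1 i2 *
    eta F i2 q v + A i1 i3 * eta F i3 q v.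
  by rewrite /= sum_I3.
have cov2 v : covec (coframe_at A q) i2 v = - A i1 i2 * eta F i1 q v + A i1 i1
    * eta F i2 q v + A i2 i3 * eta F i3 q v.
  by rewrite /= sum_I3 a21 a22.
have cov3 v : covec (coframe_at A q) i3 v = A i3 i3 * eta F i3 q v.
  by rewrite /= sum_I3 a31 a32 !mul0r !add0r.
have covE i j : covec (coframe_at A q) i (fvec F j q) = A i j.
  by rewrite /= (bigD1 j)//= big1 ?dE ?eqxx ?mulr1 ?addr0// => k kj; rewrite dE
      (negPf kj) mulr0.
split.
- split=> // l lL.
  (* The first two coordinates of l come from the inverse rotation, the third from solving on the
     third frame vector. *)
  pose c1 := A i1 i1 * l (fvec F i1 q) + A i1 i2 * l (fvec F i2 q).
  pose c2 := - A i1 i2 * l (fvec F i1 q) + A i1 i1 * l (fvec F i2 q).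
  pose c3 := (l (fvec F i3 q) - c1 * A i1 i3 - c2 * A i2 i3) / A i3 i3.
  exists (\row_i nth 0 [:: c1; c2; c3] i); split.
    move=> v; rewrite {1}(dF v) scalar_sum// !sum_I3 cov1 cov2 cov3 !mxE /=.
    have -> : c3 * (A i3 i3 * eta F i3 q v) =
        (l (fvec F i3 q) - c1 * A i1 i3 - c2 * A i2 i3) * eta F i3 q v.
      by rewrite /c3 mulrA divfK.
    rewrite /c1 /c2 -[X in X * l (fvec F i1 q)]mul1r
        -[X in X * l (fvec F i2 q)]mul1r -nA; ring.
  move=> c cP; have lE j : l (fvec F j q) = \sum_i c ord0 i * A i j.
    by rewrite cP; apply: eq_bigr => i _; rewrite covE.
  have c1E : c1 = c ord0 i1.
    rewrite /c1 !lE !sum_I3 a31 a32 a21 a22 -[RHS]mulr1 -nA; ring.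
  have c2E : c2 = c ord0 i2.
    rewrite /c2 !lE !sum_I3 a31 a32 a21 a22 -[RHS]mulr1 -nA; ring.
  have c3E : c3 = c ord0 i3.
    rewrite /c3 c1E c2E lE sum_I3; by field.
  by apply/rowP; apply: ind_I3; rewrite mxE.
- move=> v w; rewrite (cov1 v) (cov2 w) (cov1 w) (cov2 v).
  rewrite [orient S _](orient_positive oE) => -[a [b [c [d [D /= -> ->]]]]].
  rewrite !etaD !etaZ !dE /=.
  rewrite [X in 0 < X](_ : _ = (a * d - b * c) *
      (A i1 i1 ^+ 2 + A i1 i2 ^+ 2)); last by ring.
  by rewrite nA mulr1.
- by move=> w; rewrite pE cov3 /= => ->; rewrite mulr0.
- move=> w wp; rewrite mE// cov1 cov2.
  have -> : eta F i3 q w = 0 by move: wp; rewrite pE.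
  by rewrite -[LHS]mulr1 -nA; ring.
Qed.

End AdaptedCoframes.

(** * The tautological forms on the stages B0, B1, B2 *)

Section FormsOverM.
Variables (R : realType) (M : manifold R 3).

(** Cutoff functions pulled back from M suffice, because the formulas on the bundles hold over
    neighbourhoods in the base. *)
Lemma tangent_local_near (X : smoothSpace R) (pi : smoothMap X M) (h : X)
    (v : tangent X h) (P : set (mtop M)) f g :
  (\forall q \near (pi h : mtop M), P q) -> Cinf X f -> Cinf X g ->
  (forall x, P (pi x) -> f x = g x) -> v f = v g.
Proof.
move=> nP fX gX fg; have [C _] := cutoff_exists nP.
apply: (tangent_local v (smooth_mapP pi (cut_fun_Cinf C)) fX gX).
  by rewrite /= cut_fun1 oner_eq0.
by move=> x /= /cut_fun_supp/fg.
Qed.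

Lemma dform_sum (X : smoothSpace R) (a x : 'I_3 -> X -> R) (V W : vfield X) h :
  (forall l, Cinf X (a l)) -> (forall l, Cinf X (x l)) ->
  dform (fun h v => \sum_l a l h * v (x l)) V W h =
  \sum_l (V h (a l) * W h (x l) - W h (a l) * V h (x l)).
Proof.
move=> aX xX; have sX (Z : vfield X) l := vf_smooth Z (xX l).
rewrite /dform !tangent_sum; try by move=> l; exact: CinfM.
rewrite -!sumrB; apply: eq_bigr => l _.
rewrite !tangentM// bracketE; ring.
Qed.

Variable F : coframing M.

(** The value of d eta^k on (E_i, E_j) wherever the frame is dual on a neighbourhood. *)
Definition struct_const (k i j : 'I_3) (q : M) : R :=
  - eta F k q (bracket (fvec F i) (fvec F j) q).

Definition dual_near (p : M) := \forall q \near (p : mtop M), dual F q.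

Lemma dform_etaE (V W : vfield M) k p :
  dform (fun q v => eta F k q v) V W p =
  \sum_l (V p (fcoef F k l) * W p (fpot F l) - W p (fcoef F k l) * V p
      (fpot F l)).
Proof.
by apply: dform_sum => l; [exact: fcoef_Cinf|exact: fpot_Cinf].
Qed.

Lemma struct_constE k i j p : dual_near p ->
  \sum_l (fvec F i p (fcoef F k l) * fvec F j p (fpot F l) -
     fvec F j p (fcoef F k l) * fvec F i p (fpot F l)) = struct_const k i j p.
Proof.
move=> Fp; rewrite -dform_etaE /dform.
have E a b : fvec F a p (fun q => eta F k q (fvec F b q)) = 0.
  rewrite -(tangent_cst (fvec F a p) (k == b)%:R).
  apply: (@tangent_local_near _ (smap_id M) p _ _ _ _ Fp).
  - by have [_] := eta_smooth F k; exact.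
  - exact: Cinf_cst.
  - by move=> q [/= + _]; exact.
by rewrite !E subrr sub0r.
Qed.

Lemma struct_const_antisym k i j p : struct_const k j i p = - struct_const k i
    j p.
Proof. by rewrite /struct_const bracket_antisym etaN. Qed.

Lemma struct_const_diag k i p : struct_const k i i p = 0.
Proof. by rewrite /struct_const bracket_self eta0 oppr0. Qed.

(** The pullback of eta^k, by [pull_etaE], in the shape to which [dform_sum] applies. *)
Definition pull_eta (X : smoothSpace R) (pi : smoothMap X M) k : form1 X :=
  fun h v => \sum_l (fcoef F k l \o pi) h * v (fpot F l \o pi).

Arguments pull_eta : clear implicits.

Lemma pull_etaE X (pi : smoothMap X M) k h v : pull_eta X pi k h v = eta F k
    (pi h) (dmap pi v).
Proof.
apply: eq_bigr => l _; rewrite dmapE//; exact: fpot_Cinf.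
Qed.

Lemma pull_eta_smooth X (pi : smoothMap X M) k (V : vfield X) :
  Cinf X (fun h => pull_eta X pi k h (V h)).
Proof.
apply: Cinf_sum => l; apply: CinfM.
  by apply: smooth_mapP; exact: fcoef_Cinf.
by apply: vf_smooth; apply: smooth_mapP; exact: fpot_Cinf.
Qed.

(** Naturality of d for fields that need not project to M: a vector at h acts on functions of the
    base point through the expansion of its projection in the frame, and the sums collapse by
    [struct_constE]. *)
Lemma dform_pull_eta X (pi : smoothMap X M) k (V W : vfield X) (h : X) :
    dual_near (pi h) ->
  let v i := pull_eta X pi i h (V h) in let w i := pull_eta X pi i h (W h) in
  dform (pull_eta X pi k) V W h =
  struct_const k i2 i3 (pi h) * (v i2 * w i3 - v i3 * w i2) +
  struct_const k i3 i1 (pi h) * (v i3 * w i1 - v i1 * w i3) +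
  struct_const k i1 i2 (pi h) * (v i1 * w i2 - v i2 * w i1).
Proof.
move=> Fp v w; rewrite dform_sum; last 2 first.
- by move=> l; apply: smooth_mapP; exact: fcoef_Cinf.
- by move=> l; apply: smooth_mapP; exact: fpot_Cinf.
have [_ dF] := nbhs_singleton Fp.
have expand (u : tangent X h) f : Cinf M f ->
    u (f \o pi) = \sum_i pull_eta X pi i h u * fvec F i (pi h) f.
  move=> fM; rewrite -dmapE// {1}(dF (dmap pi u)) tvec_sum.
  by apply: eq_bigr => i _; rewrite pull_etaE.
transitivity (\sum_i \sum_j v i * w j * struct_const k i j (pi h)).
  transitivity (\sum_l \sum_i \sum_j v i * w j *
    (fvec F i (pi h) (fcoef F k l) * fvec F j (pi h) (fpot F l) -
     fvec F j (pi h) (fcoef F k l) * fvec F i (pi h) (fpot F l))).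
    apply: eq_bigr => l _.
    have cM := fcoef_Cinf F k l; have xM := fpot_Cinf F l.
    rewrite !expand// !sum_I3 /v /w; ring.
  rewrite exchange_big; apply: eq_bigr => i _.
  rewrite exchange_big; apply: eq_bigr => j _.
  by rewrite -struct_constE// mulr_sumr.
rewrite !sum_I3 !struct_const_diag (struct_const_antisym k i1 i2)
  (struct_const_antisym k i2 i3) (struct_const_antisym k i3 i1); ring.
Qed.

End FormsOverM.

Section ReebTorsion.
Variables (R : realType) (M : manifold R 3) (S : subRiemannianSurface M).
Variable F : coframing M.

Definition reeb_near (p : M) := \forall q \near (p : mtop M), reeb_frame S F q.

Lemma reeb_dual p : reeb_near p -> dual_near F p.
Proof. by apply: filterS => q []. Qed.

Lemma reeb_struct3 q : reeb_frame S F q -> [/\ struct_const F i3 i1 i2 q = 1,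
  struct_const F i3 i3 i1 q = 0 & struct_const F i3 i2 i3 q = 0].
Proof.
by move=> [_ _ _ _ [e1 e2 e3]]; rewrite /struct_const e1 e2 e3 oppr0 opprK.
Qed.

(* d(d eta^3) = 0 makes the torsion matrix symmetric. *)
Lemma reeb_torsion_sym p : reeb_near p ->
  struct_const F i1 i3 i1 p = struct_const F i2 i2 i3 p.
Proof.
move=> Fp; have dp := reeb_dual Fp.
have Fp1 := nbhs_singleton Fp; have [[dE _] _ _ _ _] := Fp1.
have [s1 s2 s3] := reeb_struct3 Fp1.
have dnear : \forall q \near (p : mtop M), dual_near F q by exact:
    nbhs_interior.
(* The coefficients of d eta^3 are constant near p, so the left side of [dform_closed] vanishes; on
   the right only the component of [E2, E3] along E2 and that of [E3, E1] along E1 survive. *)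
have d0 i j (V : vfield M) c : (forall q, reeb_frame S F q -> struct_const F i3
    i j q = c) ->
    V p (fun q => dform (eta F i3) (fvec F i) (fvec F j) q) = 0.
  move=> sE; rewrite -(tangent_cst (V p) c).
  apply: (@tangent_local_near _ _ _ (smap_id M) p _ _ _ _ (filterI Fp dnear)).
  - rewrite (_ : (fun q => _) = fun q => \sum_l
      (fvec F i q (fcoef F i3 l) * fvec F j q (fpot F l) - fvec F j q
      (fcoef F i3 l) * fvec F i q (fpot F l))).
      apply: Cinf_sum => l; apply: CinfB; apply: CinfM; apply: vf_smooth; by
          [exact: fcoef_Cinf|exact: fpot_Cinf].
    by apply/funext => q; exact: dform_etaE.
  - exact: Cinf_cst.
  - move=> q [/= Fq dq]; rewrite -(sE q Fq) -struct_constE//; exact: dform_etaE.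
have dE3 (V W : vfield M) : dform (eta F i3) V W p =
    eta F i1 p (V p) * eta F i2 p (W p) - eta F i2 p (V p) * eta F i1 p (W p).
  have := @dform_pull_eta _ _ F _ (smap_id M) i3 V W p dp.
  by rewrite /= s1 s2 s3 !mul0r !add0r mul1r.
have := dform_closed (fvec F i1) (fvec F i2) (fvec F i3) p (eta_smooth F i3).
rewrite (d0 _ _ _ 0) => [|q /reeb_struct3[]//].
rewrite (d0 _ _ _ 0) => [|q /reeb_struct3[]//].
rewrite (d0 _ _ _ 1) => [|q /reeb_struct3[]//].
rewrite !dE3 !dE /= /struct_const; lra.
Qed.

End ReebTorsion.

Section Stage.
Variables (R : realType) (M : manifold R 3) (S : subRiemannianSurface M).
Hypothesis hS : contact S.
Variables (X0 : Type) (G : set (X0 -> R)).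
Let X := generated_space G.
Variable iota : smoothMap X (B0 S).
Hypothesis base_fun : forall f : M -> R, Cinf M f -> G (f \o piB0 S \o iota).

(** The three bundles are treated at once as spaces X over [B0]. By [base_fun] the functions of the
    base point are generators, so that [generated_local] can use cutoffs from M. *)
Definition stage_pi : smoothMap X M := smap_comp (piB0 S) iota.
Definition stage_theta (i : 'I_3) : form1 X := pullback iota (@theta0 R M S i).

Section Frame.
Variable F : coframing M.

Definition stage_coef (i j : 'I_3) (h : X) : R := coef F (sval (iota h)) i j.
Let e j := pull_eta F stage_pi j.

Lemma stage_coef_Cinf i j : Cinf X (stage_coef i j).
Proof.
apply: (smooth_mapP iota (f := fun h : B0 S => coef F (sval h) i j)).
by apply: generated_incl; right; exists i, (fvec F j).
Qed.

Lemma stage_thetaE (h : X) (v : tangent X h) i : reeb_frame S F (stage_pi h) ->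
  stage_theta i v = \sum_j stage_coef i j h * e j v.
Proof.
move=> [dF _ _ _ _]; have [hc _ _ _] := svalP (iota h).
rewrite /stage_theta /pullback /theta0 (covec_dual dF hc).
by apply: eq_bigr => j _; rewrite /e pull_etaE dmap_comp.
Qed.

Lemma stage_coef_G0 (h : X) : reeb_frame S F (stage_pi h) ->
  in_G0 (fun i j => stage_coef i j h).
Proof. by move=> Fh; exact: (coef_in_G0 (h := sval (iota h)) Fh
    (svalP (iota h))). Qed.

(** The relations of [in_G0] hold over a neighbourhood of the base point, so they may be
    differentiated along v. *)
Lemma stage_coef_derive (h : X) (v : tangent X h) : reeb_near S F (stage_pi h)
    ->
  [/\ v (stage_coef i3 i1) = 0, v (stage_coef i3 i2) = 0,
      v (stage_coef i2 i2) = v (stage_coef i1 i1),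
      v (stage_coef i2 i1) = - v (stage_coef i1 i2) &
      stage_coef i1 i1 h * v (stage_coef i1 i1) +
      stage_coef i1 i2 h * v (stage_coef i1 i2) = 0].
Proof.
move=> Fh; have cX := stage_coef_Cinf.
have local f g : Cinf X f -> Cinf X g ->
    (forall x, reeb_frame S F (stage_pi x) -> f x = g x) -> v f = v g.
  by move=> fX gX fg; exact: (tangent_local_near v Fh fX gX).
split.
- rewrite -(tangent_cst v 0); apply: local => //; first exact: Cinf_cst.
  by move=> x /stage_coef_G0[].
- rewrite -(tangent_cst v 0); apply: local => //; first exact: Cinf_cst.
  by move=> x /stage_coef_G0[].
- by apply: local => // x /stage_coef_G0[].
- rewrite -tangentN//; apply: local => //; first exact: CinfN.
  by move=> x /stage_coef_G0[].
- have E : v (fun x => stage_coef i1 i1 x * stage_coef i1 i1 x + stage_coef i1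
    i2 x * stage_coef i1 i2 x) = 0.
    rewrite -(tangent_cst v 1); apply: local => //.
    - by apply: CinfD; apply: CinfM.
    - exact: Cinf_cst.
    - by move=> x /stage_coef_G0[_ _ _ _ [<- _]]; rewrite !expr2.
  move: E; rewrite tangentD; [|exact: CinfM|exact: CinfM].
  by rewrite !tangentM//; lra.
Qed.

End Frame.

(** Over the domain of each frame theta^i is a smooth combination of pulled-back forms; cutoffs glue
    these expressions. *)
Lemma stage_theta_smooth i (V : vfield X) : Cinf X
    (fun h => stage_theta i (V h)).
Proof.
apply: generated_local => h.
have [F Fh] := reeb_frame_exists hS (stage_pi h).
have [C _] := cutoff_exists Fh.
exists (cut_fun C \o stage_pi),
    (fun h => \sum_j stage_coef F i j h * pull_eta F stage_pi j (V h)); split.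
- exact: base_fun (cut_fun_Cinf C).
- apply: (@Cinf_sum R X) => j; apply: (@CinfM R X); first exact:
    stage_coef_Cinf.
  exact: pull_eta_smooth.
- by rewrite /= cut_fun1 oner_eq0.
- by move=> x /cut_fun_supp; exact: stage_thetaE.
Qed.

Lemma dform_stage_theta F i (V W : vfield X) h : reeb_near S F (stage_pi h) ->
  dform (stage_theta i) V W h =
  \sum_j (V h (stage_coef F i j) * pull_eta F stage_pi j (W h) -
    W h (stage_coef F i j) * pull_eta F stage_pi j (V h)) +
  \sum_j stage_coef F i j h * dform (pull_eta F stage_pi j) V W h.
Proof.
move=> Fh; have cX := stage_coef_Cinf F i; have eX := @pull_eta_smooth _ _ F _
    stage_pi.
have E (A B : vfield X) : A h (fun q => stage_theta i (B q)) =
    \sum_j (stage_coef F i j h * A h (fun q => pull_eta F stage_pi j (B q)) +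
     pull_eta F stage_pi j (B h) * A h (stage_coef F i j)).
  rewrite (tangent_local_near (A h) Fh (stage_theta_smooth i B)
      (g := fun q => \sum_j stage_coef F i j q * pull_eta F stage_pi j (B q))).
  - rewrite tangent_sum; last by move=> j; apply: CinfM; [exact: cX|exact: eX].
    by apply: eq_bigr => j _; rewrite tangentM.
  - by apply: Cinf_sum => j; apply: CinfM; [exact: cX|exact: eX].
  - by move=> x; exact: stage_thetaE.
rewrite /dform !E (stage_thetaE _ _ (nbhs_singleton Fh)) -!sumrB -big_split.
apply: eq_bigr => j _; rewrite /=; ring.
Qed.

End Stage.

(** * Vector fields on the bundles *)

Lemma sig_inj (T : Type) (P : T -> Prop) (x y : {x : T | P x}) :
  sval x = sval y -> x = y.
Proof.
case: x y => [x Px] [y Py] /= xy; move: Px; rewrite xy => Px.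
by congr exist; exact: Prop_irrelevance.
Qed.

Section SubCurves.
Variables (R : realType) (X : smoothSpace R) (P : X -> Prop) (c : X -> R -> X).
Hypothesis cP : forall (h : {x : X | P x}) t, P (c (sval h) t).

Definition sub_curve (h : subSpace P) (t : R) : subSpace P :=
  exist P (c (sval h) t) (cP h t).

Lemma sub_curve_field : curve_field c -> curve_field sub_curve.
Proof.
move=> [c0 cF]; apply: generated_curve_field => [h|_ [g gX <-]].
  by apply: sig_inj; exact: c0.
have [gd gD] := cF g gX.
split=> [h|]; first exact: gd.
by apply: generated_incl; exists (fun p => 'D_1 (g \o c p) 0).
Qed.

End SubCurves.

Section Lift.
Variables (R : realType) (M : manifold R 3) (S : subRiemannianSurface M).
Variables (F : coframing M) (p0 : mtop M).
Variables (C : cutoff p0 [set q | reeb_near S F q]) (u : 'rV[R]_3).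

Lemma coframe_at_coef (h : coframe M) : dual F (base h) -> is_coframe h ->
  coframe_at F (coef F h) (base h) = h.
Proof.
move=> dF hc; have := covec_dual dF hc.
case: h {hc dF} => q cv /= cvE; congr Coframe.
by apply/funext => i; apply/funext => v; rewrite cvE.
Qed.

(** The test supplies the proof that the transported coframe is adapted. A starting point over a bad
    base point keeps its base point, so the constant curve there fits with the rest. *)
Definition lift_curve (h : B0 S) (t : R) : B0 S :=
  let y := cut_curve C u (base (sval h)) t in
  match pselect (reeb_near S F (base (sval h)) /\ reeb_near S F y) with
  | left H => exist _ (coframe_at F (coef F (sval h)) y)
      (adapted_coframe_at (nbhs_singleton H.2)
        (coef_in_G0 (nbhs_singleton H.1) (svalP h)))
  | right _ => h
  end.

Lemma lift_curve_same (h : B0 S) t :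
  cut_curve C u (base (sval h)) t = base (sval h) -> lift_curve h t = h.
Proof.
rewrite /lift_curve => E; case: pselect => // H; apply: sig_inj => /=.
rewrite E; apply: coframe_at_coef; last by have [] := svalP h.
by have [] := nbhs_singleton H.1.
Qed.

Lemma lift_curve0 h : lift_curve h 0 = h.
Proof. by apply: lift_curve_same; rewrite cut_curve0. Qed.

(* Along the curve the base point moves on a straight line of the chart, while
   the coefficients of the coframe in the frame F are constant. *)
Lemma lift_curve_near (h : B0 S) :
  (\forall t \near (0 : R), base (sval (lift_curve h t)) = cut_curve C u
      (base (sval h)) t) /\
  forall i (V : vfield M), \forall t \near (0 : R),
    covec (sval (lift_curve h t)) i (V (base (sval (lift_curve h t)))) =
    if `[< reeb_near S F (base (sval h)) >] then
    \sum_j coef F (sval h) i j * eta F j (cut_curve C u (base (sval h)) t)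
        (V (cut_curve C u (base (sval h)) t))
    else covec (sval h) i (V (base (sval h))).
Proof.
set q := base (sval h).
have [Fq|nFq] := pselect (reeb_near S F q); last first.
  have cE t : cut_curve C u q t = q by apply: cut_curve_out.
  have lE t : lift_curve h t = h by apply: lift_curve_same.
  by split=> [|i V]; near=> t; rewrite lE ?cE// asboolF.
(* The curve is known through smooth functions of its points, so a cutoff function along it shows
   that it stays in the good set. *)
have near_good : \forall t \near (0 : R), reeb_near S F (cut_curve C u q t).
  have nFq : \forall y \near (q : mtop M), reeb_near S F y by exact:
      nbhs_interior.
  have [D _] := cutoff_exists nFq.
  have Dc : {for (0 : R), continuous (cut_fun D \o cut_curve C u q)}.
    apply/differentiable_continuous/derivable1_diffP.
    by have [] := cut_curve_derive C u q (cut_fun_Cinf D).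
  have D0 : 0 < (cut_fun D \o cut_curve C u q) 0 by rewrite /= cut_curve0
      cut_fun1.
  move/cvgr_gt: Dc => /(_ 0 D0); apply: filterS => t; rewrite /= => Dt.
  by apply: (cut_fun_supp (C := D)); rewrite gt_eqF.
split=> [|i V]; near=> t.
  rewrite /lift_curve; case: pselect => //= -[]; split=> //.
  by near: t.
rewrite asboolT// /lift_curve; case: pselect => //= -[]; split=> //.
by near: t.
Unshelve. all: by end_near. Qed.

(** On generators: functions of the base point reduce to [cut_curve_field], and the component on V
    is a combination, with coefficients constant in t, of the functions eta^j(V) along the base
    curve. *)
Lemma lift_curve_field : @curve_field R (B0 S) lift_curve.
Proof.
apply: generated_curve_field => [h|g]; first exact: lift_curve0.
move=> [[f fM <-]|[i [V ->]]].
  have D (h : B0 S) : is_derive (0 : R) (1 : R)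
      ((f \o @base R M \o sval) \o lift_curve h)
     ('D_1 (f \o cut_curve C u (base (sval h))) 0).
    have H : is_derive (0 : R) (1 : R) (f \o cut_curve C u (base (sval h)))
        ('D_1 (f \o cut_curve C u (base (sval h))) 0).
      apply: derivableP; have [] := cut_curve_derive C u (base (sval h)) fM;
          done.
    apply: near_eq_is_derive H.
    by apply: filterS (lift_curve_near h).1 => t /= ->.
  split=> [h|]; first by have [] := D h.
  rewrite (_ : (fun p => _) = (fun q => 'D_1 (f \o cut_curve C u q) 0) \o @base
      R M \o sval).
    apply: generated_incl; left.
    by exists (fun q => 'D_1 (f \o cut_curve C u q) 0) => //; have
        [_ /(_ f fM)[]] := cut_curve_field C u.
  by apply/funext => h; have [_ ->] := D h.
pose ev j q := eta F j q (V q).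
have evM j : Cinf M (ev j) by have [_] := eta_smooth F j; exact.
pose dev j q := 'D_1 (ev j \o cut_curve C u q) 0.
have D (h : B0 S) : is_derive (0 : R) (1 : R)
    ((fun h : {h : coframe M | adapted S h} => covec (sval h) i
        (V (base (sval h)))) \o lift_curve h)
    (\sum_j coef F (sval h) i j * dev j (base (sval h))).
  set q := base (sval h).
  have H j : is_derive (0 : R) (1 : R) (ev j \o cut_curve C u q) (dev j q).
    by apply: derivableP; have [] := cut_curve_derive C u q (evM j).
  have [Fq|nFq] := pselect (reeb_near S F q).
    have E := (lift_curve_near h).2 i V.
    have K : is_derive (0 : R) (1 : R)
        (fun t => \sum_j coef F (sval h) i j * (ev j \o cut_curve C u q) t)
        (\sum_j coef F (sval h) i j * dev j q).
      rewrite (_ : (fun t => _) = \sum_j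
          (coef F (sval h) i j \*: (ev j \o cut_curve C u q))).
        by apply: is_derive_sum => j; exact: is_deriveZ.
      by apply/funext => t; rewrite fct_sumE.
    apply: near_eq_is_derive K.
    by apply: filterS E => t Et; rewrite [RHS]Et asboolT.
  have cE : cut_curve C u q = fun=> q by apply/funext => t; apply:
      cut_curve_out.
  have lE : lift_curve h = fun=> h by apply/funext => t; apply:
      lift_curve_same; rewrite -/q cE.
  rewrite lE big1 => [|j _]; first exact: is_derive_cst.
  rewrite /dev cE (_ : ev j \o (fun=> q) = cst (ev j q))//.
  by rewrite derive_cst mulr0.
split=> [h|]; first by have [] := D h.
rewrite (_ : (fun p => _) = fun h : B0 S => \sum_j coef F (sval h) i j * dev j
    (base (sval h))).
  apply: (@Cinf_sum R (B0 S)) => j; apply: (@CinfM R (B0 S)); apply: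
      generated_incl.
    by right; exists i, (fvec F j).
  by left; exists (dev j) => //; have [_ /(_ _ (evM j))[]] := cut_curve_field C
      u.
by apply/funext => h; have [_ ->] := D h.
Qed.

(** This keeps the lifts inside [B1] and [B2], whose equations over a frame involve only the
    coefficients. *)
Lemma lift_curve_coef (h : B0 S) t : lift_curve h t = h \/
  [/\ reeb_near S F (base (sval h)), reeb_near S F
      (base (sval (lift_curve h t))) &
   forall i j, coef F (sval (lift_curve h t)) i j = coef F (sval h) i j].
Proof.
rewrite /lift_curve; case: pselect => [H|]; [right|by left].
split; [exact: H.1|exact: H.2|move=> i j].
have [[dE _] _ _ _ _] := nbhs_singleton H.2.
rewrite [LHS]/coef /= (bigD1 j)//= big1 => [|k kj].
  by rewrite dE eqxx mulr1 addr0.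
by rewrite dE (negPf kj) mulr0.
Qed.

Lemma lift_curve_velocity (h : B0 S) f : Cinf M f ->
  'D_1 ((f \o @base R M \o sval) \o lift_curve h) 0 =
  cut_vfield C u (base (sval h)) f.
Proof.
move=> fM; rewrite curve_vfieldE//; apply: near_eq_derive.
by apply: filterS (lift_curve_near h).1 => t /= ->.
Qed.

End Lift.

Section StageForms.
Variables (R : realType) (M : manifold R 3) (S : subRiemannianSurface M).
Hypothesis hS : contact S.
Variables (X0 : Type) (G : set (X0 -> R)).
Let X := generated_space G.
Variable iota : smoothMap X (B0 S).
Hypothesis base_fun : forall f : M -> R, Cinf M f -> G (f \o piB0 S \o iota).
Variables (F : coframing M) (h : X).
Hypothesis Fh : reeb_near S F (stage_pi iota h).
Let e j (V : vfield X) := pull_eta F (stage_pi iota) j (V h).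
Let A i j := stage_coef iota F i j.
Let K k V W := struct_const F k i2 i3 (stage_pi iota h) *
    (e i2 V * e i3 W - e i3 V * e i2 W) +
  struct_const F k i3 i1 (stage_pi iota h) *
      (e i3 V * e i1 W - e i1 V * e i3 W) +
  struct_const F k i1 i2 (stage_pi iota h) *
      (e i1 V * e i2 W - e i2 V * e i1 W).

Lemma stage_theta1E (V : vfield X) : stage_theta iota i1 (V h) =
  A i1 i1 h * e i1 V + A i1 i2 h * e i2 V + A i1 i3 h * e i3 V.
Proof. by rewrite (stage_thetaE _ _ (nbhs_singleton Fh)) sum_I3. Qed.

Lemma stage_theta2E (V : vfield X) : stage_theta iota i2 (V h) =
  - A i1 i2 h * e i1 V + A i1 i1 h * e i2 V + A i2 i3 h * e i3 V.
Proof.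
rewrite (stage_thetaE _ _ (nbhs_singleton Fh)) sum_I3.
by have [_ _ -> -> _] := stage_coef_G0 (nbhs_singleton Fh).
Qed.

Lemma stage_theta3E (V : vfield X) : stage_theta iota i3 (V h) =
  A i3 i3 h * e i3 V.
Proof.
rewrite (stage_thetaE _ _ (nbhs_singleton Fh)) sum_I3.
by have [-> -> _ _ _] := stage_coef_G0 (nbhs_singleton Fh); rewrite !mul0r
    !add0r.
Qed.

Lemma dform_stage_theta1 (V W : vfield X) : dform (stage_theta iota i1) V W h =
  V h (A i1 i1) * e i1 W - W h (A i1 i1) * e i1 V +
  (V h (A i1 i2) * e i2 W - W h (A i1 i2) * e i2 V) +
  (V h (A i1 i3) * e i3 W - W h (A i1 i3) * e i3 V) +
  (A i1 i1 h * K i1 V W + A i1 i2 h * K i2 V W +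
   A i1 i3 h * (e i1 V * e i2 W - e i2 V * e i1 W)).
Proof.
rewrite (dform_stage_theta hS base_fun _ _ _ Fh) !sum_I3 !dform_pull_eta; try
    exact: reeb_dual Fh.
have [s1 s2 s3] := reeb_struct3 (nbhs_singleton Fh).
by rewrite s1 s2 s3 !mul0r !add0r mul1r.
Qed.

Lemma dform_stage_theta2 (V W : vfield X) : dform (stage_theta iota i2) V W h =
  - V h (A i1 i2) * e i1 W + W h (A i1 i2) * e i1 V +
  (V h (A i1 i1) * e i2 W - W h (A i1 i1) * e i2 V) +
  (V h (A i2 i3) * e i3 W - W h (A i2 i3) * e i3 V) +
  (- A i1 i2 h * K i1 V W + A i1 i1 h * K i2 V W +
   A i2 i3 h * (e i1 V * e i2 W - e i2 V * e i1 W)).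
Proof.
rewrite (dform_stage_theta hS base_fun _ _ _ Fh) !sum_I3 !dform_pull_eta; try
    exact: reeb_dual Fh.
have [s1 s2 s3] := reeb_struct3 (nbhs_singleton Fh).
have [_ _ v22 v21 _] := stage_coef_derive (V h) Fh.
have [_ _ w22 w21 _] := stage_coef_derive (W h) Fh.
rewrite v22 v21 w22 w21 s1 s2 s3 !mul0r !add0r mul1r.
have [_ _ a22 a21 _] := stage_coef_G0 (nbhs_singleton Fh).
rewrite a22 a21 /A /K /e; ring.
Qed.

Lemma dform_stage_theta3 (V W : vfield X) : dform (stage_theta iota i3) V W h =
  V h (A i3 i3) * e i3 W - W h (A i3 i3) * e i3 V +
   A i3 i3 h * (e i1 V * e i2 W - e i2 V * e i1 W).
Proof.
rewrite (dform_stage_theta hS base_fun _ _ _ Fh) !sum_I3 !dform_pull_eta; try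
    exact: reeb_dual Fh.
have [s1 s2 s3] := reeb_struct3 (nbhs_singleton Fh).
have [v31 v32 _ _ _] := stage_coef_derive (V h) Fh.
have [w31 w32 _ _ _] := stage_coef_derive (W h) Fh.
have [a31 a32 _ _ _] := stage_coef_G0 (nbhs_singleton Fh).
by rewrite v31 v32 w31 w32 a31 a32 s1 s2 s3 !mul0r !subr0 !add0r mul1r.
Qed.

End StageForms.

(** * The equations of B_1 and B_2 in a frame *)

Section Reductions.
Variables (R : realType) (M : manifold R 3) (S : subRiemannianSurface M).
Hypothesis hS : contact S.

(** These fields test the equations behind [T312] and [T3] and thereby determine their coefficients.
    Only the projection at one point is prescribed; the vertical part is left free. *)
Definition has_lifts (X : smoothSpace R) (pi : smoothMap X M) :=
  forall (h : X) (F : coframing M), reeb_near S F (pi h) -> forall j,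
  exists T : vfield X, forall k, pull_eta F pi k (T h) = (k == j)%:R.

Definition iota0 : smoothMap (B0 S) (B0 S) := smap_id (B0 S).

Lemma base_fun_B0 f : Cinf M f -> B0_gen (f \o piB0 S \o iota0).
Proof. by move=> fM; left; exists f. Qed.

Lemma theta0_stage i : @theta0 R M S i = stage_theta iota0 i.
Proof.
apply: functional_extensionality_dep => h; apply/funext => v.
by rewrite /stage_theta /pullback dmap_id.
Qed.

(** The direction consists of the coordinates of E_j at the base point, so by [cut_coord_basis] the
    coordinate field equals E_j there. *)
Lemma lift_from_curve (X : smoothSpace R) (pi : smoothMap X M) (h : X)
    (F : coframing M) (C : cutoff (pi h : mtop M) [set q | reeb_near S F q]) j
        (T : vfield X) :
  reeb_near S F (pi h) ->
  (forall f, Cinf M f -> T h (f \o pi) =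
    cut_vfield C (\row_l fvec F j (pi h) (cut_coord C l)) (pi h) f) ->
  forall k, pull_eta F pi k (T h) = (k == j)%:R.
Proof.
move=> Fh TE k; have [[dE dF] _ _ _ _] := nbhs_singleton Fh.
rewrite pull_etaE -dE; congr (eta F k _ _).
apply: tangent_ext => f fM; rewrite dmapE// TE//.
have [_ /(_ (fvec F j (pi h))) {2}->//] := @cut_coord_basis _ _ _ _ _ C
    (fun k => fvec F k (pi h)) (fun v => ex_intro _ _ (dF v)).
Qed.

Lemma has_lifts0 : has_lifts (stage_pi iota0).
Proof.
move=> h F Fh j.
have nF : \forall q \near (stage_pi iota0 h : mtop M), reeb_near S F q by
    exact: nbhs_interior.
have [C _] := cutoff_exists nF.
exists (curve_vfield (lift_curve_field C
    (\row_l fvec F j (stage_pi iota0 h) (cut_coord C l)))).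
apply: (lift_from_curve (C := C)) => // f fM.
rewrite curve_vfieldE; last exact: (smooth_mapP (stage_pi iota0) fM).
exact: (lift_curve_velocity C _ h fM).
Qed.

(** Wedging with theta^3 = A_33 eta^3 kills the term with dA_33 and leaves A_33^2 eta^1 /\ eta^2 /\
    eta^3, while theta^1 /\ theta^2 /\ theta^3 is A_33 eta^1 /\ eta^2 /\ eta^3. *)
Lemma T312E (h : B0 S) (F : coframing M) : reeb_near S F (base (sval h)) ->
  T312 h = coef F (sval h) i3 i3.
Proof.
move=> Fh; have Fh' : reeb_near S F (stage_pi iota0 h) by [].
have t1E := stage_theta1E Fh'; have t2E := stage_theta2E Fh'.
have t3E := stage_theta3E Fh'; have d3E := dform_stage_theta3 hS base_fun_B0
    Fh'.
have [_ _ _ _ [/= nA a33]] := stage_coef_G0 (nbhs_singleton Fh').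
apply: xget_unique => [V W Z|t tP].
  rewrite /mkset !theta0_stage /wedge21 /wedge !t1E !t2E !t3E !d3E.
  rewrite -/(stage_coef iota0 F i3 i3 h) -[LHS]mulr1 -[X in _ * X = _]nA; ring.
have [E1 E1P] := has_lifts0 Fh' i1.
have [E2 E2P] := has_lifts0 Fh' i2.
have [E3 E3P] := has_lifts0 Fh' i3.
have := tP E1 E2 E3; rewrite !theta0_stage /wedge21 /wedge !t1E !t2E !t3E !d3E
    !E1P !E2P !E3P /=.
move=> E; apply: (mulfI a33); rewrite -/(stage_coef iota0 F i3 i3 h).
transitivity (t * (stage_coef iota0 F i1 i1 h ^+ 2 + stage_coef iota0 F i1 i2 h
    ^+ 2) * stage_coef iota0 F i3 i3 h).
  by rewrite nA; ring.
by move: E; lra.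
Qed.

Definition iota1 : smoothMap (B1 S) (B0 S) := incl (fun h : B0 S => T312 h = 1).

Lemma base_fun_B1 f : Cinf M f -> subspace_gen (fun h : B0 S => T312 h = 1)
    (f \o piB0 S \o iota1).
Proof. by move=> fM; exists (f \o piB0 S) => //; exact:
    (smooth_mapP (piB0 S) fM). Qed.

Lemma coef33_B1 (h : B1 S) F : reeb_near S F (stage_pi iota1 h) ->
  stage_coef iota1 F i3 i3 h = 1.
Proof. by move=> Fh; apply: etrans (svalP h); exact/esym/T312E. Qed.

(** Vectors of [B1] differentiate functions on [B1], where A_33 is 1 over a neighbourhood of the
    base point. *)
Lemma coef33_B1_derive (h : B1 S) F (v : tangent (B1 S) h) :
  reeb_near S F (stage_pi iota1 h) -> v (stage_coef iota1 F i3 i3) = 0.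
Proof.
move=> Fh; rewrite -[RHS](tangent_cst v 1).
apply: (@tangent_local_near _ _ _ (stage_pi iota1) h v
    [set q | reeb_near S F q]).
- exact: nbhs_interior.
- exact: stage_coef_Cinf.
- exact: Cinf_cst.
- by move=> x; exact: coef33_B1.
Qed.

Lemma T312_lift F (p0 : mtop M) (C : cutoff p0 [set q | reeb_near S F q]) u
    (h : {h : B0 S | T312 h = 1}) t : T312 (lift_curve C u (sval h) t) = 1.
Proof.
have [->|[Fh Fl cE]] := lift_curve_coef C u (sval h) t; first exact: (svalP h).
by rewrite (T312E Fl) cE -(T312E Fh) (svalP h).
Qed.

Lemma has_lifts1 : has_lifts (stage_pi iota1).
Proof.
move=> h F Fh j.
have nF : \forall q \near (stage_pi iota1 h : mtop M), reeb_near S F q by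
    exact: nbhs_interior.
have [C _] := cutoff_exists nF.
pose u := \row_l fvec F j (stage_pi iota1 h) (cut_coord C l).
have cF := sub_curve_field (T312_lift C u) (lift_curve_field C u).
exists (curve_vfield cF); apply: (lift_from_curve (C := C)) => // f fM.
rewrite curve_vfieldE; last exact: (smooth_mapP (stage_pi iota1) fM).
exact: (lift_curve_velocity C _ (sval h) fM).
Qed.

Lemma T3E (h : B1 S) F : reeb_near S F (stage_pi iota1 h) ->
  T3 h = (stage_coef iota1 F i1 i3 h, stage_coef iota1 F i2 i3 h).
Proof.
move=> Fh.
have t1E := stage_theta1E Fh; have t2E := stage_theta2E Fh.
have t3E := stage_theta3E Fh; have d3E := dform_stage_theta3 hS base_fun_B1 Fh.
have [_ _ _ _ [/= nA _]] := stage_coef_G0 (nbhs_singleton Fh).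
have a33 := coef33_B1 Fh; have d33 (V : vfield (B1 S)) := coef33_B1_derive
    (V h) Fh.
have thE i (V : vfield (B1 S)) : @theta1 R M S i h (V h) = stage_theta iota1 i
    (V h) by [].
apply: xget_unique => [V W|[t1 t2] tP].
  rewrite /mkset /wedge !thE [LHS]d3E !t1E !t2E !t3E !d33 a33 /=.
  rewrite !mul0r subrr add0r mul1r -[LHS]mulr1 -[X in _ * X = _]nA; ring.
have [E1 E1P] := has_lifts1 Fh i1.
have [E2 E2P] := has_lifts1 Fh i2.
have [E3 E3P] := has_lifts1 Fh i3.
have dE V W : dform (@theta1 R M S i3) V W h = dform (stage_theta iota1 i3) V W
    h by [].
have := tP E2 E3; have := tP E1 E3.
rewrite /wedge !thE !dE !d3E !t1E !t2E !t3E !d33 a33 !E1P !E2P !E3P /=.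
rewrite -/(stage_coef iota1 F i1 i3 h).
set c := stage_coef iota1 F i1 i1 h in nA *; set s := stage_coef iota1 F i1 i2
    h in nA *.
set x := stage_coef iota1 F i1 i3 h; set y := stage_coef iota1 F i2 i3 h.
move=> H1 H2.
(* The differences t1 - x and t2 - y solve a homogeneous system whose matrix is orthogonal. *)
have e1 : s * (t1 - x) + c * (t2 - y) = 0 by lra.
have e2 : c * (t1 - x) - s * (t2 - y) = 0 by lra.
congr (_, _); apply/eqP; rewrite -subr_eq0; apply/eqP.
  transitivity ((c ^+ 2 + s ^+ 2) * (t1 - x)); first by rewrite nA mul1r.
  transitivity (c * (c * (t1 - x) - s * (t2 - y)) + s *
      (s * (t1 - x) + c * (t2 - y))); first by ring.
  by rewrite e1 e2 !mulr0 addr0.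
transitivity ((c ^+ 2 + s ^+ 2) * (t2 - y)); first by rewrite nA mul1r.
transitivity (c * (s * (t1 - x) + c * (t2 - y)) - s *
    (c * (t1 - x) - s * (t2 - y))); first by ring.
by rewrite e1 e2 !mulr0 subr0.
Qed.

Definition iota2 : smoothMap (B2 S) (B0 S) := smap_comp iota1 (incl21 S).

Lemma base_fun_B2 f : Cinf M f ->
  subspace_gen (fun h : B1 S => T323 h = 0 /\ T331 h = 0)
      (f \o piB0 S \o iota2).
Proof.
move=> fM; exists (f \o stage_pi iota1) => //; exact:
    (smooth_mapP (stage_pi iota1) fM).
Qed.

Lemma theta_stage i : @theta R M S i = stage_theta iota2 i.
Proof.
apply: functional_extensionality_dep => h; apply/funext => v.
by rewrite /stage_theta /theta /theta1 /pullback dmap_comp.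
Qed.

Lemma coef_B2 (h : B2 S) F : reeb_near S F (stage_pi iota2 h) ->
  [/\ stage_coef iota2 F i3 i3 h = 1, stage_coef iota2 F i1 i3 h = 0 &
      stage_coef iota2 F i2 i3 h = 0].
Proof.
move=> Fh; have [] := svalP h; rewrite /T323 /T331 (@T3E _ F)// => H1 H2.
by split=> //; exact: (@coef33_B1 (sval h) F).
Qed.

Lemma coef_B2_derive (h : B2 S) F (v : tangent (B2 S) h) :
  reeb_near S F (stage_pi iota2 h) ->
  [/\ v (stage_coef iota2 F i3 i3) = 0, v (stage_coef iota2 F i1 i3) = 0 &
      v (stage_coef iota2 F i2 i3) = 0].
Proof.
move=> Fh.
have loc i j (c : R) : (forall x, reeb_near S F (stage_pi iota2 x) ->
    stage_coef iota2 F i j x = c) ->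
    v (stage_coef iota2 F i j) = 0.
  move=> cE; rewrite -[RHS](tangent_cst v c).
  apply: (@tangent_local_near _ _ _ (stage_pi iota2) h v
      [set q | reeb_near S F q]) => //.
  - exact: nbhs_interior.
  - exact: stage_coef_Cinf.
  - exact: Cinf_cst.
by split; [apply: (loc _ _ 1)|apply: (loc _ _ 0)|apply: (loc _ _ 0)] => x
    /coef_B2[].
Qed.

Lemma T3_lift F (p0 : mtop M) (C : cutoff p0 [set q | reeb_near S F q]) u
    (h : {h : B1 S | T323 h = 0 /\ T331 h = 0}) t :
  T323 (sub_curve (T312_lift C u) (sval h) t) = 0 /\
  T331 (sub_curve (T312_lift C u) (sval h) t) = 0.
Proof.
have [E|[Fh Fl cE]] := lift_curve_coef C u (sval (sval h)) t.
  have -> : sub_curve (T312_lift C u) (sval h) t = sval h by exact: sig_inj.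
  exact: (svalP h).
have [] := svalP h; rewrite /T323 /T331
    (@T3E (sub_curve (T312_lift C u) (sval h) t) F Fl) (@T3E (sval h) F Fh) /=
    => H1 H2.
by split; rewrite /stage_coef /= cE.
Qed.

Lemma has_lifts2 : has_lifts (stage_pi iota2).
Proof.
move=> h F Fh j.
have nF : \forall q \near (stage_pi iota2 h : mtop M), reeb_near S F q by
    exact: nbhs_interior.
have [C _] := cutoff_exists nF.
pose u := \row_l fvec F j (stage_pi iota2 h) (cut_coord C l).
have cF1 := sub_curve_field (T312_lift C u) (lift_curve_field C u).
have cF := sub_curve_field (T3_lift C u) cF1.
exists (curve_vfield cF); apply: (lift_from_curve (C := C)) => // f fM.
rewrite curve_vfieldE; last exact: (smooth_mapP (stage_pi iota2) fM).
exact: (lift_curve_velocity C _ (sval (sval h)) fM).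
Qed.

End Reductions.

(** * Structure equations *)

Section StructureAlgebra.
Variable R : realType.
Variables c s bv bw v1 v2 v3 w1 w2 w3 p1 p2 p3 q2 q3 : R.
Hypothesis cs1 : c ^+ 2 + s ^+ 2 = 1.
Let z := - (p1 + q2) / 2.
Let b1 := (p1 - q2) / 2.
Let av := bv + (p3 * v1 + q3 * v2 + z * v3).
Let aw := bw + (p3 * w1 + q3 * w2 + z * w3).
Let a1 := (c ^+ 2 - s ^+ 2) * b1 + 2 * c * s * p2.
Let a2 := - (2 * c * s) * b1 + (c ^+ 2 - s ^+ 2) * p2.
Let K1 := p1 * (v2 * w3 - v3 * w2) + p2 * (v3 * w1 - v1 * w3) + p3 *
    (v1 * w2 - v2 * w1).
Let K2 := p2 * (v2 * w3 - v3 * w2) + q2 * (v3 * w1 - v1 * w3) + q3 *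
    (v1 * w2 - v2 * w1).
Let V1 := c * v1 + s * v2. Let W1 := c * w1 + s * w2.
Let V2 := - s * v1 + c * v2. Let W2 := - s * w1 + c * w2.

(** Here c, s are the rotation entries, bv and bw the values of c ds - s dc on two fields, v_i and
    w_i those of eta^i, and K1, K2 those of d eta^1, d eta^2 with q1 = p2. Multiplied suitably by
    c^2 + s^2, the part without bv and bw is homogeneous of degree 3 in c and s and holds
    identically; z is the value that leaves a trace-free torsion. *)
Lemma structure_algebra1 :
  - s * bv * w1 - (- s * bw) * v1 + (c * bv * w2 - c * bw * v2) +
      (c * K1 + s * K2) =
  av * W2 - aw * V2 + (a1 * (V2 * w3 - W2 * v3) + a2 * (v3 * W1 - w3 * V1)).
Proof.
have E : (c * K1 + s * K2) * (c ^+ 2 + s ^+ 2) =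
  (p3 * v1 + q3 * v2 + z * v3) * W2 * (c ^+ 2 + s ^+ 2) -
  (p3 * w1 + q3 * w2 + z * w3) * V2 * (c ^+ 2 + s ^+ 2) +
  (a1 * (V2 * w3 - W2 * v3) + a2 * (v3 * W1 - w3 * V1)).
  by rewrite /K1 /K2 /W2 /V2 /W1 /V1 /a1 /a2 /b1 /z; field.
move: E; rewrite cs1 !mulr1 => ->; rewrite /av /aw /V2 /W2; ring.
Qed.

Lemma structure_algebra2 :
  - (c * bv) * w1 + c * bw * v1 + (- s * bv * w2 - (- s * bw) * v2) +
      (- s * K1 + c * K2) =
  - (av * W1) + aw * V1 + (a2 * (V2 * w3 - W2 * v3) - a1 * (v3 * W1 - w3 * V1)).
Proof.
have E : (- s * K1 + c * K2) * (c ^+ 2 + s ^+ 2) =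
  - ((p3 * v1 + q3 * v2 + z * v3) * W1 * (c ^+ 2 + s ^+ 2)) +
  (p3 * w1 + q3 * w2 + z * w3) * V1 * (c ^+ 2 + s ^+ 2) +
  (a2 * (V2 * w3 - W2 * v3) - a1 * (v3 * W1 - w3 * V1)).
  by rewrite /K1 /K2 /W2 /V2 /W1 /V1 /a1 /a2 /b1 /z; field.
move: E; rewrite cs1 !mulr1 => ->; rewrite /av /aw /V1 /W1; ring.
Qed.

End StructureAlgebra.

Section LocalStructure.
Variables (R : realType) (M : manifold R 3) (S : subRiemannianSurface M).
Hypothesis hS : contact S.

(** A pointwise form, in which solutions built from different frames can be compared at one
    coframe. *)
Definition structure_at (h : B2 S) (al : vfield (B2 S) -> R) (a1 a2 : R) :=
  forall V W : vfield (B2 S), [/\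
    dform (@theta R M S i1) V W h =
      al V * theta i2 (W h) - al W * theta i2 (V h) +
      (a1 * wedge (@theta R M S i2) (@theta R M S i3) V W h +
       a2 * wedge (@theta R M S i3) (@theta R M S i1) V W h),
    dform (@theta R M S i2) V W h =
      - (al V * theta i1 (W h)) + al W * theta i1 (V h) +
      (a2 * wedge (@theta R M S i2) (@theta R M S i3) V W h -
       a1 * wedge (@theta R M S i3) (@theta R M S i1) V W h) &
    dform (@theta R M S i3) V W h = wedge (@theta R M S i1) (@theta R M S i2) V
        W h].

Section Frame.
Variable F : coframing M.
Let p1 := struct_const F i1 i2 i3.
Let p2 := struct_const F i1 i3 i1.
Let p3 := struct_const F i1 i1 i2.
Let q2 := struct_const F i2 i3 i1.
Let q3 := struct_const F i2 i1 i2.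

Definition torsion1 (q : M) : R := (p1 q - q2 q) / 2.
Definition torsion2 (q : M) : R := p2 q.

Let C := stage_coef (@iota2 R M S) F i1 i1.
Let D := stage_coef (@iota2 R M S) F i1 i2.
Let pi := stage_pi (@iota2 R M S).

(** The coefficients are the cosine and, up to sign, the sine of twice the angle: conjugation by a
    rotation turns a traceless symmetric matrix twice as fast. *)
Definition local_a1 (h : B2 S) : R :=
  (C h ^+ 2 - D h ^+ 2) * torsion1 (pi h) + 2 * C h * D h * torsion2 (pi h).
Definition local_a2 (h : B2 S) : R :=
  - (2 * C h * D h) * torsion1 (pi h) + (C h ^+ 2 - D h ^+ 2) * torsion2 (pi h).
Definition local_alpha (h : B2 S) (v : tangent (B2 S) h) : R :=
  (C h * v D - D h * v C) +
  (p3 (pi h) * pull_eta F pi i1 v + q3 (pi h) * pull_eta F pi i2 v +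
   - (p1 (pi h) + q2 (pi h)) / 2 * pull_eta F pi i3 v).

(** By (C^2 - D^2)^2 + (2 C D)^2 = (C^2 + D^2)^2 = 1 the torsion pair is only rotated. *)
Lemma local_a_sqr h : reeb_frame S F (pi h) ->
  local_a1 h ^+ 2 + local_a2 h ^+ 2 = torsion1 (pi h) ^+ 2 + torsion2 (pi h) ^+
      2.
Proof.
move=> Fh; have [_ _ _ _ [/= nA _]] := stage_coef_G0 (iota := @iota2 R M S) Fh.
transitivity ((torsion1 (pi h) ^+ 2 + torsion2 (pi h) ^+ 2) *
    (C h ^+ 2 + D h ^+ 2) ^+ 2).
  by rewrite /local_a1 /local_a2; ring.
by rewrite /C /D nA expr1n mulr1.
Qed.

Lemma local_structure h : reeb_near S F (pi h) ->
  structure_at h (fun V => local_alpha (V h)) (local_a1 h) (local_a2 h).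
Proof.
move=> Fh V W.
have [_ _ _ _ [/= nA _]] := stage_coef_G0 (iota := @iota2 R M S)
    (nbhs_singleton Fh).
have [x33 x13 x23] := coef_B2 hS Fh.
have [V33 V13 V23] := coef_B2_derive hS (V h) Fh.
have [W33 W13 W23] := coef_B2_derive hS (W h) Fh.
have t1E := stage_theta1E Fh; have t2E := stage_theta2E Fh; have t3E :=
    stage_theta3E Fh.
have G2 := @base_fun_B2 R M S.
(* A velocity on the unit circle at (C, D) is b (- D, C) with b = C dD - D dC. *)
have rot (v : tangent (B2 S) h) : v C = - D h * (C h * v D - D h * v C) /\ v D
    = C h * (C h * v D - D h * v C).
  have [_ _ _ _] := stage_coef_derive v Fh; rewrite -/C -/D => cd.
  have nA' : C h ^+ 2 + D h ^+ 2 = 1 := nA.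
  split.
    transitivity ((C h ^+ 2 + D h ^+ 2) * v C); first by rewrite nA' mul1r.
    transitivity (C h * (C h * v C + D h * v D) - D h *
        (C h * v D - D h * v C)); first by ring.
    by rewrite cd; ring.
  transitivity ((C h ^+ 2 + D h ^+ 2) * v D); first by rewrite nA' mul1r.
  transitivity (D h * (C h * v C + D h * v D) + C h * (C h * v D - D h * v C));
      first by ring.
  by rewrite cd; ring.
have [VC VD] := rot (V h); have [WC WD] := rot (W h).
have alE (v : tangent (B2 S) h) : local_alpha v = (C h * v D - D h * v C) +
  (p3 (pi h) * pull_eta F pi i1 v + q3 (pi h) * pull_eta F pi i2 v +
   - (p1 (pi h) + q2 (pi h)) / 2 * pull_eta F pi i3 v) by [].
have a1E : local_a1 h = (C h ^+ 2 - D h ^+ 2) * ((p1 (pi h) - q2 (pi h)) / 2) +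
    2 * C h * D h * p2 (pi h) by [].
have a2E : local_a2 h = - (2 * C h * D h) * ((p1 (pi h) - q2 (pi h)) / 2) +
    (C h ^+ 2 - D h ^+ 2) * p2 (pi h) by [].
rewrite /wedge !theta_stage !t1E !t2E !t3E !alE a1E a2E.
rewrite (dform_stage_theta1 hS G2 Fh) (dform_stage_theta2 hS G2 Fh)
    (dform_stage_theta3 hS G2 Fh).
rewrite V33 V13 V23 W33 W13 W23 x33 x13 x23 -(reeb_torsion_sym Fh).
rewrite -/pi -/C -/D -/(p1 (pi h)) -/(p2 (pi h)) -/(p3 (pi h)) -/(q2 (pi h))
    -/(q3 (pi h)).
have nA' : C h ^+ 2 + D h ^+ 2 = 1 := nA.
move: VC VD WC WD.
set bv := C h * V h D - D h * V h C; set bw := C h * W h D - D h * W h C.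
move=> -> -> -> ->.
have E1 := structure_algebra1 bv bw (pull_eta F pi i1 (V h))
    (pull_eta F pi i2 (V h)) (pull_eta F pi i3 (V h))
  (pull_eta F pi i1 (W h)) (pull_eta F pi i2 (W h)) (pull_eta F pi i3 (W h))
  (p1 (pi h)) (p2 (pi h)) (p3 (pi h)) (q2 (pi h)) (q3 (pi h)) nA'.
have E2 := structure_algebra2 bv bw (pull_eta F pi i1 (V h))
    (pull_eta F pi i2 (V h)) (pull_eta F pi i3 (V h))
  (pull_eta F pi i1 (W h)) (pull_eta F pi i2 (W h)) (pull_eta F pi i3 (W h))
  (p1 (pi h)) (p2 (pi h)) (p3 (pi h)) (q2 (pi h)) (q3 (pi h)) nA'.
move: E1 E2 nA'; cbv zeta; clearbody bv bw.
move: (C h) (D h) (pull_eta F pi i1 (V h)) (pull_eta F pi i2 (V h))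
    (pull_eta F pi i3 (V h))
  (pull_eta F pi i1 (W h)) (pull_eta F pi i2 (W h)) (pull_eta F pi i3 (W h))
  (p1 (pi h)) (p2 (pi h)) (p3 (pi h)) (q2 (pi h)) (q3 (pi h)).
move=> c s v1 v2 v3 w1 w2 w3 P1 P2 P3 Q2 Q3 E1 E2 cs1; split.
- apply: etrans (etrans _ E1) _; first by ring.
  ring.
- apply: etrans (etrans _ E2) _; first by ring.
  ring.
- transitivity ((c ^+ 2 + s ^+ 2) * (v1 * w2 - v2 * w1)); first by rewrite cs1;
    ring.
  ring.
Qed.

End Frame.

End LocalStructure.

Section GlobalStructure.
Variables (R : realType) (M : manifold R 3) (S : subRiemannianSurface M).
Hypothesis hS : contact S.
Notation pi := (stage_pi (@iota2 R M S)).

Lemma struct_const_Cinf (F : coframing M) k i j : Cinf M (struct_const F k i j).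
Proof. by apply: CinfN; have [_] := eta_smooth F k; exact. Qed.

Lemma pull_eta_scalar F k (h : B2 S) : scalar (@pull_eta R M F (B2 S) pi k h).
Proof. by move=> a u v; rewrite !pull_etaE dmap_linear etaD etaZ. Qed.

Lemma local_alpha_scalar F (h : B2 S) : scalar (@local_alpha R M S F h).
Proof.
move=> a u v; rewrite /local_alpha !pull_eta_scalar !tvecD !tvecZ.
ring.
Qed.

Lemma torsion1_Cinf (F : coframing M) : Cinf M (torsion1 F).
Proof.
apply: CinfM; last exact: Cinf_cst.
by apply: CinfB; exact: struct_const_Cinf.
Qed.

Lemma local_coef_Cinf F :
  [/\ Cinf (B2 S) (stage_coef (@iota2 R M S) F i1 i1),
      Cinf (B2 S) (stage_coef (@iota2 R M S) F i1 i2),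
      Cinf (B2 S) (fun h => stage_coef (@iota2 R M S) F i1 i1 h ^+ 2 -
          stage_coef (@iota2 R M S) F i1 i2 h ^+ 2) &
      Cinf (B2 S) (fun h => 2 * stage_coef (@iota2 R M S) F i1 i1 h *
          stage_coef (@iota2 R M S) F i1 i2 h)].
Proof.
have cC : Cinf (B2 S) (stage_coef (@iota2 R M S) F i1 i1) by exact:
    stage_coef_Cinf.
have dC : Cinf (B2 S) (stage_coef (@iota2 R M S) F i1 i2) by exact:
    stage_coef_Cinf.
split=> //; first by apply: CinfB; apply: CinfM.
by apply: CinfM => //; apply: CinfM => //; exact: Cinf_cst.
Qed.

Lemma local_a1_Cinf F : Cinf (B2 S) (local_a1 (S := S) F).
Proof.
have [_ _ H1 H2] := local_coef_Cinf F.
apply: CinfD; apply: CinfM => //; apply: (smooth_mapP pi); first exact: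
    torsion1_Cinf.
exact: struct_const_Cinf.
Qed.

Lemma local_a2_Cinf F : Cinf (B2 S) (local_a2 (S := S) F).
Proof.
have [_ _ H1 H2] := local_coef_Cinf F.
apply: CinfD; apply: CinfM => //; try exact: CinfN; apply: (smooth_mapP pi);
    first exact: torsion1_Cinf.
exact: struct_const_Cinf.
Qed.

Lemma local_alpha_Cinf F (V : vfield (B2 S)) :
  Cinf (B2 S) (fun h => local_alpha F (V h)).
Proof.
have [H1 H2 _ _] := local_coef_Cinf F.
have sM k i j : Cinf (B2 S) (struct_const F k i j \o pi).
  by apply: (smooth_mapP pi); exact: struct_const_Cinf.
have eM k := @pull_eta_smooth _ _ F (B2 S) pi k V.
apply: CinfD.
  by apply: CinfB; apply: CinfM => //; exact: vf_smooth.
apply: CinfD; last first.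
  apply: CinfM => //; apply: CinfM; last exact: Cinf_cst.
  by apply: CinfN; apply: CinfD; exact: sM.
by apply: CinfD; apply: CinfM => //; exact: sM.
Qed.

(** The lifts of E1 and E2 are combined by the inverse rotation; the lift of E3 is kept, because
    A_13 = A_23 = 0 and A_33 = 1 on [B2]. *)
Lemma theta_dual_lifts (h : B2 S) : exists T : 'I_3 -> vfield (B2 S),
  forall i j, theta i (T j h) = (i == j)%:R.
Proof.
have [F Fh] := reeb_frame_exists hS (pi h).
have [E1 E1P] := has_lifts2 hS Fh i1.
have [E2 E2P] := has_lifts2 hS Fh i2.
have [E3 E3P] := has_lifts2 hS Fh i3.
have [_ _ _ _ [/= nA _]] := stage_coef_G0 (iota := @iota2 R M S)
    (nbhs_singleton Fh).
have [x33 x13 x23] := coef_B2 hS Fh.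
have t1E := stage_theta1E Fh; have t2E := stage_theta2E Fh; have t3E :=
    stage_theta3E Fh.
set c := stage_coef (@iota2 R M S) F i1 i1 h in nA t1E t2E t3E *.
set s := stage_coef (@iota2 R M S) F i1 i2 h in nA t1E t2E t3E *.
have comb a b (V W : vfield (B2 S)) k : pull_eta F pi k
    (vfD (vfZ (Cinf_cst (B2 S) a) V) (vfZ (Cinf_cst (B2 S) b) W) h) =
   a * pull_eta F pi k (V h) + b * pull_eta F pi k (W h).
  change (pull_eta F pi k (a *: V h + b *: W h) = a * pull_eta F pi k (V h) + b
      * pull_eta F pi k (W h)).
  by rewrite /pull_eta !sum_I3 !tvecD !tvecZ; ring.
clearbody c s; have [n nE] : exists n, n = - s by exists (- s).
pose T (j : 'I_3) := nth E3 [:: vfD (vfZ (Cinf_cst (B2 S) c) E1)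
    (vfZ (Cinf_cst (B2 S) s) E2);
  vfD (vfZ (Cinf_cst (B2 S) n) E1) (vfZ (Cinf_cst (B2 S) c) E2)] j.
exists T; apply: ind_I3; apply: ind_I3; rewrite theta_stage ?t1E ?t2E ?t3E /T
    ?x13 ?x23 ?x33 /= ?comb ?E1P ?E2P ?E3P /=.
all: rewrite ?nE; first [by ring|by rewrite -[RHS]nA; ring].
Qed.

(** On the dual lifts, alpha could change only by a multiple of theta^3. This would add a multiple
    of the identity to the upper left torsion block, which is trace-free for both solutions. Pairing
    any field with T_2 then recovers all of alpha. *)
Lemma structure_at_unique (h : B2 S) al al' a1 a2 a1' a2' :
  structure_at h al a1 a2 -> structure_at h al' a1' a2' ->
  [/\ a1 = a1', a2 = a2' & forall V, al V = al' V].
Proof.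
move=> Hs Hs'; have [T TE] := theta_dual_lifts h.
have wE i j V W : wedge (@theta R M S i) (@theta R M S j) V W h =
  theta i (V h) * theta j (W h) - theta i (W h) * theta j (V h) by [].
have key (V W : vfield (B2 S)) : [/\
    (al V - al' V) * theta i2 (W h) - (al W - al' W) * theta i2 (V h) +
      ((a1 - a1') * wedge (@theta R M S i2) (@theta R M S i3) V W h +
       (a2 - a2') * wedge (@theta R M S i3) (@theta R M S i1) V W h) = 0 &
    - ((al V - al' V) * theta i1 (W h)) + (al W - al' W) * theta i1 (V h) +
      ((a2 - a2') * wedge (@theta R M S i2) (@theta R M S i3) V W h -
       (a1 - a1') * wedge (@theta R M S i3) (@theta R M S i1) V W h) = 0].
  have [e1 e2 _] := Hs V W; have [e1' e2' _] := Hs' V W.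
  by split; [move: e1; rewrite e1'|move: e2; rewrite e2']; move/eqP; rewrite
      -subr_eq0 => /eqP H; rewrite -[RHS]oppr0 -[X in _ = - X]H; ring.
have [k1 k2] := key (T i1) (T i2); have [k3 k4] := key (T i2) (T i3).
have [k5 k6] := key (T i3) (T i1).
move: k1 k2 k3 k4 k5 k6; rewrite !wE !TE /= => k1 k2 k3 k4 k5 k6.
have b1 : a1 = a1' by lra.
have b2 : a2 = a2' by lra.
have d2 : al (T i2) - al' (T i2) = 0 by lra.
split=> // V; have [+ _] := key V (T i2).
rewrite b1 b2 !subrr !mul0r !addr0 d2 TE /= mul0r subr0 mulr1 => /eqP.
by rewrite subr_eq0 => /eqP.
Qed.

Lemma structure_equations_at (alpha : form1 (B2 S)) (a1 a2 : B2 S -> R) :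
  (forall (i : 'I_3) (V W : vfield (B2 S)) (h : B2 S),
     dform (theta i) V W h = mx_wedge (conn alpha) (@theta R M S) i V W h +
        \sum_j torsion a1 a2 h i j * theta2 j V W h) <->
  forall h, structure_at h (fun V => alpha h (V h)) (a1 h) (a2 h).
Proof.
have E1 V W h : mx_wedge (conn alpha) (@theta R M S) i1 V W h +
    \sum_j torsion a1 a2 h i1 j * theta2 j V W h =
    alpha h (V h) * theta i2 (W h) - alpha h (W h) * theta i2 (V h) +
      (a1 h * wedge (@theta R M S i2) (@theta R M S i3) V W h +
       a2 h * wedge (@theta R M S i3) (@theta R M S i1) V W h).
  by rewrite /mx_wedge !sum_I3 /wedge !mxE /theta2 /= /wedge; ring.
have E2 V W h : mx_wedge (conn alpha) (@theta R M S) i2 V W h +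
    \sum_j torsion a1 a2 h i2 j * theta2 j V W h =
    - (alpha h (V h) * theta i1 (W h)) + alpha h (W h) * theta i1 (V h) +
      (a2 h * wedge (@theta R M S i2) (@theta R M S i3) V W h -
       a1 h * wedge (@theta R M S i3) (@theta R M S i1) V W h).
  by rewrite /mx_wedge !sum_I3 /wedge !mxE /theta2 /= /wedge; ring.
have E3 V W h : mx_wedge (conn alpha) (@theta R M S) i3 V W h +
    \sum_j torsion a1 a2 h i3 j * theta2 j V W h =
    wedge (@theta R M S i1) (@theta R M S i2) V W h.
  by rewrite /mx_wedge !sum_I3 /wedge !mxE /theta2 /= /wedge; ring.
split=> [H h V W|H].
  by rewrite -E1 -E2 -E3; split; exact: H.
apply: ind_I3 => V W h; have [H1 H2 H3] := H h V W.
- by rewrite E1.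
- by rewrite E2.
- by rewrite E3.
Qed.

(** The choice has no regularity in p; smoothness of what is built from it will come from
    [structure_at_unique]. *)
Lemma reeb_choice : exists Fr : M -> coframing M, forall p, reeb_near S (Fr p)
    p.
Proof.
exists (fun p => projT1 (cid (reeb_frame_exists hS (p : mtop M)))) => p.
exact: (projT2 (cid (reeb_frame_exists hS (p : mtop M)))).
Qed.

End GlobalStructure.

Lemma generated_derivable (R : realType) (X : Type) (G : set (X -> R))
    (c : R -> X) : (forall g, G g -> derivable (g \o c) 0 (1 : R)) ->
  forall f, generated G f -> derivable (f \o c) 0 (1 : R).
Proof.
move=> cG f fG; have [k [g [F [e [gG FS e0 fE]]]]] := fG (c 0).
by have [] := generated_derive (erefl (c 0)) cG gG FS e0 fE.
Qed.

(** * Rotations of coframes and fundamental vectors *)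

Section Rotation.
Variables (R : realType) (M : manifold R 3) (S : subRiemannianSurface M).
Hypothesis hS : contact S.

Lemma rotE (s : R) : [/\ rot s i1 i1 = cos s, rot s i1 i2 = - sin s,
  rot s i2 i1 = sin s, rot s i2 i2 = cos s & rot s i3 i3 = 1] /\
  [/\ rot s i1 i3 = 0, rot s i2 i3 = 0, rot s i3 i1 = 0 & rot s i3 i2 = 0].
Proof. by split; split; rewrite mxE. Qed.

(** The inverse undoes the one in [act]: the covectors are multiplied by [rot s], as in
    [fundamental]. *)
Definition rotate (s : R) (h : coframe M) : coframe M := act (invmx (rot s)) h.

Lemma covec_rotate s h i v :
  covec (rotate s h) i v = \sum_j rot s i j * covec h j v.
Proof. by rewrite /= invmxK. Qed.

Lemma rotate0 h : rotate 0 h = h.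
Proof.
have H i v : covec (rotate 0 h) i v = covec h i v.
  rewrite covec_rotate sum_I3.
  have [[e11 e12 e21 e22 e33] [e13 e23 e31 e32]] := rotE 0.
  move: i; apply: ind_I3; rewrite ?e11 ?e12 ?e21 ?e22 ?e33 ?e13 ?e23 ?e31 ?e32
      ?cos0 ?sin0; ring.
case: h H => q cv H; congr Coframe; apply/funext => i; apply/funext => v.
exact: H.
Qed.

Section Frame.
Variables (F : coframing M) (h : coframe M).
Hypothesis Fh : reeb_near S F (base h).
Hypothesis ah : adapted S h.

Let A (s : R) i k := \sum_j rot s i j * coef F h j k.

Lemma rotate_coefE s : [/\ A s i1 i1 = cos s * coef F h i1 i1 + sin s * coef F
    h i1 i2,
  A s i1 i2 = cos s * coef F h i1 i2 - sin s * coef F h i1 i1,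
  A s i1 i3 = cos s * coef F h i1 i3 - sin s * coef F h i2 i3,
  A s i2 i3 = sin s * coef F h i1 i3 + cos s * coef F h i2 i3 &
  A s i3 i3 = coef F h i3 i3] /\ in_G0 (A s).
Proof.
have [a31 a32 a22 a21 [nA a33]] := coef_in_G0 (nbhs_singleton Fh) ah.
have [[e11 e12 e21 e22 e33] [e13 e23 e31 e32]] := rotE s.
have cs := cos2Dsin2 s.
split; split; rewrite /A !sum_I3 ?e11 ?e12 ?e21 ?e22 ?e33 ?e13 ?e23 ?e31 ?e32
    ?a31 ?a32 ?a21 ?a22; try ring.
split.
  transitivity ((cos s ^+ 2 + sin s ^+ 2) *
      (coef F h i1 i1 ^+ 2 + coef F h i1 i2 ^+ 2)); first by ring.
  by rewrite cs nA mulr1.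
by rewrite !mul0r !add0r mul1r.
Qed.

Lemma rotate_coframe_at s : rotate s h = coframe_at F (A s) (base h).
Proof.
have [hc _ _ _] := ah; have [dF _ _ _ _] := nbhs_singleton Fh.
rewrite /rotate /act /coframe_at; congr Coframe.
apply/funext => i; apply/funext => v; rewrite invmxK /A !sum_I3.
by rewrite !(covec_dual dF hc) !sum_I3; ring.
Qed.

Lemma rotate_adapted s : adapted S (rotate s h).
Proof.
rewrite rotate_coframe_at; apply: adapted_coframe_at; first exact:
    nbhs_singleton Fh.
by have [] := rotate_coefE s.
Qed.

Lemma coef_rotate s i k : coef F (rotate s h) i k = A s i k.
Proof. by rewrite /coef covec_rotate. Qed.

End Frame.

Lemma rotate_T312 s (h : B1 S) (H : adapted S (rotate s (sval (sval h)))) :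
  T312 (exist _ (rotate s (sval (sval h))) H : B0 S) = 1.
Proof.
have [F Fh] := reeb_frame_exists hS (base (sval (sval h))).
rewrite (@T312E _ _ _ hS (exist _ (rotate s (sval (sval h))) H : B0 S) F Fh)
    coef_rotate.
have [[_ _ _ _ ->] _] := rotate_coefE Fh (svalP (sval h)) s.
exact: coef33_B1 Fh.
Qed.

Lemma rotate_exists (s : R) (h : B2 S) : exists h' : B2 S, coframe_of h' =
    rotate s (coframe_of h).
Proof.
have [F Fh] := reeb_frame_exists hS (base (coframe_of h)).
pose h0 : B0 S := exist _ (rotate s (coframe_of h))
    (rotate_adapted Fh (svalP (sval (sval h))) s).
pose h1 : B1 S := exist _ h0 (rotate_T312 (h := sval h) _).
suff H : T323 h1 = 0 /\ T331 h1 = 0 by exists (exist _ h1 H).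
rewrite /T323 /T331 (@T3E _ _ _ hS h1 F Fh) /=.
have [[_ _ e13 e23 _] _] := rotate_coefE Fh (svalP (sval (sval h))) s.
have [_ x13 x23] := coef_B2 hS (h := h) Fh.
have E13 : coef F (coframe_of h) i1 i3 = 0 := x13.
have E23 : coef F (coframe_of h) i2 i3 = 0 := x23.
split; rewrite [LHS]coef_rotate ?e13 ?e23 E13 E23; ring.
Qed.

(** Along t -> rot (t a) h the base point is fixed and dA = [lie_G2 a] A, so the eta-terms of alpha
    vanish and C dD - D dC = - a (C^2 + D^2). *)
Lemma fundamental_exists (F : coframing M) (a : R) (h : B2 S) :
  reeb_near S F (piB2 h) ->
  exists2 v : tangent (B2 S) h, fundamental a v & local_alpha F v = - a.
Proof.
move=> Fh; have ah := svalP (sval (sval h)).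
pose c t := projT1 (cid (rotate_exists (t * a) h)).
have cE t : coframe_of (c t) = rotate (t * a) (coframe_of h) by exact:
    (projT2 (cid (rotate_exists (t * a) h))).
have c0 : c 0 = h by do 3!apply: sig_inj; rewrite -/(coframe_of _) cE mul0r
    rotate0.
have lin : is_derive (0 : R) (1 : R) ( *%R^~ a) a.
  by apply: is_derive_eq; rewrite scaler0 add0r [_ *: _]mulr1.
have cD : is_derive (0 : R) (1 : R) (fun t : R => cos (t * a)) 0.
  have H := @is_derive1_comp R (@cos R) ( *%R^~ a) 0 _ _
      (is_derive_cos (0 * a)) lin.
  apply: is_derive_eq H _.
  by rewrite mul0r sin0 oppr0 mul0r.
have sD : is_derive (0 : R) (1 : R) (fun t : R => sin (t * a)) a.
  have H := @is_derive1_comp R (@sin R) ( *%R^~ a) 0 _ _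
      (is_derive_sin (0 * a)) lin.
  apply: is_derive_eq H _.
  by rewrite mul0r cos0 mul1r.
have rD i j : is_derive (0 : R) (1 : R) (fun t : R => rot (t * a) i j)
    (lie_G2 a i j).
  have -> : (fun t => rot (t * a) i j) = (fun t => nth 0 (nth [::]
      [:: [:: cos (t * a); - sin (t * a); 0]; [:: sin (t * a); cos (t * a); 0];
          [:: 0; 0; 1]] i) j).
    by apply/funext => t; rewrite mxE.
  rewrite [lie_G2 a i j]mxE; move: i j.
  apply: (@ind_I3 (fun i => forall j, is_derive _ _ _ _)); apply:
      (@ind_I3 (fun j => is_derive _ _ _ _)) => /=;
    do ?[exact: is_derive_cst|exact: cD|exact: sD].
  exact: is_deriveN.
have rsumD (w : 'I_3 -> R) i : is_derive (0 : R) (1 : R)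
    (fun t => \sum_j rot (t * a) i j * w j) (\sum_j lie_G2 a i j * w j).
  rewrite (_ : (fun t => _) = \sum_j (w j \*: (fun t => rot (t * a) i j))).
    rewrite (_ : \sum_j _ = \sum_j w j *: lie_G2 a i j).
      by apply: is_derive_sum => j; exact: is_deriveZ.
    by apply: eq_bigr => j _; rewrite mulrC.
  by apply/funext => t; rewrite fct_sumE; apply: eq_bigr => j _; rewrite mulrC.
have covE i (V : vfield M) t : covec (coframe_of (c t)) i
    (V (base (coframe_of (c t)))) =
    \sum_j rot (t * a) i j * covec (coframe_of h) j (V (piB2 h)).
  by rewrite cE covec_rotate.
have D0 g : B0_gen g -> derivable (g \o (fun t => sval (sval (c t)))) 0 (1 : R).
  move=> [[f fM <-]|[i [V ->]]].
    rewrite (_ : _ \o _ = cst (f (piB2 h))); first exact: derivable_cst.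
    apply/funext => t; rewrite /=; have := cE t; rewrite /coframe_of => ->.
    by [].
  rewrite (_ : _ \o _ = fun t => \sum_j rot (t * a) i j * covec (coframe_of h)
      j (V (piB2 h))).
    by have [] := rsumD (fun j => covec (coframe_of h) j (V (piB2 h))) i.
  by apply/funext => t; exact: covE.
(* The smooth functions of each stage are generated by restrictions from the preceding one, so
   derivability along c passes from [B0] to [B2]. *)
have D1 g : Cinf (B1 S) g -> derivable (g \o (fun t => sval (c t))) 0 (1 : R).
  apply: generated_derivable => _ [f fX <-].
  exact: (generated_derivable D0 fX).
have D2 g : Cinf (B2 S) g -> derivable (g \o c) 0 (1 : R).
  apply: generated_derivable => _ [f fX <-].
  exact: (D1 f fX).
exists (Tangent (velocity_tangent c0 D2)).
  exists c; first exact: cE.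
  by move=> f fX; rewrite /= /velocity_fun asboolT//; apply: derivableP; exact:
      D2.
have coefV i k : Tangent (velocity_tangent c0 D2)
    (stage_coef (@iota2 R M S) F i k) =
    \sum_j lie_G2 a i j * stage_coef (@iota2 R M S) F j k h.
  have fX := stage_coef_Cinf (@iota2 R M S) F i k.
  rewrite /= /velocity_fun asboolT//.
  have [_ <-] := rsumD (fun j => stage_coef (@iota2 R M S) F j k h) i.
  congr (derive _ _ _); apply/funext => t; exact: covE.
have baseV f : Cinf M f -> Tangent (velocity_tangent c0 D2)
    (f \o stage_pi (@iota2 R M S)) = 0.
  move=> fM; have fX := smooth_mapP (stage_pi (@iota2 R M S)) fM.
  rewrite /= /velocity_fun asboolT//.
  rewrite (_ : _ \o c = cst (f (piB2 h))); first exact: derive_cst.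
  by apply/funext => t; rewrite /=; have := cE t; rewrite /coframe_of => ->.
have etaV k : pull_eta F (stage_pi (@iota2 R M S)) k
    (Tangent (velocity_tangent c0 D2)) = 0.
  rewrite /pull_eta big1// => l _; rewrite baseV ?mulr0//; exact: fpot_Cinf.
rewrite /local_alpha !etaV !coefV !sum_I3 !mulr0 !addr0.
have [_ _ a22 a21 [/= nA _]] := stage_coef_G0 (iota := @iota2 R M S)
    (nbhs_singleton Fh).
rewrite a22 a21 ![lie_G2 _ _ _]mxE /=.
rewrite -[RHS]mulr1 -[X in _ = _ * X]nA; ring.
Qed.

End Rotation.

(** * The invariant *)

Section Existence.
Variables (R : realType) (M : manifold R 3) (S : subRiemannianSurface M).
Hypothesis hS : contact S.
Notation pi := (stage_pi (@iota2 R M S)).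

(** The dual coframe of a Reeb frame has the identity matrix, so it lies in [B2]. *)
Lemma piB2_surj (p : M) : exists h : B2 S, piB2 h = p.
Proof.
have [F Fp] := reeb_frame_exists hS p.
have F0 := nbhs_singleton Fp; have [[dE _] _ _ _ _] := F0.
pose I (i j : 'I_3) : R := (i == j)%:R.
have I0 : in_G0 I.
  by split; rewrite /I //= ?oppr0 ?oner_eq0 // expr1n expr0n addr0.
pose h0 : B0 S := exist _ (coframe_at F I p) (adapted_coframe_at F0 I0).
have cE i j : coef F (sval h0) i j = I i j.
  rewrite /coef /= (bigD1 j)//= big1 => [|k kj]; first by rewrite dE eqxx mulr1
      addr0.
  by rewrite dE (negPf kj) mulr0.
have T1 : T312 h0 = 1 by rewrite (T312E hS (h := h0) Fp) cE.
pose h1 : B1 S := exist _ h0 T1.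
have T2 : T323 h1 = 0 /\ T331 h1 = 0.
  rewrite /T323 /T331 (@T3E _ _ _ hS h1 F Fp) /=.
  by split; exact: cE.
by exists (exist _ h1 T2).
Qed.

(** By uniqueness any solution agrees at h with that of F, and the angle drops out of the sum of
    squares. *)
Lemma torsion_sqr_frame (alpha : form1 (B2 S)) (a1 a2 : B2 S -> R) (h : B2 S) F
    :
  structure_equations alpha a1 a2 -> reeb_near S F (piB2 h) ->
  a1 h ^+ 2 + a2 h ^+ 2 = torsion1 F (piB2 h) ^+ 2 + torsion2 F (piB2 h) ^+ 2.
Proof.
move=> [_ _ _ _ /structure_equations_at/(_ h) H] Fh.
have [-> -> _] := structure_at_unique hS H (local_structure hS Fh).
exact: (local_a_sqr (nbhs_singleton Fh)).
Qed.

Lemma structure_exists : exists (alpha : form1 (B2 S)) (a1 a2 : B2 S -> R),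
  structure_equations alpha a1 a2.
Proof.
have [Fr FrP] := reeb_choice hS.
pose alpha : form1 (B2 S) := fun h v => local_alpha (Fr (pi h)) v.
pose a1 (h : B2 S) := local_a1 (Fr (pi h)) h.
pose a2 (h : B2 S) := local_a2 (Fr (pi h)) h.
have sE h : structure_at h (fun V => alpha h (V h)) (a1 h) (a2 h).
  exact: (local_structure hS (FrP (pi h))).
(* Near each point the choice of frames may be replaced by a single frame. *)
have local (f : B2 S -> R) (f0 : coframing M -> B2 S -> R) :
    (forall F, Cinf (B2 S) (f0 F)) ->
    (forall F h, reeb_near S F (pi h) -> f h = f0 F h) -> Cinf (B2 S) f.
  move=> f0C fE; apply: generated_local => h.
  have nF : \forall q \near (pi h : mtop M), reeb_near S (Fr (pi h)) q.
    by have := FrP (pi h); exact: nbhs_interior.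
  have [C _] := cutoff_exists nF.
  exists (cut_fun C \o pi), (f0 (Fr (pi h))); split.
  - exact: (@base_fun_B2 R M S _ (cut_fun_Cinf C)).
  - exact: f0C.
  - by rewrite /= cut_fun1 oner_eq0.
  - by move=> x /cut_fun_supp; exact: fE.
have a1C : Cinf (B2 S) a1.
  apply: (local a1 (fun F => local_a1 F)) => [F|F h Fh]; first exact:
      local_a1_Cinf.
  by have [] := structure_at_unique hS (sE h) (local_structure hS Fh).
have a2C : Cinf (B2 S) a2.
  apply: (local a2 (fun F => local_a2 F)) => [F|F h Fh]; first exact:
      local_a2_Cinf.
  by have [] := structure_at_unique hS (sE h) (local_structure hS Fh).
have alphaC : smooth_form alpha.
  split=> [h|V]; first exact: local_alpha_scalar.
  apply: (local _ (fun F h => local_alpha F (V h))) => [F|F h Fh]; first exact: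
      local_alpha_Cinf.
  by have [_ _ ->] := structure_at_unique hS (sE h) (local_structure hS Fh).
exists alpha, a1, a2; split=> //; last exact/structure_equations_at.
split.
- have zeroC : smooth_form (fun (h : B2 S) (_ : tangent (B2 S) h) => 0 : R).
    by split=> [h k u v|V]; [rewrite mulr0 addr0|exact: Cinf_cst].
  have oppC : smooth_form (fun (h : B2 S) v => - alpha h v).
    have [aL aC] := alphaC.
    by split=> [h k u v|V]; [rewrite aL; ring|exact: CinfN].
  have E (i j : 'I_3) (b : form1 (B2 S)) :
      (forall h v, conn alpha v i j = b h v) ->
      smooth_form b -> smooth_form (fun (h : B2 S) v => conn alpha v i j).
    move=> bE; rewrite (_ : (fun h v => _) = b)//.
    by apply: functional_extensionality_dep => h; apply/funext => v.
  apply: ind_I3; apply: ind_I3;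
    by [apply: E zeroC => h v; rewrite mxE|apply: E alphaC => h v; rewrite
        mxE|apply: E oppC => h v; rewrite mxE].
(* [lie_G2 a] has - a in the entry where [conn alpha] has alpha. *)
- move=> h v; exists (- alpha h v).
  by apply/matrixP; apply: ind_I3; apply: ind_I3; rewrite !mxE /= ?opprK.
- move=> a h; have [v fv vE] := fundamental_exists hS a (FrP (pi h)).
  exists v => //.
  have {}vE : alpha h v = - a := vE.
  by apply/matrixP; apply: ind_I3; apply: ind_I3; rewrite !mxE /= ?vE ?opprK.
Qed.

End Existence.

(** * Transport along an isomorphism *)

Section Isomorphism.
Variables (R : realType) (M M' : manifold R 3).
Variables (f : smoothMap M M') (g : smoothMap M' M).
Hypotheses (fK : cancel f g) (gK : cancel g f).

Definition push_fun (V : vfield M) (y : M') (phi : M' -> R) : R :=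
  if `[< Cinf M' phi >] then V (g y) (phi \o f) else 0.

(** [dmap f (V (g y))] is a vector at f (g y), not at y by conversion; being a derivation is
    transported along [gK]. *)
Lemma push_tangent V y : push_fun V y \in is_tangent y.
Proof.
have K (w : (M' -> R) -> R) : derivation (f (g y)) w -> derivation y w.
  by rewrite gK.
by apply/asboolP/K; exact: tangentP (dmap f (V (g y))).
Qed.

Lemma push_smooth V phi : Cinf M' phi ->
  Cinf M' (fun y => Tangent (push_tangent V y) phi).
Proof.
move=> phiC; rewrite (_ : (fun y => _) = (fun q => V q (phi \o f)) \o g).
  by apply: (smooth_mapP g); apply: vf_smooth; exact: (smooth_mapP f).
by apply/funext => y; rewrite /= /push_fun asboolT.
Qed.

Definition push V : vfield M' := VField (push_smooth V).

Lemma pushE V q : push V (f q) = dmap f (V q).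
Proof.
apply: tangent_ext => phi phiC; rewrite dmapE// /= /push_fun asboolT//.
by rewrite fK.
Qed.

Lemma bracket_push V W q :
  bracket (push V) (push W) (f q) = dmap f (bracket V W q).
Proof.
apply: tangent_ext => phi phiC; rewrite dmapE// !bracketE !pushE.
have E (Z : vfield M) : (fun y => push Z y phi) \o f =
    (fun q => Z q (phi \o f)).
  by apply/funext => x; rewrite /comp pushE dmapE.
by rewrite !dmapE ?E//; exact: vf_smooth.
Qed.

(** The preimage is the image of v' under dg, moved from g (f q) to q. *)
Lemma dmap_surj q (v' : tangent M' (f q)) : exists v : tangent M q, v' = dmap f
    v.
Proof.
have [v vE] : exists v : tangent M q, forall psi, Cinf M psi -> v psi = v'
    (psi \o g).
  have K r : g (f q) = r -> exists v : tangent M r, forall psi, Cinf M psi -> v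
      psi = v' (psi \o g).
    by move=> <-; exists (dmap g v') => psi psiC; rewrite dmapE.
  exact: K (fK q).
exists v; apply: tangent_ext => phi phiC; rewrite dmapE// vE; last exact:
    (smooth_mapP f).
by congr (v' _); apply/funext => y; rewrite /= gK.
Qed.

Definition push_coframing (F : coframing M) : coframing M' :=
  Coframing (fun k => push (fvec F k))
    (fun l => smooth_mapP g (fpot_Cinf F l))
        (fun k l => smooth_mapP g (fcoef_Cinf F k l)).

Lemma eta_push F k q (v : tangent M q) :
  eta (push_coframing F) k (f q) (dmap f v) = eta F k q v.
Proof.
apply: eq_bigr => l _; rewrite dmapE /=; last by apply: (smooth_mapP g); exact:
    fpot_Cinf.
rewrite fK; congr (_ * v _); apply/funext => x; by rewrite /= fK.
Qed.

Lemma struct_const_push F k i j q :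
  struct_const (push_coframing F) k i j (f q) = struct_const F k i j q.
Proof. by rewrite /struct_const bracket_push eta_push. Qed.

Variables (S : subRiemannianSurface M) (S' : subRiemannianSurface M').
Hypothesis fS : is_isomorphism S S' f.

Lemma reeb_frame_push F q : reeb_frame S F q ->
  reeb_frame S' (push_coframing F) (f q).
Proof.
move=> [[dE dF] oE pE mE [e1 e2 e3]]; have [_ planeE metricE orientE] := fS.
split.
- split=> [k l|v']; first by rewrite [fvec _ _]/= pushE eta_push.
  have [v ->] := dmap_surj v'.
  apply: tangent_ext => phi phiC; rewrite tvec_sum dmapE// {1}(dF v) tvec_sum.
  apply: eq_bigr => k _.
  by rewrite !tvecZ eta_push [fvec (push_coframing F) k]/= pushE dmapE.
- by have := orientE _ _ _ oE; rewrite -!pushE.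
- rewrite -planeE; apply/seteqP; split=> [_ [v pv <-]|v'] /=.
    by rewrite eta_push; move: pv; rewrite pE.
  by have [v ->] := dmap_surj v'; rewrite eta_push => v0; exists v => //;
      rewrite pE.
- move=> w'; rewrite -planeE => -[w pw <-].
  by rewrite !eta_push metricE// mE.
- by rewrite !bracket_push !eta_push.
Qed.

Lemma reeb_near_push F p : reeb_near S F p ->
  reeb_near S' (push_coframing F) (f p).
Proof.
move=> Fp; have [C _] := cutoff_exists Fp.
(* This function is 1 at f p and nonzero only over good points, so it exhibits a neighbourhood of f
   p in M'. *)
have cg : Cinf M' (cut_fun C \o g) by apply: (smooth_mapP g); exact:
    cut_fun_Cinf.
have c0 : 0 < (cut_fun C \o g) (f p) by rewrite /= fK cut_fun1.
apply: filterS (mCinf_lt_near cg c0) => y cy.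
rewrite -(gK y); apply: reeb_frame_push; apply: (cut_fun_supp (C := C)).
by rewrite gt_eqF.
Qed.

End Isomorphism.

Theorem mainTheorem2 (R : realType) (M : manifold R 3)
    (S : subRiemannianSurface M) (hS : contact S) :
  exists (alpha : form1 (B2 S)) (a1 a2 : B2 S -> R),
    structure_equations alpha a1 a2 /\
    exists m : M -> R,
      unique (fun m0 : M -> R =>
        forall h : B2 S, a1 h ^+ 2 + a2 h ^+ 2 = m0 (piB2 h)) m /\
      forall (M' : manifold R 3) (S' : subRiemannianSurface M')
          (hS' : contact S') (f : smoothMap M M'),
        is_isomorphism S S' f ->
        forall (alpha' : form1 (B2 S')) (a1' a2' : B2 S' -> R) (m' : M' -> R),
          structure_equations alpha' a1' a2' ->
          (forall h : B2 S', a1' h ^+ 2 + a2' h ^+ 2 = m' (piB2 h)) ->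
          forall p : M, m' (f p) = m p.
Proof.
have [alpha [a1 [a2 sE]]] := structure_exists hS.
have [Fr FrP] := reeb_choice hS.
exists alpha, a1, a2; split=> //.
exists (fun p => torsion1 (Fr p) p ^+ 2 + torsion2 (Fr p) p ^+ 2); split.
  have mE (h : B2 S) : a1 h ^+ 2 + a2 h ^+ 2 =
      torsion1 (Fr (piB2 h)) (piB2 h) ^+ 2 + torsion2 (Fr (piB2 h)) (piB2 h) ^+ 2.
    exact: (torsion_sqr_frame hS sE (FrP (piB2 h))).
  split=> // m0 m0E; apply/funext => p; have [h <-] := piB2_surj hS p.
  by rewrite -m0E mE.
move=> M' S' hS' f fS alpha' a1' a2' m' sE' m'E p.
have [[g fK gK] _ _ _] := fS.
have [h hp] := piB2_surj hS' (f p).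
(* The frame pushed from M is a Reeb frame of S' near f p, so m' can be computed in it; its
   structure functions are those of the frame on M. *)
have Fp : reeb_near S' (push_coframing gK (Fr p)) (piB2 h).
  by rewrite hp; exact: (reeb_near_push fK gK fS (FrP p)).
rewrite -hp -m'E (torsion_sqr_frame hS' sE' Fp) hp.
by rewrite /torsion1 /torsion2 !struct_const_push.
Qed.
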